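(* Let $\sigma > 0$. If $f\in B_\sigma$, then $$|f(x)| \le \sigma \| t f(t) \|_{C(\mathbb{R})}, \qquad x\in\mathbb{R}. \qquad ( * )$$ Moreover, for a function $f\in B_\sigma$ that is real-valued on $\mathbb{R}$ with $f \not\equiv 0$, equality holds in $( * )$ for some point $x=x_0 \in \mathbb{R}$ if and only if $f(x) \equiv S \sin (\sigma x)/x$ for some real $S \ne 0$.
   Context: For $\gamma\ge 0$, $B_\gamma$ denotes the collection of entire functions of exponential type at most $\gamma$: an entire function $f:\mathbb{C}\to\mathbb{C}$ belongs to $B_\gamma$ if and only if for every $\varepsilon>0$ we have $\limsup_{|z|\to\infty}|f(z)|\exp(-(\gamma+\varepsilon)|z|)<\infty$. For a continuous function $g$ on $\mathbb{R}$, $\|g\|_{C(\mathbb{R})} = \|g(t)\|_{C(\mathbb{R})}= \sup_{t\in\mathbb{R}}|g(t)|$, which may be $+\infty$ (in which case $( * )$ holds trivially). The quotient $\sin(\sigma x)/x$ is understood as extended continuously (holomorphically) at $x=0$. *)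

(* Defs.v *)
From Stdlib Require Import Reals.
From Coquelicot Require Export Coquelicot.
Open Scope R_scope.

(* Complex differentiability: C is both the field of scalars and the target,
   so [ex_derive] here is [@ex_derive C_AbsRing C_NormedModule]. *)
Definition entire (f : C -> C) : Prop :=
  forall z : C, ex_derive f z.

(* limsup_{|z| -> oo} h(z), as the infimum over r of sup_{|z| > r} h(z). *)
Definition limsup_infty (h : C -> R) : Rbar :=
  Rbar_glb (fun s : Rbar => exists r : R,
    s = Lub_Rbar (fun y : R => exists z : C, r < Cmod z /\ y = h z)).

Definition exp_type (gamma : R) (f : C -> C) : Prop :=
  entire f /\
  forall eps : R, 0 < eps ->
    Rbar_lt
      (limsup_infty (fun z => Cmod (f z) * exp (- ((gamma + eps) * Cmod z))))
      p_infty.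

Definition sup_norm (g : R -> C) : Rbar :=
  Lub_Rbar (fun y : R => exists t : R, y = Cmod (g t)).

Definition Cexp (z : C) : C := (exp (Re z) * cos (Im z), exp (Re z) * sin (Im z)).

Definition Csin (z : C) : C :=
  ((Cexp (Ci * z) - Cexp (- (Ci * z))) / (2 * Ci))%C.

Lemma Csin_RtoC (x : R) : Csin (RtoC x) = RtoC (sin x).
Proof.
unfold Csin.
replace (Cexp (Ci * RtoC x)%C) with ((cos x, sin x) : C).
2:{ unfold Cexp, Ci, RtoC; simpl.
    replace (0 * x - 1 * 0) with 0 by ring.
    replace (0 * 0 + 1 * x) with x by ring.
    rewrite exp_0; apply injective_projections; simpl; ring. }
replace (Cexp (- (Ci * RtoC x))%C) with ((cos x, - sin x) : C).
2:{ unfold Cexp, Ci, RtoC; simpl.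
    replace (- (0 * x - 1 * 0)) with 0 by ring.
    replace (- (0 * 0 + 1 * x)) with (- x) by ring.
    rewrite exp_0, cos_neg, sin_neg; apply injective_projections; simpl; ring. }
unfold Cdiv, Cminus, Ci, RtoC.
apply injective_projections; simpl; field.
Qed.

(* The entire function sin (sigma z) / z; its removable singularity at 0 is
   filled by the limit sigma. *)
Definition sin_quot (sigma : R) (z : C) : C :=
  if Ceq_dec z 0%C then RtoC sigma else (Csin (sigma * z) / z)%C.

(* Main.v *)
Require Import Defs.
From Stdlib Require Import Reals.
From Coquelicot Require Import Coquelicot.
From Stdlib Require Import Lra Lia ZArith ClassicalEpsilon List.
From Stdlib Require FinFun.
Import ListNotations.
Open Scope R_scope.

(** After the rescaling [z |-> f (z / sigma)] the type is 1. Put [M] for the supremum of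
    [|t f(t)|] over the reals, assumed finite. The theorem is an extremal problem for the
    linear functional [f |-> f x], solved by an interpolation formula whose nodes are the
    points [t] with [cos t = 0], where [|sin|] is largest:

      f(w) = sum over nodes t of  f(t) sinc (w - t),      sinc z = sin z / z.

    For real [x] with [|x| < PI / 2] and a node [t], the number [sinc t * sinc (x - t)] equals
    [cos x / (t (t - x))], hence is positive, while [|f(t)| <= M / |t| = M |sinc t|].
    Therefore [|f(x)| <= M * sum sinc t sinc (x - t) = M sinc x], the last sum being the same
    formula applied to [f = sinc] ([le_rsinc]). For [|x| >= PI / 2] the bound
    [|f(x)| <= M / |x|] is already enough ([bound_on_reals]). Both bounds are strict away from
    [0] unless [M = 0], so equality anywhere entails equality at [0]
    ([extremal_at_0]); there every term of the dominated series must attain its bound, which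
    says that [f] and [f 0 * sinc] agree at all nodes ([extremal_at_nodes]). Their difference
    has vanishing interpolation series and is therefore zero ([extremal_is_sinc]).

    The interpolation formula comes from integrating [z f(z) / (cos z (z - w))] over the
    circles [|z| = N PI]. Its value is [2 PI (f(w) - partial sum) / cos w]
    ([cardinal_remainder]), and it is [O(1/N)] because [|cos z| >= exp |Im z| / 4] on these
    circles whereas [|z f(z)| <= (M + 1) exp |Im z|] everywhere
    ([exponential_type_bound], by Phragmen-Lindelof).

    The complex analysis is built on a single integral theorem: the mean value property over
    circles, for functions that are continuous on the closed disc and differentiable in it
    outside a finite set ([mean_value_exceptional]). It follows from Goursat's theorem for
    rectangles applied in logarithmic coordinates. Because finitely many points are
    forgiven, quotients with removable singularities can be integrated without knowing that
    they are differentiable there ([circle_integral_removable]). The same mean value property gives the maximum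
    principle, and Goursat's theorem and the extreme value theorem both rest on one
    bisection lemma ([cousin_rectangle]). *)

(** * Complex differentiability in the form of Caratheodory *)

Definition ccont (f : C -> C) (z : C) : Prop :=
  forall eps, 0 < eps -> exists del, 0 < del /\
    forall w, Cmod (w - z) < del -> Cmod (f w - f z) < eps.

(** The slope function [phi] replaces difference quotients, so that the product, chain and
    quotient rules become polynomial identities between slope functions. It also hands over,
    for a zero [z] of [f], the factorization [f w = phi w * (w - z)] that removing
    singularities needs. *)
Definition cderiv_at (f : C -> C) (z l : C) : Prop :=
  exists phi : C -> C, ccont phi z /\ phi z = l /\
    forall w, f w = (f z + phi w * (w - z))%C.

Definition cdiff (f : C -> C) (z : C) : Prop := exists l, cderiv_at f z l.

Lemma Cmod_sub_sym (x y : C) : Cmod (x - y) = Cmod (y - x).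
Proof.
  rewrite <- Cmod_opp. f_equal. ring.
Qed.

Lemma Cmod_sub_pos (x y : C) : x <> y -> 0 < Cmod (x - y).
Proof.
  intros H. apply Cmod_gt_0. intros E. apply H.
  replace x with (x - y + y)%C by ring. rewrite E. ring.
Qed.

Lemma Cmod_ge_sub (x y : C) : Cmod x - Cmod y <= Cmod (x - y).
Proof.
  pose proof (Cmod_triangle (x - y) y) as H.
  replace (x - y + y)%C with x in H by ring. lra.
Qed.

Lemma re_minus (z w : C) : Re (z - w) = Re z - Re w.
Proof. unfold Cminus. now rewrite re_plus, re_opp. Qed.

Lemma Im_le_Cmod (z : C) : Rabs (Im z) <= Cmod z.
Proof.
  eapply Rle_trans; [|apply Rmax_Cmod]. apply Rmax_r.
Qed.

Lemma Cmod_le_abs (z : C) : Cmod z <= Rabs (Re z) + Rabs (Im z).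
Proof.
  destruct z as [x y]; simpl.
  replace ((x, y) : C) with (RtoC x + Ci * RtoC y)%C.
  - eapply Rle_trans; [apply Cmod_triangle|].
    rewrite Cmod_mult, Cmod_Ci, !Cmod_R. lra.
  - unfold RtoC, Ci. apply injective_projections; simpl; ring.
Qed.

Lemma ccont_const (c z : C) : ccont (fun _ => c) z.
Proof.
  intros eps He. exists 1. split; [lra|]. intros w _.
  replace (c - c)%C with (RtoC 0) by ring. now rewrite Cmod_0.
Qed.

Lemma ccont_id (z : C) : ccont (fun w => w) z.
Proof.
  intros eps He. exists eps. auto.
Qed.

Lemma ccont_plus f g z : ccont f z -> ccont g z -> ccont (fun w => f w + g w)%C z.
Proof.
  intros Hf Hg eps He.
  destruct (Hf (eps/2)) as [d1 [Hd1 H1]]; [lra|].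
  destruct (Hg (eps/2)) as [d2 [Hd2 H2]]; [lra|].
  exists (Rmin d1 d2). split; [now apply Rmin_glb_lt|].
  intros w Hw.
  replace (f w + g w - (f z + g z))%C with ((f w - f z) + (g w - g z))%C by ring.
  eapply Rle_lt_trans; [apply Cmod_triangle|].
  pose proof (H1 w (Rlt_le_trans _ _ _ Hw (Rmin_l _ _))).
  pose proof (H2 w (Rlt_le_trans _ _ _ Hw (Rmin_r _ _))). lra.
Qed.

Lemma ccont_mult f g z : ccont f z -> ccont g z -> ccont (fun w => f w * g w)%C z.
Proof.
  intros Hf Hg eps He.
  set (A := Cmod (f z) + Cmod (g z) + 2).
  assert (HA : 2 <= A).
  { unfold A. pose proof (Cmod_ge_0 (f z)). pose proof (Cmod_ge_0 (g z)). lra. }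
  assert (He' : 0 < eps / (2 * A)) by (apply Rdiv_lt_0_compat; lra).
  destruct (Hf _ He') as [d1 [Hd1 H1]].
  destruct (Hg _ He') as [d2 [Hd2 H2]].
  destruct (Hg 1) as [d3 [Hd3 H3]]; [lra|].
  exists (Rmin d1 (Rmin d2 d3)). split; [repeat apply Rmin_glb_lt; auto|].
  intros w Hw.
  assert (W1 : Cmod (w - z) < d1) by (eapply Rlt_le_trans; [apply Hw|apply Rmin_l]).
  assert (W' : Cmod (w - z) < Rmin d2 d3) by (eapply Rlt_le_trans; [apply Hw|apply Rmin_r]).
  assert (W2 : Cmod (w - z) < d2) by (eapply Rlt_le_trans; [apply W'|apply Rmin_l]).
  assert (W3 : Cmod (w - z) < d3) by (eapply Rlt_le_trans; [apply W'|apply Rmin_r]).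
  specialize (H1 w W1). specialize (H2 w W2). specialize (H3 w W3).
  replace (f w * g w - f z * g z)%C
    with ((f w - f z) * g w + f z * (g w - g z))%C by ring.
  eapply Rle_lt_trans; [apply Cmod_triangle|]. rewrite !Cmod_mult.
  assert (Hgw : Cmod (g w) <= A).
  { pose proof (Cmod_ge_sub (g w) (g z)). unfold A.
    pose proof (Cmod_ge_0 (f z)). lra. }
  assert (Hfz : Cmod (f z) <= A).
  { unfold A. pose proof (Cmod_ge_0 (g z)). lra. }
  assert (E : eps / (2 * A) * A = eps / 2) by (field; lra).
  assert (Cmod (f w - f z) * Cmod (g w) <= eps / (2 * A) * A).
  { apply Rmult_le_compat; try apply Cmod_ge_0; lra. }
  assert (Cmod (f z) * Cmod (g w - g z) <= A * Cmod (g w - g z)).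
  { apply Rmult_le_compat_r; [apply Cmod_ge_0|lra]. }
  assert (A * Cmod (g w - g z) < A * (eps / (2 * A))).
  { apply Rmult_lt_compat_l; lra. }
  lra.
Qed.

Lemma ccont_comp f g z : ccont f z -> ccont g (f z) -> ccont (fun w => g (f w)) z.
Proof.
  intros Hf Hg eps He.
  destruct (Hg eps He) as [d [Hd H]].
  destruct (Hf d Hd) as [d' [Hd' H']].
  exists d'. split; auto.
Qed.

Lemma ccont_ext_loc f g z r : 0 < r ->
  (forall w, Cmod (w - z) < r -> f w = g w) -> ccont f z -> ccont g z.
Proof.
  intros Hr E Hf eps He.
  destruct (Hf eps He) as [d [Hd H]].
  exists (Rmin d r). split; [now apply Rmin_glb_lt|].
  intros w Hw.
  rewrite <- !E.
  - apply H. eapply Rlt_le_trans; [apply Hw|apply Rmin_l].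
  - replace (z - z)%C with (RtoC 0) by ring. now rewrite Cmod_0.
  - eapply Rlt_le_trans; [apply Hw|apply Rmin_r].
Qed.

Lemma ccont_neq_0 f z : ccont f z -> f z <> 0%C ->
  exists r, 0 < r /\ forall w, Cmod (w - z) < r -> f w <> 0%C.
Proof.
  intros Hf Hn.
  destruct (Hf (Cmod (f z))) as [d [Hd H]]; [now apply Cmod_gt_0|].
  exists d. split; auto. intros w Hw E.
  specialize (H w Hw). rewrite E, Cmod_sub_sym in H.
  replace (f z - 0)%C with (f z) in H by ring. lra.
Qed.

Lemma ccont_inv f z : ccont f z -> f z <> 0%C -> ccont (fun w => / f w)%C z.
Proof.
  intros Hf Hn eps He.
  pose proof (proj1 (Cmod_gt_0 (f z)) Hn) as Hp. set (a := Cmod (f z)) in *.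
  destruct (Hf (a / 2)) as [d1 [Hd1 H1]]; [lra|].
  destruct (Hf (eps * (a * a / 2))) as [d2 [Hd2 H2]].
  { apply Rmult_lt_0_compat; auto. nra. }
  exists (Rmin d1 d2). split; [now apply Rmin_glb_lt|].
  intros w Hw.
  specialize (H1 w (Rlt_le_trans _ _ _ Hw (Rmin_l _ _))).
  specialize (H2 w (Rlt_le_trans _ _ _ Hw (Rmin_r _ _))).
  assert (Ha : a / 2 < Cmod (f w)).
  { pose proof (Cmod_ge_sub (f z) (f w)). rewrite Cmod_sub_sym in H. unfold a in *. lra. }
  assert (Hw0 : f w <> 0%C) by (apply Cmod_gt_0; lra).
  replace (/ f w - / f z)%C with ((f z - f w) / (f w * f z))%C by (field; auto).
  rewrite Cmod_div, Cmod_mult by (apply Cmult_neq_0; auto).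
  rewrite Cmod_sub_sym. fold a.
  apply Rlt_div_l; [nra|].
  eapply Rlt_trans; [apply H2|]. apply Rmult_lt_compat_l; auto. nra.
Qed.

Lemma cderiv_cdiff f z l : cderiv_at f z l -> cdiff f z.
Proof. intros H; now exists l. Qed.

Lemma cdiff_ccont f z : cdiff f z -> ccont f z.
Proof.
  intros [l [phi [Hc [_ H]]]].
  apply (ccont_ext_loc (fun w => f z + phi w * (w + - z))%C f z 1); [lra| |].
  - intros w _. now rewrite (H w).
  - apply ccont_plus; [apply ccont_const|].
    apply ccont_mult; auto. apply ccont_plus; [apply ccont_id|apply ccont_const].
Qed.

Lemma cderiv_const c z : cderiv_at (fun _ => c) z 0%C.
Proof.
  exists (fun _ => 0%C). split; [apply ccont_const|]. split; auto. intros w; ring.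
Qed.

Lemma cderiv_id z : cderiv_at (fun w => w) z 1%C.
Proof.
  exists (fun _ => 1%C). split; [apply ccont_const|]. split; auto. intros w; ring.
Qed.

Lemma cderiv_plus f g z l m : cderiv_at f z l -> cderiv_at g z m ->
  cderiv_at (fun w => f w + g w)%C z (l + m)%C.
Proof.
  intros [p [Hp [Hl Hf]]] [q [Hq [Hm Hg]]].
  exists (fun w => p w + q w)%C. split; [now apply ccont_plus|].
  split; [now rewrite Hl, Hm|]. intros w. rewrite (Hf w), (Hg w). ring.
Qed.

Lemma cderiv_mult f g z l m : cderiv_at f z l -> cderiv_at g z m ->
  cderiv_at (fun w => f w * g w)%C z (l * g z + f z * m)%C.
Proof.
  intros Hf0 Hg0.
  pose proof (cdiff_ccont g z (cderiv_cdiff _ _ _ Hg0)) as Cg.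
  destruct Hf0 as [p [Hp [Hl Hf]]]. destruct Hg0 as [q [Hq [Hm Hg]]].
  exists (fun w => p w * g w + f z * q w)%C.
  split; [|split].
  - apply ccont_plus; apply ccont_mult; auto using ccont_const.
  - now rewrite Hl, Hm.
  - intros w. rewrite (Hf w) at 1. rewrite (Hg w). ring.
Qed.

Lemma cderiv_comp f g z l m : cderiv_at f z l -> cderiv_at g (f z) m ->
  cderiv_at (fun w => g (f w)) z (m * l)%C.
Proof.
  intros Hf0 Hg0.
  pose proof (cdiff_ccont f z (cderiv_cdiff _ _ _ Hf0)) as Cf.
  destruct Hf0 as [p [Hp [Hl Hf]]]. destruct Hg0 as [q [Hq [Hm Hg]]].
  exists (fun w => q (f w) * p w)%C. split; [|split].
  - apply ccont_mult; auto. now apply (ccont_comp f q).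
  - now rewrite Hl, Hm.
  - intros w. rewrite (Hg (f w)). rewrite (Hf w) at 2. ring.
Qed.

(** Nonvanishing everywhere makes the slope function of [/ f] global; [cdiff_inv] reduces to
    this case by changing [f] away from the point. *)
Lemma cderiv_inv f z l : cderiv_at f z l -> f z <> 0%C ->
  (forall w, f w <> 0%C) -> cderiv_at (fun w => / f w)%C z (- l / (f z * f z))%C.
Proof.
  intros Hf0 Hz Hn.
  pose proof (cdiff_ccont f z (cderiv_cdiff _ _ _ Hf0)) as Cf.
  destruct Hf0 as [p [Hp [Hl Hf]]].
  exists (fun w => (-(1) * p w) * / (f z * f w))%C. split; [|split].
  - apply ccont_mult; [apply ccont_mult; auto using ccont_const|].
    apply ccont_inv; [apply ccont_mult; auto using ccont_const|].
    apply Cmult_neq_0; auto.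
  - rewrite Hl. field. auto.
  - intros w. assert (E : (p w * (w - z))%C = (f w - f z)%C) by (rewrite (Hf w); ring).
    replace (- (1) * p w * / (f z * f w) * (w - z))%C
      with (- (p w * (w - z)) * / (f z * f w))%C by ring.
    rewrite E. field. auto.
Qed.

Lemma cderiv_eps f z l : cderiv_at f z l <->
  forall eps, 0 < eps -> exists del, 0 < del /\
    forall w, Cmod (w - z) < del -> Cmod (f w - f z - l * (w - z)) <= eps * Cmod (w - z).
Proof.
  split.
  - intros [p [Hp [Hl Hf]]] eps He.
    destruct (Hp eps He) as [d [Hd H]]. exists d. split; auto.
    intros w Hw. rewrite (Hf w).
    replace (f z + p w * (w - z) - f z - l * (w - z))%C
      with ((p w - p z) * (w - z))%C by (rewrite Hl; ring).
    rewrite Cmod_mult. apply Rmult_le_compat_r; [apply Cmod_ge_0|].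
    left; now apply H.
  - intros H.
    exists (fun w => if Ceq_dec w z then l else ((f w - f z) / (w - z))%C).
    split; [|split].
    + intros eps He. destruct (H (eps/2)) as [d [Hd H']]; [lra|].
      exists d. split; auto. intros w Hw.
      destruct (Ceq_dec z z) as [_|N]; [|now elim N].
      destruct (Ceq_dec w z) as [->|N].
      * replace (l - l)%C with (RtoC 0) by ring. now rewrite Cmod_0.
      * pose proof (Cmod_sub_pos w z N) as Hp.
        assert (Hne : (w - z)%C <> 0%C) by now apply Cmod_gt_0.
        replace ((f w - f z) / (w - z) - l)%C
          with ((f w - f z - l * (w - z)) / (w - z))%C by (field; auto).
        rewrite Cmod_div by auto. apply Rlt_div_l; auto.
        specialize (H' w Hw). nra.
    + destruct (Ceq_dec z z) as [_|N]; [auto|now elim N].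
    + intros w. destruct (Ceq_dec w z) as [->|N]; [ring|].
      assert (Hne : (w - z)%C <> 0%C) by (apply Cmod_gt_0, Cmod_sub_pos; auto).
      field; auto.
Qed.

Lemma cderiv_ext_loc f g z l r : 0 < r ->
  (forall w, Cmod (w - z) < r -> f w = g w) -> cderiv_at f z l -> cderiv_at g z l.
Proof.
  intros Hr E Hf. apply cderiv_eps. intros eps He.
  destruct (proj1 (cderiv_eps f z l) Hf eps He) as [d [Hd H]].
  exists (Rmin d r). split; [now apply Rmin_glb_lt|].
  intros w Hw. rewrite <- !E.
  - apply H. eapply Rlt_le_trans; [apply Hw|apply Rmin_l].
  - replace (z - z)%C with (RtoC 0) by ring. now rewrite Cmod_0.
  - eapply Rlt_le_trans; [apply Hw|apply Rmin_r].
Qed.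

Lemma cdiff_ext_loc f g z r : 0 < r ->
  (forall w, Cmod (w - z) < r -> f w = g w) -> cdiff f z -> cdiff g z.
Proof.
  intros Hr E [l H]. exists l. now apply (cderiv_ext_loc f g z l r).
Qed.

Lemma cdiff_ext f g z : (forall w, f w = g w) -> cdiff f z -> cdiff g z.
Proof.
  intros E. apply (cdiff_ext_loc f g z 1); [lra|auto].
Qed.

Lemma cdiff_const c z : cdiff (fun _ => c) z.
Proof. eexists; apply cderiv_const. Qed.

Lemma cdiff_id z : cdiff (fun w => w) z.
Proof. eexists; apply cderiv_id. Qed.

Lemma cdiff_plus f g z : cdiff f z -> cdiff g z -> cdiff (fun w => f w + g w)%C z.
Proof. intros [l Hl] [m Hm]; eexists; eapply cderiv_plus; eauto. Qed.

Lemma cdiff_mult f g z : cdiff f z -> cdiff g z -> cdiff (fun w => f w * g w)%C z.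
Proof. intros [l Hl] [m Hm]; eexists; eapply cderiv_mult; eauto. Qed.

Lemma cdiff_comp f g z : cdiff f z -> cdiff g (f z) -> cdiff (fun w => g (f w)) z.
Proof. intros [l Hl] [m Hm]; eexists; eapply cderiv_comp; eauto. Qed.

Lemma cdiff_opp f z : cdiff f z -> cdiff (fun w => - f w)%C z.
Proof.
  intros H. apply (cdiff_ext (fun w => (-(1)) * f w)%C); [intros; ring|].
  apply cdiff_mult; auto using cdiff_const.
Qed.

Lemma cdiff_minus f g z : cdiff f z -> cdiff g z -> cdiff (fun w => f w - g w)%C z.
Proof.
  intros Hf Hg. apply cdiff_plus; auto. now apply cdiff_opp.
Qed.

Lemma cdiff_inv f z : cdiff f z -> f z <> 0%C -> cdiff (fun w => / f w)%C z.
Proof.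
  intros Hf Hz.
  destruct (ccont_neq_0 f z (cdiff_ccont f z Hf) Hz) as [r [Hr Hn]].
  set (g := fun w => if Ceq_dec (f w) 0%C then RtoC 1 else f w).
  assert (Eg : forall w, Cmod (w - z) < r -> f w = g w).
  { intros w Hw. unfold g. destruct (Ceq_dec (f w) 0%C) as [e|]; auto.
    now elim (Hn w Hw). }
  assert (Ng : forall w, g w <> 0%C).
  { intros w. unfold g. destruct (Ceq_dec (f w) 0%C) as [e|N]; auto.
    intros E. injection E. lra. }
  apply (cdiff_ext_loc (fun w => / g w)%C _ z r); auto.
  - intros w Hw. now rewrite Eg.
  - destruct (cdiff_ext_loc f g z r Hr Eg Hf) as [l Hl].
    eexists. apply cderiv_inv; eauto.
Qed.

Lemma cdiff_div f g z : cdiff f z -> cdiff g z -> g z <> 0%C ->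
  cdiff (fun w => f w / g w)%C z.
Proof.
  intros Hf Hg Hz. apply cdiff_mult; auto. now apply cdiff_inv.
Qed.

Lemma ex_derive_cdiff (f : C -> C) (z : C) : ex_derive f z -> cdiff f z.
Proof.
  intros [l [_ H]]. exists l. apply cderiv_eps. intros eps He.
  assert (Hz : is_filter_lim (locally (T := AbsRing_UniformSpace C_AbsRing) z) z).
  { intros P HP. exact HP. }
  specialize (H z Hz (mkposreal eps He)).
  destruct H as [[d Hd] H]. exists d. split; auto.
  intros w Hw. specialize (H w Hw).
  change (Cmod ((f w - f z) - (w - z) * l) <= eps * Cmod (w - z)) in H.
  now rewrite (Cmult_comm l).
Qed.

(** * Bisection of rectangles and extreme values *)

Lemma functional_choice_on (A B : Type) (P : A -> B -> Prop) :
  (forall x, exists y, P x y) -> exists f : A -> B, forall x, P x (f x).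
Proof.
  intros H.
  exists (fun x => proj1_sig (constructive_indefinite_description _ (H x))).
  intros x. apply proj2_sig.
Qed.

Lemma nested_intervals (a b : nat -> R) :
  (forall n, a n <= a (S n)) -> (forall n, b (S n) <= b n) -> (forall n, a n <= b n) ->
  exists p, forall n, a n <= p <= b n.
Proof.
  intros Ha Hb Hab.
  assert (Hm : forall n k, a n <= a (n + k)%nat).
  { intros n k; induction k as [|k IH]; [rewrite Nat.add_0_r; lra|].
    rewrite Nat.add_succ_r. pose proof (Ha (n + k)%nat). lra. }
  assert (Hn : forall n k, b (n + k)%nat <= b n).
  { intros n k; induction k as [|k IH]; [rewrite Nat.add_0_r; lra|].
    rewrite Nat.add_succ_r. pose proof (Hb (n + k)%nat). lra. }
  assert (Hc : forall n m, a n <= b m).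
  { intros n m. apply Rle_trans with (a (n + m)%nat); [apply Hm|].
    eapply Rle_trans; [apply Hab|]. rewrite Nat.add_comm. apply Hn. }
  destruct (completeness (fun x => exists n, x = a n)) as [p [Hp1 Hp2]].
  - exists (b O). intros x [n ->]. apply Hc.
  - exists (a O). now exists O.
  - exists p. intros n. split.
    + apply Hp1. now exists n.
    + apply Hp2. intros x [m ->]. apply Hc.
Qed.

Lemma half_pow_small (d : R) : 0 < d -> exists n, (/ 2) ^ n < d.
Proof.
  intros Hd.
  destruct (pow_lt_1_zero (/ 2)) with (y := d) as [n Hn]; auto.
  - rewrite Rabs_pos_eq; lra.
  - exists n. specialize (Hn n (Nat.le_refl n)).
    rewrite Rabs_pos_eq in Hn; auto. apply pow_le; lra.
Qed.

(** If [Q] failed on the whole rectangle it would fail on one of the four quarters, and so on;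
    the nested rectangles shrink to a point, near which [Q] holds by assumption. All
    rectangles [(x, y, t)], with lower left corner [(x, y)] and sides [t * W] and [t * H], have
    the same shape: this keeps the squared diameter comparable to the area, as
    the local estimate in the theorem of Goursat requires. Either side may be degenerate. *)
Lemma cousin_rectangle (W H : R) (Q : R -> R -> R -> Prop) (x0 y0 : R) :
  0 <= W -> 0 <= H ->
  (forall x y t, 0 < t ->
     Q x y (t / 2) -> Q (x + t / 2 * W) y (t / 2) ->
     Q x (y + t / 2 * H) (t / 2) -> Q (x + t / 2 * W) (y + t / 2 * H) (t / 2) ->
     Q x y t) ->
  (forall p q, x0 <= p <= x0 + W -> y0 <= q <= y0 + H ->
     exists del, 0 < del /\ forall x y t, 0 < t < del ->
       x <= p <= x + t * W -> y <= q <= y + t * H -> Q x y t) ->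
  Q x0 y0 1.
Proof.
  intros HW HH Hadd Hloc.
  apply NNPP; intros HN.
  pose (Sub := fun s s' : R * R * R =>
    let '(x, y, t) := s in let '(x', y', t') := s' in
    0 < t -> t' = t / 2 /\ x <= x' /\ x' + t' * W <= x + t * W /\
      y <= y' /\ y' + t' * H <= y + t * H /\ (~ Q x y t -> ~ Q x' y' t')).
  assert (Hs : forall s, exists s', Sub s s').
  { intros [[x y] t]. unfold Sub.
    destruct (classic (0 < t)) as [Ht|]; [|now exists (x, y, t)].
    assert (Z : 0 <= t / 2 * W) by (apply Rmult_le_pos; lra).
    assert (Z' : 0 <= t / 2 * H) by (apply Rmult_le_pos; lra).
    assert (E : t * W = t / 2 * W + t / 2 * W) by field.
    assert (E' : t * H = t / 2 * H + t / 2 * H) by field.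
    destruct (classic (Q x y (t / 2))) as [Q1|Q1].
    2:{ exists (x, y, t / 2). intros _. repeat split; auto; lra. }
    destruct (classic (Q (x + t / 2 * W) y (t / 2))) as [Q2|Q2].
    2:{ exists (x + t / 2 * W, y, t / 2). intros _. repeat split; auto; lra. }
    destruct (classic (Q x (y + t / 2 * H) (t / 2))) as [Q3|Q3].
    2:{ exists (x, y + t / 2 * H, t / 2). intros _. repeat split; auto; lra. }
    exists (x + t / 2 * W, y + t / 2 * H, t / 2). intros _.
    repeat split; auto; try lra. }
  destruct (functional_choice_on _ _ _ Hs) as [next Hnext].
  pose (s := fun n => Nat.iter n next (x0, y0, 1)).
  pose (X := fun n => fst (fst (s n))).
  pose (Y := fun n => snd (fst (s n))).
  assert (Ht : forall n, snd (s n) = (/ 2) ^ n /\ ~ Q (X n) (Y n) ((/ 2) ^ n) /\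
     (X n <= X (S n) /\ X (S n) + (/ 2) ^ S n * W <= X n + (/ 2) ^ n * W) /\
     (Y n <= Y (S n) /\ Y (S n) + (/ 2) ^ S n * H <= Y n + (/ 2) ^ n * H)).
  { assert (Step : forall n, snd (s n) = (/ 2) ^ n -> ~ Q (X n) (Y n) ((/ 2) ^ n) ->
      snd (s (S n)) = (/ 2) ^ S n /\ ~ Q (X (S n)) (Y (S n)) ((/ 2) ^ S n) /\
     (X n <= X (S n) /\ X (S n) + (/ 2) ^ S n * W <= X n + (/ 2) ^ n * W) /\
     (Y n <= Y (S n) /\ Y (S n) + (/ 2) ^ S n * H <= Y n + (/ 2) ^ n * H)).
    { intros n E HQ. pose proof (Hnext (s n)) as K. unfold Sub in K.
      change (next (s n)) with (s (S n)) in K. unfold X, Y in *.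
      destruct (s n) as [[x y] t]. destruct (s (S n)) as [[x' y'] t']. simpl in *.
      subst t. assert (P : 0 < (/ 2) ^ n) by (apply pow_lt; lra).
      destruct (K P) as (E & K1 & K2 & K3 & K4 & K5).
      assert (E' : t' = / 2 * (/ 2) ^ n) by (rewrite E; field).
      rewrite <- E'. repeat split; auto. }
    intros n.
    assert (A : snd (s n) = (/ 2) ^ n /\ ~ Q (X n) (Y n) ((/ 2) ^ n)).
    { induction n as [|n [IH1 IH2]].
      - split; auto.
      - destruct (Step n IH1 IH2) as (A1 & A2 & _). auto. }
    destruct A as [A1 A2]. destruct (Step n A1 A2) as (_ & _ & B).
    auto. }
  assert (Hpos : forall n, 0 < (/ 2) ^ n) by (intros; apply pow_lt; lra).
  destruct (nested_intervals X (fun n => X n + (/ 2) ^ n * W)) as [p Hp].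
  { intros n; apply Ht. } { intros n; apply Ht. }
  { intros n. pose proof (Rmult_le_pos _ _ (Rlt_le _ _ (Hpos n)) HW). lra. }
  destruct (nested_intervals Y (fun n => Y n + (/ 2) ^ n * H)) as [q Hq].
  { intros n; apply Ht. } { intros n; apply Ht. }
  { intros n. pose proof (Rmult_le_pos _ _ (Rlt_le _ _ (Hpos n)) HH). lra. }
  destruct (Hloc p q) as [d [Hd Hl]].
  { pose proof (Hp O) as K. unfold X, s in K; simpl in K. lra. }
  { pose proof (Hq O) as K. unfold Y, s in K; simpl in K. lra. }
  destruct (half_pow_small d Hd) as [n Hn].
  destruct (Ht n) as (_ & K & _). apply K, Hl; auto.
Qed.

(** If there were no maximum, each point of [K] would have a neighbourhood on which [h] stays
    below a value that [h] takes elsewhere in [K]. This property of a rectangle is additive, so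
    it would hold for all of [K] at once, which is absurd. Upper semicontinuity is enough, and
    it allows the maximum of [Re] over a level set to be taken later. *)
Lemma closed_bounded_max (K : C -> Prop) (h : C -> R) (A : R) :
  (exists z, K z) ->
  (forall z, K z -> Cmod z <= A) ->
  (forall z, ~ K z -> exists r, 0 < r /\ forall w, Cmod (w - z) < r -> ~ K w) ->
  (forall z, K z -> forall eps, 0 < eps -> exists r, 0 < r /\
     forall w, K w -> Cmod (w - z) < r -> h w < h z + eps) ->
  exists p, K p /\ forall q, K q -> h q <= h p.
Proof.
  intros [z0 Hz0] HA Hcl Hc.
  apply NNPP; intros HN.
  assert (Hbig : forall p, K p -> exists q, K q /\ h p < h q).
  { intros p Hp. apply NNPP; intros F. apply HN. exists p. split; auto.
    intros q Hq. destruct (Rle_lt_dec (h q) (h p)); auto. elim F. now exists q. }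
  assert (HA0 : 0 <= A) by (eapply Rle_trans; [apply Cmod_ge_0|apply (HA z0 Hz0)]).
  pose (Q := fun x y t => exists q, K q /\
     forall a b, x <= a <= x + t * (2 * A) -> y <= b <= y + t * (2 * A) ->
       K (a, b) -> h (a, b) < h q).
  (* The square of side [2 * A] around the origin contains [K]. *)
  assert (HQ : Q (- A) (- A) 1).
  { apply (cousin_rectangle (2 * A) (2 * A) Q); try lra.
    - intros x y t Ht [q1 [K1 H1]] [q2 [K2 H2]] [q3 [K3 H3]] [q4 [K4 H4]].
      assert (M : forall u v, K u -> K v -> exists m, K m /\ h u <= h m /\ h v <= h m).
      { intros u v Ku Kv. destruct (Rle_lt_dec (h u) (h v)).
        - exists v; repeat split; auto; lra.
        - exists u; repeat split; auto; lra. }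
      destruct (M q1 q2 K1 K2) as [m [Km [L1 L2]]].
      destruct (M q3 q4 K3 K4) as [m' [Km' [L3 L4]]].
      destruct (M m m' Km Km') as [m2 [Km2 [L5 L6]]].
      exists m2. split; auto. intros a b Ha Hb Hk.
      assert (E : t * (2 * A) = t / 2 * (2 * A) + t / 2 * (2 * A)) by field.
      destruct (Rle_lt_dec a (x + t / 2 * (2 * A))); destruct (Rle_lt_dec b (y + t / 2 * (2 * A))).
      + specialize (H1 a b ltac:(lra) ltac:(lra) Hk). lra.
      + specialize (H3 a b ltac:(lra) ltac:(lra) Hk). lra.
      + specialize (H2 a b ltac:(lra) ltac:(lra) Hk). lra.
      + specialize (H4 a b ltac:(lra) ltac:(lra) Hk). lra.
    - intros p q _ _.
      assert (L : exists r m, 0 < r /\ K m /\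
                forall w, Cmod (w - (p, q)) < r -> K w -> h w < h m).
      { destruct (classic (K (p, q))) as [Kp|Kp].
        - destruct (Hbig _ Kp) as [m [Km Hm]].
          destruct (Hc _ Kp (h m - h (p, q))) as [r [Hr H]]; [lra|].
          exists r, m. repeat split; auto. intros w Hw Kw. specialize (H w Kw Hw). lra.
        - destruct (Hcl _ Kp) as [r [Hr H]]. exists r, z0. repeat split; auto.
          intros w Hw Kw. elim (H w Hw Kw). }
      destruct L as (r & m & Hr & Km & H).
      (* A square of side [t * 2 * A] has diameter at most [t * 4 * A]; the summand 1 covers [A = 0]. *)
      exists (r / (4 * A + 1)). split; [apply Rdiv_lt_0_compat; lra|].
      intros x y t Ht Hp Hq. exists m. split; auto. intros a b Ha Hb Kab.
      apply H; auto. eapply Rle_lt_trans; [apply Cmod_le_abs|]. simpl.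
      assert (T : t * (4 * A + 1) < r) by (apply Rlt_div_r; lra).
      assert (Rabs (a + - p) <= t * (2 * A)) by (apply Rabs_le; lra).
      assert (Rabs (b + - q) <= t * (2 * A)) by (apply Rabs_le; lra).
      lra. }
  destruct HQ as [q [Kq Hq]].
  pose proof (HA q Kq) as B.
  pose proof (re_le_Cmod q) as B1. pose proof (Im_le_Cmod q) as B2.
  apply Rabs_le_between in B1. apply Rabs_le_between in B2.
  destruct q as [a b]; simpl in *.
  specialize (Hq a b ltac:(lra) ltac:(lra) Kq). lra.
Qed.

(** * The theorem of Goursat for rectangles *)

Lemma continuous_eps (f : R -> R) (t : R) :
  continuous f t <-> forall eps, 0 < eps -> exists del, 0 < del /\
    forall s, Rabs (s - t) < del -> Rabs (f s - f t) < eps.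
Proof.
  split.
  - intros H eps He.
    destruct (proj1 (filterlim_locally _ _) H (mkposreal eps He)) as [d Hd].
    exists d. split; [apply cond_pos|]. exact Hd.
  - intros H. apply filterlim_locally. intros [eps He].
    destruct (H eps He) as [d [Hd K]]. exists (mkposreal d Hd). exact K.
Qed.

Lemma ccont_path (g : C -> C) (a b : R -> R) (t : R) :
  continuous a t -> continuous b t -> ccont g (a t, b t) ->
  forall eps, 0 < eps -> exists del, 0 < del /\
    forall s, Rabs (s - t) < del -> Cmod (g (a s, b s) - g (a t, b t)) < eps.
Proof.
  intros Ha Hb Hg eps He.
  destruct (Hg eps He) as [d [Hd H]].
  destruct (proj1 (continuous_eps a t) Ha (d / 2)) as [d1 [Hd1 H1]]; [lra|].
  destruct (proj1 (continuous_eps b t) Hb (d / 2)) as [d2 [Hd2 H2]]; [lra|].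
  exists (Rmin d1 d2). split; [now apply Rmin_glb_lt|].
  intros s Hs. apply H. eapply Rle_lt_trans; [apply Cmod_le_abs|]. simpl.
  specialize (H1 s (Rlt_le_trans _ _ _ Hs (Rmin_l _ _))).
  specialize (H2 s (Rlt_le_trans _ _ _ Hs (Rmin_r _ _))). unfold Rminus in *. lra.
Qed.

Lemma continuous_Re_path (g : C -> C) (a b : R -> R) (t : R) :
  continuous a t -> continuous b t -> ccont g (a t, b t) ->
  continuous (fun s => Re (g (a s, b s))) t.
Proof.
  intros Ha Hb Hg. apply continuous_eps. intros eps He.
  destruct (ccont_path g a b t Ha Hb Hg eps He) as [d [Hd H]].
  exists d. split; auto. intros s Hs. specialize (H s Hs).
  eapply Rle_lt_trans; [|apply H].
  eapply Rle_trans; [|apply re_le_Cmod]. unfold Cminus. rewrite re_plus, re_opp. apply Rle_refl.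
Qed.

Lemma continuous_Im_path (g : C -> C) (a b : R -> R) (t : R) :
  continuous a t -> continuous b t -> ccont g (a t, b t) ->
  continuous (fun s => Im (g (a s, b s))) t.
Proof.
  intros Ha Hb Hg. apply continuous_eps. intros eps He.
  destruct (ccont_path g a b t Ha Hb Hg eps He) as [d [Hd H]].
  exists d. split; auto. intros s Hs. specialize (H s Hs).
  eapply Rle_lt_trans; [|apply H].
  eapply Rle_trans; [|apply Im_le_Cmod]. unfold Cminus. rewrite im_plus, im_opp. apply Rle_refl.
Qed.

(** This is the imaginary part of the integral of [h z dz] along the boundary of the rectangle
    with lower left corner [(x, y)], width [w] and height [k]. In the coordinates [exp z], its
    vertical sides are integrals of a real part over circles, which is all that the mean value
    property needs. *)
Definition rect_flux (h : C -> C) (x y w k : R) : R :=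
  RInt (fun s => Im (h (s, y)) - Im (h (s, y + k))) x (x + w)
  + RInt (fun v => Re (h (x + w, v)) - Re (h (x, v))) y (y + k).

Lemma RInt_bound_pos (f : R -> R) (a L M : R) : 0 <= L ->
  (forall t, a <= t <= a + L -> continuous f t) ->
  (forall t, a <= t <= a + L -> Rabs (f t) <= M) ->
  Rabs (RInt f a (a + L)) <= L * M.
Proof.
  intros HL Hc HM.
  replace L with (a + L - a) at 2 by ring.
  apply abs_RInt_le_const; [lra| |auto].
  apply (ex_RInt_continuous (V := R_CompleteNormedModule)). rewrite Rmin_left, Rmax_right; auto; lra.
Qed.

Definition in_rect (x y w k a b : R) : Prop := x <= a <= x + w /\ y <= b <= y + k.

Section Goursat.
Variable h : C -> C.
Variables x0 y0 W H : R.
Hypothesis HW : 0 <= W.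
Hypothesis HH : 0 <= H.
Hypothesis Hd : forall a b, in_rect x0 y0 W H a b -> cdiff h (a, b).

Let cIm a b : in_rect x0 y0 W H a b -> continuous (fun s => Im (h (s, b))) a.
Proof.
  intros I. apply (continuous_Im_path h (fun s => s) (fun _ => b)).
  - apply continuous_id.
  - apply continuous_const.
  - apply cdiff_ccont; auto.
Qed.

Let cRe a b : in_rect x0 y0 W H a b -> continuous (fun v => Re (h (a, v))) b.
Proof.
  intros I. apply (continuous_Re_path h (fun _ => a) (fun v => v)).
  - apply continuous_const.
  - apply continuous_id.
  - apply cdiff_ccont; auto.
Qed.

Lemma ex_RInt_Im x b L : 0 <= L -> y0 <= b <= y0 + H -> x0 <= x -> x + L <= x0 + W ->
  ex_RInt (fun s => Im (h (s, b))) x (x + L).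
Proof.
  intros HL Hb H1 H2. apply (ex_RInt_continuous (V := R_CompleteNormedModule)).
  rewrite Rmin_left, Rmax_right by lra. intros z Hz. apply cIm. unfold in_rect; lra.
Qed.

Lemma ex_RInt_Re a y L : 0 <= L -> x0 <= a <= x0 + W -> y0 <= y -> y + L <= y0 + H ->
  ex_RInt (fun v => Re (h (a, v))) y (y + L).
Proof.
  intros HL Hb H1 H2. apply (ex_RInt_continuous (V := R_CompleteNormedModule)).
  rewrite Rmin_left, Rmax_right by lra. intros z Hz. apply cRe. unfold in_rect; lra.
Qed.

Lemma rect_flux_expand x y w k : 0 <= w -> 0 <= k -> x0 <= x -> x + w <= x0 + W ->
  y0 <= y -> y + k <= y0 + H ->
  rect_flux h x y w k =
   RInt (fun s => Im (h (s, y))) x (x + w) - RInt (fun s => Im (h (s, y + k))) x (x + w)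
  + (RInt (fun v => Re (h (x + w, v))) y (y + k) - RInt (fun v => Re (h (x, v))) y (y + k)).
Proof.
  intros. unfold rect_flux. f_equal.
  - apply (RInt_minus (V := R_CompleteNormedModule)); apply ex_RInt_Im; lra.
  - apply (RInt_minus (V := R_CompleteNormedModule)); apply ex_RInt_Re; lra.
Qed.

Lemma rect_flux_split x y w k : 0 <= w -> 0 <= k -> x0 <= x -> x + (w + w) <= x0 + W ->
  y0 <= y -> y + (k + k) <= y0 + H ->
  rect_flux h x y (w + w) (k + k) =
    rect_flux h x y w k + rect_flux h (x + w) y w k
    + rect_flux h x (y + k) w k + rect_flux h (x + w) (y + k) w k.
Proof.
  intros.
  rewrite !rect_flux_expand by lra.
  assert (CI : forall b, y0 <= b <= y0 + H ->
    RInt (fun s => Im (h (s, b))) x (x + (w + w)) =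
    RInt (fun s => Im (h (s, b))) x (x + w) + RInt (fun s => Im (h (s, b))) (x + w) (x + w + w)).
  { intros b Hb. rewrite <- Rplus_assoc. symmetry.
    apply (RInt_Chasles (V := R_CompleteNormedModule)); apply ex_RInt_Im; lra. }
  assert (CR : forall a, x0 <= a <= x0 + W ->
    RInt (fun s => Re (h (a, s))) y (y + (k + k)) =
    RInt (fun s => Re (h (a, s))) y (y + k) + RInt (fun s => Re (h (a, s))) (y + k) (y + k + k)).
  { intros b Hb. rewrite <- Rplus_assoc. symmetry.
    apply (RInt_Chasles (V := R_CompleteNormedModule)); apply ex_RInt_Re; lra. }
  rewrite !CI, !CR by lra.
  replace (x + (w + w)) with (x + w + w) by ring.
  replace (y + (k + k)) with (y + k + k) by ring. ring.
Qed.

(** The flux of an affine function [l * (z - p) + c] vanishes identically, so the flux of [h]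
    over a small rectangle around [p] is that of the remainder of order
    [eps * (diameter)], integrated over the perimeter. *)
Lemma rect_flux_local p q eps : in_rect x0 y0 W H p q -> 0 < eps ->
  exists del, 0 < del /\ forall x y t, 0 < t < del ->
    x <= p <= x + t * W -> y <= q <= y + t * H ->
    x0 <= x -> x + t * W <= x0 + W -> y0 <= y -> y + t * H <= y0 + H ->
    Rabs (rect_flux h x y (t * W) (t * H)) <= t * t * (2 * eps * ((W + H) * (W + H))).
Proof.
  intros Hpq He.
  destruct (Hd p q Hpq) as [[al be] Hl].
  destruct (proj1 (cderiv_eps _ _ _) Hl eps He) as [d [Hdp K]].
  exists (d / (W + H + 1)). split; [apply Rdiv_lt_0_compat; lra|].
  intros x y t Ht Hp Hq X1 X2 Y1 Y2.
  assert (T : t * (W + H) < d).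
  { assert (t * (W + H + 1) < d) by (apply Rlt_div_r; lra). lra. }
  assert (TW : 0 <= t * W) by (apply Rmult_le_pos; lra).
  assert (TH : 0 <= t * H) by (apply Rmult_le_pos; lra).
  assert (K' : forall a b, in_rect x y (t * W) (t * H) a b ->
     Rabs (Re (h (a, b)) - Re (h (p, q)) - (al * (a - p) - be * (b - q))) <= eps * (t * (W + H)) /\
     Rabs (Im (h (a, b)) - Im (h (p, q)) - (be * (a - p) + al * (b - q))) <= eps * (t * (W + H))).
  { intros a b [Ia Ib].
    assert (D : Cmod ((a, b) - (p, q)) <= t * (W + H)).
    { eapply Rle_trans; [apply Cmod_le_abs|]. simpl.
      assert (Rabs (a + - p) <= t * W) by (apply Rabs_le; lra).
      assert (Rabs (b + - q) <= t * H) by (apply Rabs_le; lra). lra. }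
    specialize (K (a, b) ltac:(lra)).
    assert (K2 : Cmod (h (a, b) - h (p, q) - (al, be) * ((a, b) - (p, q))) <= eps * (t * (W + H))).
    { eapply Rle_trans; [apply K|]. apply Rmult_le_compat_l; lra. }
    split; (eapply Rle_trans; [|apply K2]).
    - eapply Rle_trans; [|apply re_le_Cmod]. apply Req_le. apply f_equal. unfold Re, Im; simpl; ring.
    - eapply Rle_trans; [|apply Im_le_Cmod]. apply Req_le. apply f_equal. unfold Re, Im; simpl; ring. }
  assert (I1 : RInt (fun s => Im (h (s, y)) - Im (h (s, y + t * H)) + al * (t * H)) x (x + t * W)
       = RInt (fun s => Im (h (s, y)) - Im (h (s, y + t * H))) x (x + t * W) + al * (t * H) * (t * W)).
  { rewrite (RInt_plus (V := R_CompleteNormedModule) (fun s => Im (h (s, y)) - Im (h (s, y + t * H))) (fun _ => al * (t * H))).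
    - rewrite RInt_const. unfold plus, scal; simpl; unfold mult; simpl. ring.
    - apply (ex_RInt_minus (V := R_CompleteNormedModule)); apply ex_RInt_Im; lra.
    - apply ex_RInt_const. }
  assert (I2 : RInt (fun v => Re (h (x + t * W, v)) - Re (h (x, v)) - al * (t * W)) y (y + t * H)
       = RInt (fun v => Re (h (x + t * W, v)) - Re (h (x, v))) y (y + t * H) - al * (t * H) * (t * W)).
  { rewrite (RInt_minus (V := R_CompleteNormedModule) (fun v => Re (h (x + t * W, v)) - Re (h (x, v))) (fun _ => al * (t * W))).
    - rewrite RInt_const. unfold minus, plus, opp, scal; simpl; unfold mult; simpl. ring.
    - apply (ex_RInt_minus (V := R_CompleteNormedModule)); apply ex_RInt_Re; lra.
    - apply ex_RInt_const. }
  assert (E : rect_flux h x y (t * W) (t * H) =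
     RInt (fun s => Im (h (s, y)) - Im (h (s, y + t * H)) + al * (t * H)) x (x + t * W) +
     RInt (fun v => Re (h (x + t * W, v)) - Re (h (x, v)) - al * (t * W)) y (y + t * H)).
  { rewrite I1, I2. unfold rect_flux. ring. }
  rewrite E.
  assert (B1 : Rabs (RInt (fun s => Im (h (s, y)) - Im (h (s, y + t * H)) + al * (t * H)) x (x + t * W))
       <= t * W * (2 * (eps * (t * (W + H))))).
  { apply RInt_bound_pos; auto.
    - intros s Hs. apply (continuous_plus (V := R_NormedModule)); [|apply continuous_const].
      apply (continuous_minus (V := R_NormedModule)); apply cIm; unfold in_rect; lra.
    - intros s Hs.
      destruct (K' s y) as [_ U1]; [unfold in_rect; lra|].
      destruct (K' s (y + t * H)) as [_ U2]; [unfold in_rect; lra|].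
      apply Rabs_le_between in U1. apply Rabs_le_between in U2. apply Rabs_le. lra. }
  assert (B2 : Rabs (RInt (fun v => Re (h (x + t * W, v)) - Re (h (x, v)) - al * (t * W)) y (y + t * H))
       <= t * H * (2 * (eps * (t * (W + H))))).
  { apply RInt_bound_pos; auto.
    - intros s Hs. apply (continuous_minus (V := R_NormedModule)); [|apply continuous_const].
      apply (continuous_minus (V := R_NormedModule)); apply cRe; unfold in_rect; lra.
    - intros s Hs.
      destruct (K' x s) as [U1 _]; [unfold in_rect; lra|].
      destruct (K' (x + t * W) s) as [U2 _]; [unfold in_rect; lra|].
      apply Rabs_le_between in U1. apply Rabs_le_between in U2. apply Rabs_le. lra. }
  eapply Rle_trans; [apply Rabs_triang|].
  replace (t * t * (2 * eps * ((W + H) * (W + H))))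
    with (t * W * (2 * (eps * (t * (W + H)))) + t * H * (2 * (eps * (t * (W + H))))) by ring.
  lra.
Qed.

(** The local estimate is additive over
    subdivisions into quarters, because [t * t] is four times [(t / 2) * (t / 2)], and hence
    passes to the whole rectangle with [eps] arbitrary. *)
Lemma goursat_rectangle : rect_flux h x0 y0 W H = 0.
Proof.
  assert (Hall : forall eps, 0 < eps -> Rabs (rect_flux h x0 y0 W H) <= 2 * eps * ((W + H) * (W + H))).
  { intros eps He.
    pose (Q := fun x y t => x0 <= x -> x + t * W <= x0 + W -> y0 <= y -> y + t * H <= y0 + H ->
      Rabs (rect_flux h x y (t * W) (t * H)) <= t * t * (2 * eps * ((W + H) * (W + H)))).
    assert (HQ : Q x0 y0 1).
    { apply (cousin_rectangle W H Q); auto.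
      - intros x y t Ht Q1 Q2 Q3 Q4 X1 X2 Y1 Y2. unfold Q in *.
        assert (TW : 0 <= t / 2 * W) by (apply Rmult_le_pos; lra).
        assert (TH : 0 <= t / 2 * H) by (apply Rmult_le_pos; lra).
        assert (EW : t * W = t / 2 * W + t / 2 * W) by field.
        assert (EH : t * H = t / 2 * H + t / 2 * H) by field.
        rewrite EW, EH in *. rewrite rect_flux_split by lra.
        specialize (Q1 ltac:(lra) ltac:(lra) ltac:(lra) ltac:(lra)).
        specialize (Q2 ltac:(lra) ltac:(lra) ltac:(lra) ltac:(lra)).
        specialize (Q3 ltac:(lra) ltac:(lra) ltac:(lra) ltac:(lra)).
        specialize (Q4 ltac:(lra) ltac:(lra) ltac:(lra) ltac:(lra)).
        apply Rabs_le_between in Q1. apply Rabs_le_between in Q2.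
        apply Rabs_le_between in Q3. apply Rabs_le_between in Q4.
        apply Rabs_le. lra.
      - intros p q Hp Hq.
        destruct (rect_flux_local p q eps (conj Hp Hq) He) as [d [Hd0 K]].
        exists d. split; auto. }
    unfold Q in HQ. rewrite !Rmult_1_l in HQ. apply HQ; lra. }
  apply Rabs_eq_0. apply Rle_antisym; [|apply Rabs_pos].
  apply Rnot_lt_le. intros Hlt.
  set (a := Rabs (rect_flux h x0 y0 W H)) in *.
  set (m := (W + H) * (W + H)) in *.
  assert (Hm : 0 <= m) by (apply Rmult_le_pos; lra).
  specialize (Hall (a / (4 * (m + 1)))).
  assert (0 < a / (4 * (m + 1))) by (apply Rdiv_lt_0_compat; lra).
  specialize (Hall ltac:(auto)).
  assert (2 * (a / (4 * (m + 1))) * m = a * (m / (m + 1)) / 2) by (field; lra).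
  assert (m / (m + 1) <= 1) by (apply Rle_div_l; lra).
  nra.
Qed.
End Goursat.

(** * Local expansions and the complex exponential *)

Lemma exp_monotone (x y : R) : x <= y -> exp x <= exp y.
Proof.
  intros [H| ->]; [left; now apply exp_increasing|lra].
Qed.

Lemma mvt_from_0 (f df : R -> R) (x : R) : (forall t, is_derive f t (df t)) ->
  exists c, Rabs c <= Rabs x /\ f x = f 0 + df c * x.
Proof.
  intros Hd.
  destruct (MVT_gen f 0 x df) as [c [Hc E]].
  - intros; apply Hd.
  - intros t _. apply continuity_pt_filterlim.
    apply (ex_derive_continuous (V := R_NormedModule)). eexists; apply Hd.
  - exists c. split; [|lra].
    unfold Rmin, Rmax in Hc. destruct (Rle_dec 0 x).
    + rewrite !Rabs_pos_eq; lra.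
    + rewrite !Rabs_left1; lra.
Qed.

Lemma Rabs_sin_le (x : R) : Rabs (sin x) <= Rabs x.
Proof.
  destruct (mvt_from_0 sin cos x) as [c [_ E]].
  { intros t. auto_derive; auto. ring. }
  rewrite E, sin_0, Rplus_0_l, Rabs_mult.
  assert (Rabs (cos c) <= 1) by (apply Rabs_le, COS_bound).
  pose proof (Rabs_pos x). nra.
Qed.

Lemma cos_quadratic (y : R) : Rabs (cos y - 1) <= y ^ 2.
Proof.
  replace y with (2 * (y / 2)) at 1 by field. rewrite cos_2a_sin.
  pose proof (Rabs_sin_le (y / 2)) as H.
  assert (E : (sin (y/2)) ^ 2 <= (y / 2) ^ 2).
  { rewrite <- (pow2_abs (sin (y/2))), <- (pow2_abs (y / 2)).
    apply pow_incr. split; [apply Rabs_pos|auto]. }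
  apply Rabs_le. pose proof (pow2_ge_0 (sin (y/2))). nra.
Qed.

Lemma sin_cubic (x : R) : Rabs (sin x - x) <= Rabs x ^ 3.
Proof.
  destruct (mvt_from_0 (fun t => sin t - t) (fun t => cos t - 1) x) as [c [Hc E]].
  { intros t. auto_derive; auto. ring. }
  rewrite E, sin_0, Rminus_0_r, Rplus_0_l, Rabs_mult.
  assert (Rabs (cos c - 1) <= Rabs x ^ 2).
  { eapply Rle_trans; [apply cos_quadratic|]. rewrite <- (pow2_abs c).
    apply pow_incr. split; [apply Rabs_pos|auto]. }
  pose proof (Rabs_pos x). simpl in *. nra.
Qed.

Lemma exp_quadratic (x : R) : Rabs x <= 1 / 2 -> Rabs (exp x - 1 - x) <= 2 * x ^ 2.
Proof.
  intros Hx. apply Rabs_le_between in Hx.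
  pose proof (exp_ineq1_le x) as L. pose proof (exp_ineq1_le (- x)) as L'.
  rewrite exp_Ropp in L'.
  assert (U : exp x * (1 - x) <= 1).
  { pose proof (exp_pos x). replace 1 with (exp x * / exp x) at 2 by (field; lra).
    apply Rmult_le_compat_l; lra. }
  apply Rabs_le. split; [nra|].
  assert (1 <= (1 + x + 2 * x ^ 2) * (1 - x)) by nra.
  assert (exp x <= 1 + x + 2 * x ^ 2); [|lra].
  apply Rmult_le_reg_r with (1 - x); lra.
Qed.

Lemma cosh_quadratic (y : R) : Rabs y <= 1 / 2 -> Rabs (cosh y - 1) <= 2 * y ^ 2.
Proof.
  intros Hy. pose proof (exp_quadratic y Hy) as H1.
  pose proof (exp_quadratic (- y)) as H2. rewrite Rabs_Ropp in H2. specialize (H2 Hy).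
  apply Rabs_le_between in H1. apply Rabs_le_between in H2.
  unfold cosh. apply Rabs_le. replace ((- y) ^ 2) with (y ^ 2) in H2 by ring. lra.
Qed.

Lemma sinh_cubic (y : R) : Rabs y <= 1 / 2 -> Rabs (sinh y - y) <= 2 * Rabs y ^ 3.
Proof.
  intros Hy.
  destruct (mvt_from_0 (fun t => sinh t - t) (fun t => cosh t - 1) y) as [c [Hc E]].
  { intros t. unfold sinh, cosh. auto_derive; auto. field. }
  rewrite E, sinh_0, Rminus_0_r, Rplus_0_l, Rabs_mult.
  assert (Rabs (cosh c - 1) <= 2 * Rabs y ^ 2).
  { eapply Rle_trans; [apply cosh_quadratic; lra|]. rewrite <- (pow2_abs c).
    apply Rmult_le_compat_l; [lra|].
    apply pow_incr. split; [apply Rabs_pos|auto]. }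
  pose proof (Rabs_pos y). simpl in *. nra.
Qed.

Lemma Cexp_plus (z w : C) : Cexp (z + w) = (Cexp z * Cexp w)%C.
Proof.
  destruct z as [x y], w as [u v]. unfold Cexp; simpl.
  rewrite exp_plus, cos_plus, sin_plus.
  apply injective_projections; simpl; ring.
Qed.

Lemma Cexp_0 : Cexp 0 = 1%C.
Proof.
  unfold Cexp; simpl. rewrite exp_0, cos_0, sin_0.
  apply injective_projections; simpl; ring.
Qed.

Lemma Cmod_Cexp (z : C) : Cmod (Cexp z) = exp (Re z).
Proof.
  unfold Cmod, Cexp. simpl.
  replace (exp (Re z) * cos (Im z) * (exp (Re z) * cos (Im z) * 1) +
           exp (Re z) * sin (Im z) * (exp (Re z) * sin (Im z) * 1))
    with (exp (Re z) ^ 2 * (Rsqr (sin (Im z)) + Rsqr (cos (Im z)))) by (unfold Rsqr; ring).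
  rewrite sin2_cos2, Rmult_1_r. apply sqrt_pow2. left; apply exp_pos.
Qed.

Lemma Cexp_quadratic (z : C) : Cmod z <= 1 / 2 -> Cmod (Cexp z - 1 - z) <= 20 * Cmod z ^ 2.
Proof.
  intros Hz. eapply Rle_trans; [apply Cmod_le_abs|].
  pose proof (re_le_Cmod z) as Hx. pose proof (Im_le_Cmod z) as Hy.
  destruct z as [x y]. unfold Re, Im in Hx, Hy. simpl in Hx, Hy. set (m := Cmod (x, y)) in *.
  assert (E1 : Rabs (exp x - 1 - x) <= 2 * m ^ 2).
  { eapply Rle_trans; [apply exp_quadratic; lra|]. rewrite <- (pow2_abs x).
    apply Rmult_le_compat_l; [lra|]. apply pow_incr; split; [apply Rabs_pos|auto]. }
  assert (E2 : Rabs (cos y - 1) <= m ^ 2).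
  { eapply Rle_trans; [apply cos_quadratic|]. rewrite <- (pow2_abs y).
    apply pow_incr; split; [apply Rabs_pos|auto]. }
  assert (E3 : Rabs (sin y - y) <= m ^ 2).
  { eapply Rle_trans; [apply sin_cubic|]. pose proof (Rabs_pos y).
    assert (Rabs y ^ 3 <= m ^ 3) by (apply pow_incr; lra). simpl in *. nra. }
  assert (E4 : Rabs (sin y) <= m) by (eapply Rle_trans; [apply Rabs_sin_le|auto]).
  assert (Hm : 0 <= m) by apply Cmod_ge_0.
  assert (E5 : exp x <= 3).
  { apply Rabs_le_between in E1. apply Rabs_le_between in Hx. nra. }
  pose proof (exp_pos x).
  assert (R1 : Rabs (exp x * cos y - 1 - x) <= 5 * m ^ 2).
  { replace (exp x * cos y - 1 - x) with (exp x * (cos y - 1) + (exp x - 1 - x)) by ring.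
    eapply Rle_trans; [apply Rabs_triang|]. rewrite Rabs_mult, (Rabs_pos_eq (exp x)) by lra.
    pose proof (Rabs_pos (cos y - 1)). nra. }
  assert (E6 : Rabs (exp x - 1) <= 2 * m).
  { replace (exp x - 1) with ((exp x - 1 - x) + x) by ring.
    eapply Rle_trans; [apply Rabs_triang|]. nra. }
  assert (R2 : Rabs (exp x * sin y - y) <= 5 * m ^ 2).
  { replace (exp x * sin y - y) with ((exp x - 1) * sin y + (sin y - y)) by ring.
    eapply Rle_trans; [apply Rabs_triang|]. rewrite Rabs_mult.
    pose proof (Rabs_pos (exp x - 1)). pose proof (Rabs_pos (sin y)).
    assert (Rabs (exp x - 1) * Rabs (sin y) <= 2 * m * m) by (apply Rmult_le_compat; auto).
    nra. }
  unfold Re, Im, Cexp. simpl.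
  replace (exp x * cos y + - (1) + - x) with (exp x * cos y - 1 - x) by ring.
  replace (exp x * sin y + - 0 + - y) with (exp x * sin y - y) by ring.
  simpl in *. nra.
Qed.

Lemma cdiff_Cexp (z : C) : cdiff Cexp z.
Proof.
  assert (H0 : cderiv_at Cexp 0 1%C).
  { apply cderiv_eps. intros eps He. exists (Rmin (1 / 2) (eps / 20)).
    split; [apply Rmin_glb_lt; lra|]. intros w Hw.
    pose proof (Rmin_l (1/2) (eps / 20)). pose proof (Rmin_r (1/2) (eps / 20)).
    rewrite Cexp_0. replace (Cexp w - 1 - 1 * (w - 0))%C with (Cexp w - 1 - w)%C by ring.
    replace (w - 0)%C with w in * by ring.
    eapply Rle_trans; [apply Cexp_quadratic; lra|].
    pose proof (Cmod_ge_0 w). simpl. nra. }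
  apply (cdiff_ext (fun w => Cexp z * Cexp (w - z))%C).
  { intros w. rewrite <- Cexp_plus. f_equal. ring. }
  apply cdiff_mult; [apply cdiff_const|].
  apply (cdiff_comp (fun w => w - z)%C Cexp).
  - apply cdiff_minus; [apply cdiff_id|apply cdiff_const].
  - replace (z - z)%C with (RtoC 0) by ring. eexists; apply H0.
Qed.

(** * Mean values over circles *)

Definition Cpol (r t : R) : C := (r * cos t, r * sin t).

Lemma Cmod_Cpol (r t : R) : 0 <= r -> Cmod (Cpol r t) = r.
Proof.
  intros Hr. unfold Cmod, Cpol. simpl.
  replace (r * cos t * (r * cos t * 1) + r * sin t * (r * sin t * 1))
    with (r ^ 2 * (Rsqr (sin t) + Rsqr (cos t))) by (unfold Rsqr; ring).
  rewrite sin2_cos2, Rmult_1_r. now apply sqrt_pow2.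
Qed.

(** Only the real part is integrated. Nothing is lost, since [g] may be multiplied
    by any complex constant beforehand. *)
Definition circle_integral (g : C -> C) (r : R) : R :=
  RInt (fun t => Re (g (Cpol r t))) 0 (2 * PI).

Lemma continuous_circle (g : C -> C) (r t : R) : ccont g (Cpol r t) ->
  continuous (fun s => Re (g (Cpol r s))) t.
Proof.
  intros H. apply (continuous_Re_path g (fun s => r * cos s) (fun s => r * sin s)).
  - apply (continuous_mult (K := R_AbsRing)); [apply continuous_const|].
    apply continuity_pt_filterlim. apply continuity_cos.
  - apply (continuous_mult (K := R_AbsRing)); [apply continuous_const|].
    apply continuity_pt_filterlim. apply continuity_sin.
  - exact H.
Qed.

Lemma ex_RInt_circle (g : C -> C) (r : R) : (forall t, ccont g (Cpol r t)) ->
  ex_RInt (fun t => Re (g (Cpol r t))) 0 (2 * PI).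
Proof.
  intros H. apply (ex_RInt_continuous (V := R_CompleteNormedModule)).
  intros t _. now apply continuous_circle.
Qed.

(** In the coordinate [z |-> exp z] the annulus becomes a rectangle of height [2 * PI]. The two
    horizontal sides cancel by periodicity, so that the vertical sides give equal integrals. *)
Lemma circle_integral_const_annulus (g : C -> C) (r1 r2 : R) : 0 < r1 <= r2 ->
  (forall z, r1 <= Cmod z <= r2 -> cdiff g z) ->
  circle_integral g r1 = circle_integral g r2.
Proof.
  intros Hr Hg.
  pose (h := fun z => g (Cexp z)).
  assert (L : ln r1 <= ln r2).
  { destruct (Req_dec r1 r2) as [->|]; [lra|]. left. apply ln_increasing; lra. }
  assert (PP := PI_RGT_0).
  assert (F : rect_flux h (ln r1) 0 (ln r2 - ln r1) (2 * PI) = 0).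
  { apply goursat_rectangle; try lra. intros a b [Ia _].
    apply (cdiff_comp Cexp g); [apply cdiff_Cexp|]. apply Hg.
    rewrite Cmod_Cexp. simpl. rewrite <- (exp_ln r1), <- (exp_ln r2) by lra.
    split; apply exp_monotone; lra. }
  unfold rect_flux in F.
  rewrite (RInt_ext (V := R_CompleteNormedModule) (fun s : R => Im (h (s, 0)) - Im (h (s, 0 + 2 * PI))) (fun _ => 0)) in F.
  2:{ intros s _. unfold h, Cexp. simpl. rewrite Rplus_0_l, cos_2PI, sin_2PI, cos_0, sin_0. unfold minus, plus, opp; simpl. ring. }
  rewrite RInt_const in F.
  replace (ln r1 + (ln r2 - ln r1)) with (ln r2) in F by ring.
  rewrite !Rplus_0_l in F.
  assert (EX : forall r, r1 <= r <= r2 -> ex_RInt (fun t => Re (g (Cpol r t))) 0 (2 * PI)).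
  { intros r Hr'. apply ex_RInt_circle. intros t. apply cdiff_ccont, Hg.
    rewrite Cmod_Cpol; lra. }
  rewrite (RInt_ext (V := R_CompleteNormedModule) _ (fun t => minus (Re (g (Cpol r2 t))) (Re (g (Cpol r1 t))))) in F.
  2:{ intros t _. unfold h, Cexp. simpl. rewrite !exp_ln by lra. reflexivity. }
  rewrite (RInt_minus (V := R_CompleteNormedModule) (fun t => Re (g (Cpol r2 t)))
    (fun t => Re (g (Cpol r1 t)))) in F by (apply EX; lra).
  change (scal (ln r2 - ln r1) 0 + (circle_integral g r2 - circle_integral g r1) = 0) in F.
  replace (scal (ln r2 - ln r1) 0) with 0 in F by (unfold scal; simpl; unfold mult; simpl; ring).
  lra.
Qed.

(** Uniform continuity of [g] along the circle of radius [r0] is obtained by bisecting the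
    interval of angles, which is a rectangle of height [0]. *)
Lemma circle_integral_continuous (g : C -> C) (R0 r0 : R) : 0 <= r0 <= R0 ->
  (forall z, Cmod z <= R0 -> ccont g z) ->
  forall eps, 0 < eps -> exists del, 0 < del /\ forall r, 0 <= r <= R0 ->
    Rabs (r - r0) < del -> Rabs (circle_integral g r - circle_integral g r0) <= 2 * PI * eps.
Proof.
  intros Hr Hg eps He. assert (PP := PI_RGT_0).
  pose (Q := fun x (y : R) t => exists del, 0 < del /\ forall r th, Rabs (r - r0) < del ->
    x <= th <= x + t * (2 * PI) -> Cmod (g (Cpol r th) - g (Cpol r0 th)) < eps).
  assert (HQ : Q 0 0 1).
  { apply (cousin_rectangle (2 * PI) 0 Q); try lra.
    - intros x y t Ht [d1 [P1 H1]] [d2 [P2 H2]] _ _.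
      exists (Rmin d1 d2). split; [now apply Rmin_glb_lt|]. intros r th Hd Hth.
      destruct (Rle_lt_dec th (x + t / 2 * (2 * PI))).
      + apply H1; [|lra]. eapply Rlt_le_trans; [apply Hd|apply Rmin_l].
      + apply H2; [|lra]. eapply Rlt_le_trans; [apply Hd|apply Rmin_r].
    - intros p q _ _.
      assert (Cg : ccont g (Cpol r0 p)) by (apply Hg; rewrite Cmod_Cpol; lra).
      destruct (Cg (eps / 2)) as [d [Hd K]]; [lra|].
      assert (Dist : forall r th, Cmod (Cpol r th - Cpol r0 p) <= 2 * Rabs (r - r0) + 2 * r0 * Rabs (th - p)).
      { intros r th. eapply Rle_trans; [apply Cmod_le_abs|]. simpl.
        assert (Lc : Rabs (cos th - cos p) <= Rabs (th - p)).
        { rewrite form2, !Rabs_mult. replace (Rabs (-2)) with 2 by (rewrite Rabs_left; lra).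
          pose proof (Rabs_sin_le ((th - p) / 2)) as S1.
          assert (S2 : Rabs (sin ((th + p) / 2)) <= 1) by (apply Rabs_le, SIN_bound).
          assert (E : Rabs ((th - p) / 2) = Rabs (th - p) / 2)
            by (unfold Rdiv; rewrite Rabs_mult, (Rabs_pos_eq (/ 2)); lra).
          rewrite E in S1. pose proof (Rabs_pos (sin ((th - p) / 2))).
          pose proof (Rabs_pos (sin ((th + p) / 2))). nra. }
        assert (Ls : Rabs (sin th - sin p) <= Rabs (th - p)).
        { rewrite form4, !Rabs_mult. rewrite (Rabs_pos_eq 2) by lra.
          pose proof (Rabs_sin_le ((th - p) / 2)) as S1.
          assert (S2 : Rabs (cos ((th + p) / 2)) <= 1) by (apply Rabs_le, COS_bound).
          assert (E : Rabs ((th - p) / 2) = Rabs (th - p) / 2)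
            by (unfold Rdiv; rewrite Rabs_mult, (Rabs_pos_eq (/ 2)); lra).
          rewrite E in S1. pose proof (Rabs_pos (sin ((th - p) / 2))).
          pose proof (Rabs_pos (cos ((th + p) / 2))). nra. }
        assert (Bc : Rabs (cos th) <= 1) by (apply Rabs_le, COS_bound).
        assert (Bs : Rabs (sin th) <= 1) by (apply Rabs_le, SIN_bound).
        replace (r * cos th + - (r0 * cos p)) with ((r - r0) * cos th + r0 * (cos th - cos p)) by ring.
        replace (r * sin th + - (r0 * sin p)) with ((r - r0) * sin th + r0 * (sin th - sin p)) by ring.
        pose proof (Rabs_triang ((r - r0) * cos th) (r0 * (cos th - cos p))) as T1.
        pose proof (Rabs_triang ((r - r0) * sin th) (r0 * (sin th - sin p))) as T2.
        rewrite !Rabs_mult, (Rabs_pos_eq r0) in T1, T2 by lra.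
        pose proof (Rabs_pos (r - r0)). nra. }
      exists (d / (4 * PI * (2 * r0 + 1))). split.
      { apply Rdiv_lt_0_compat; nra. }
      intros x y t Ht Hp _.
      assert (Tt : t * (4 * PI * (2 * r0 + 1)) < d) by (apply Rlt_div_r; [nra|lra]).
      exists (d / 4). split; [lra|]. intros r th Hrr Hth.
      assert (A : Rabs (th - p) <= t * (2 * PI)) by (apply Rabs_le; lra).
      assert (A' : 2 * r0 * Rabs (th - p) < d / 2).
      { apply Rle_lt_trans with (2 * r0 * (t * (2 * PI))).
        - apply Rmult_le_compat_l; lra.
        - assert (0 < t * PI) by nra. nra. }
      replace (g (Cpol r th) - g (Cpol r0 th))%C
        with ((g (Cpol r th) - g (Cpol r0 p)) - (g (Cpol r0 th) - g (Cpol r0 p)))%C by ring.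
      eapply Rle_lt_trans; [apply Cmod_triangle|]. rewrite Cmod_opp.
      assert (K1 : Cmod (g (Cpol r th) - g (Cpol r0 p)) < eps / 2).
      { apply K. eapply Rle_lt_trans; [apply Dist|]. lra. }
      assert (K2 : Cmod (g (Cpol r0 th) - g (Cpol r0 p)) < eps / 2).
      { apply K. eapply Rle_lt_trans; [apply Dist|].
        replace (r0 - r0) with 0 by ring. rewrite Rabs_R0. lra. }
      lra. }
  destruct HQ as [d [Hd K]]. exists d. split; auto. intros r Hr1 Hrd.
  assert (EX : forall r, 0 <= r <= R0 -> ex_RInt (fun t => Re (g (Cpol r t))) 0 (2 * PI)).
  { intros r' Hr'. apply ex_RInt_circle. intros t. apply Hg.
    rewrite Cmod_Cpol; lra. }
  unfold circle_integral.
  replace (RInt (fun t : R => Re (g (Cpol r t))) 0 (2 * PI) - RInt (fun t : R => Re (g (Cpol r0 t))) 0 (2 * PI))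
    with (RInt (fun t => minus (Re (g (Cpol r t))) (Re (g (Cpol r0 t)))) 0 (2 * PI)).
  2:{ rewrite (RInt_minus (V := R_CompleteNormedModule)) by (apply EX; lra). reflexivity. }
  replace (2 * PI) with (2 * PI - 0) at 2 by ring.
  apply abs_RInt_le_const; [lra| |].
  - apply (ex_RInt_minus (V := R_CompleteNormedModule)); apply EX; lra.
  - intros t Ht. eapply Rle_trans; [|left; apply (K r t Hrd); lra].
    eapply Rle_trans; [|apply re_le_Cmod].
    unfold Cminus. rewrite re_plus, re_opp. apply Rle_refl.
Qed.

(** By induction on the exceptional points: the interval is cut at one of them, and the two
    halves are joined there by continuity. *)
Lemma constant_across_exceptions (J : R -> R) (L : list R) : forall a b, a <= b ->
  (forall r0, a <= r0 <= b -> forall eps, 0 < eps -> exists del, 0 < del /\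
     forall r, a <= r <= b -> Rabs (r - r0) < del -> Rabs (J r - J r0) <= eps) ->
  (forall r1 r2, a <= r1 <= r2 -> r2 <= b -> (forall x, In x L -> ~ (r1 <= x <= r2)) -> J r1 = J r2) ->
  J a = J b.
Proof.
  induction L as [|x L IH]; intros a b Hab Hc Hj.
  - apply Hj; try lra. intros x [].
  - assert (Hlim : forall u v, a <= u <= b -> (forall r, a <= r <= b -> r <> u -> Rabs (r - u) <= Rabs (v - u) -> 0 < (r - u) * (v - u) -> J r = J v) ->
       a <= v <= b -> J u = J v).
    { intros u v Hu HJ Hv.
      destruct (Req_dec u v) as [->|Huv]; auto.
      assert (P : forall eps, 0 < eps -> Rabs (J u - J v) <= eps).
      { intros eps He. destruct (Hc u Hu eps He) as [d [Hd K]].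
        set (l := Rmin (/ 2) (d / (2 * Rabs (v - u)))).
        assert (Vp : 0 < Rabs (v - u)) by (apply Rabs_pos_lt; lra).
        assert (Lp : 0 < l) by (apply Rmin_glb_lt; [lra|apply Rdiv_lt_0_compat; lra]).
        assert (L1 : l <= / 2) by apply Rmin_l.
        assert (L2 : l * (2 * Rabs (v - u)) <= d).
        { apply Rle_div_r; [lra|apply Rmin_r]. }
        set (r := u + l * (v - u)).
        assert (Er : r - u = l * (v - u)) by (unfold r; ring).
        assert (Hr : a <= r <= b) by (unfold r; split; nra).
        rewrite <- (HJ r Hr).
        - rewrite <- Rabs_Ropp. replace (- (J u - J r)) with (J r - J u) by ring.
          apply K; auto. rewrite Er, Rabs_mult, (Rabs_pos_eq l) by lra. nra.
        - intros E. rewrite E in Er. assert (l * (v - u) = 0) by lra.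
          apply Rmult_integral in H. lra.
        - rewrite Er, Rabs_mult, (Rabs_pos_eq l) by lra. nra.
        - rewrite Er. assert (0 < (v - u) * (v - u)) by (apply Rlt_0_sqr; lra). nra. }
      apply Rminus_diag_uniq, Rabs_eq_0. apply Rle_antisym; [|apply Rabs_pos].
      apply Rnot_lt_le. intros Hlt. specialize (P (Rabs (J u - J v) / 2)). lra. }
    destruct (classic (a <= x <= b)) as [Hx|Hx].
    2:{ apply IH; auto. intros r1 r2 H1 H2 HL. apply Hj; auto.
        intros y [<-|Hy]; [lra|auto]. }
    assert (HA : forall r, a <= r < x -> J a = J r).
    { intros r Hr. apply IH; [lra| |].
      - intros r0 Hr0 eps He. destruct (Hc r0 ltac:(lra) eps He) as [d [Hd K]].
        exists d. split; auto. intros r' Hr'. apply K. lra.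
      - intros r1 r2 H1 H2 HL. apply Hj; try lra.
        intros y [<-|Hy]; [lra|auto]. }
    assert (HB : forall r, x < r <= b -> J r = J b).
    { intros r Hr. apply IH; [lra| |].
      - intros r0 Hr0 eps He. destruct (Hc r0 ltac:(lra) eps He) as [d [Hd K]].
        exists d. split; auto. intros r' Hr'. apply K. lra.
      - intros r1 r2 H1 H2 HL. apply Hj; try lra.
        intros y [<-|Hy]; [lra|auto]. }
    transitivity (J x).
    + symmetry. apply Hlim; [auto| |lra].
      intros r Hr Hne _ Hs. symmetry. apply HA. split; [lra|].
      apply Rnot_le_lt. intros F. assert (0 <= (r - x) * (x - a)) by (apply Rmult_le_pos; lra). lra.
    + apply Hlim; [auto| |lra].
      intros r Hr Hne _ Hs. apply HB. split; [|lra].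
      apply Rnot_le_lt. intros F. assert (0 <= (x - r) * (b - x)) by (apply Rmult_le_pos; lra). lra.
Qed.

(** The circle integral is constant on every interval of radii that avoids the moduli of the
    exceptional points, and continuous across them. The radius [0] is exceptional as well,
    because logarithmic coordinates do not reach the centre. *)
Lemma mean_value_exceptional (g : C -> C) (R0 : R) (L : list C) : 0 <= R0 ->
  (forall z, Cmod z <= R0 -> ccont g z) ->
  (forall z, Cmod z <= R0 -> ~ In z L -> cdiff g z) ->
  circle_integral g R0 = 2 * PI * Re (g 0%C).
Proof.
  intros HR Hc Hd. assert (PP := PI_RGT_0).
  transitivity (circle_integral g 0).
  - symmetry. apply (constant_across_exceptions (circle_integral g) (0 :: map Cmod L)); auto.
    + intros r0 Hr0 eps He.
      destruct (circle_integral_continuous g R0 r0 Hr0 Hc (eps / (2 * PI))) as [d [Hp K]].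
      { apply Rdiv_lt_0_compat; lra. }
      exists d. split; auto. intros r Hr Hrd. eapply Rle_trans; [now apply K|].
      right. field. lra.
    + intros r1 r2 H1 H2 HL.
      assert (0 < r1).
      { destruct (Req_dec r1 0); [|lra]. elim (HL 0); [now left|lra]. }
      apply circle_integral_const_annulus; [lra|]. intros z Hz. apply Hd; [lra|].
      intros Hin. apply (HL (Cmod z)); auto. right. now apply in_map.
  - unfold circle_integral.
    rewrite (RInt_ext (V := R_CompleteNormedModule) _ (fun _ => Re (g 0%C))).
    + rewrite RInt_const. unfold scal; simpl; unfold mult; simpl. ring.
    + intros t _. do 2 f_equal. unfold Cpol. apply injective_projections; simpl; ring.
Qed.

(** * The maximum principle *)

(** The left end point stands for the rightmost point of a circle parametrized by angle. *)
Lemma RInt_nonneg_zero (f : R -> R) (a b : R) : a < b ->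
  (forall t, a <= t <= b -> continuous f t) -> (forall t, a <= t <= b -> 0 <= f t) ->
  RInt f a b = 0 -> f a = 0.
Proof.
  intros Hab Hc Hp HI.
  apply Rle_antisym; [|apply Hp; lra]. apply Rnot_lt_le. intros Hfa.
  destruct (proj1 (continuous_eps f a) (Hc a ltac:(lra)) (f a)) as [d [Hd K]]; auto.
  set (c := Rmin ((a + b) / 2) (a + d / 2)).
  assert (C1 : c <= (a + b) / 2) by apply Rmin_l.
  assert (C2 : c <= a + d / 2) by apply Rmin_r.
  assert (C3 : a < c) by (apply Rmin_glb_lt; lra).
  assert (EX : forall u v, a <= u <= v -> v <= b -> ex_RInt f u v).
  { intros u v Hu Hv. apply (ex_RInt_continuous (V := R_CompleteNormedModule)).
    rewrite Rmin_left, Rmax_right by lra. intros t Ht; apply Hc; lra. }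
  assert (I1 : 0 < RInt f a c).
  { apply RInt_gt_0; auto.
    - intros t Ht. specialize (K t). assert (T : Rabs (t - a) < d) by (apply Rabs_lt_between; lra).
      specialize (K T). apply Rabs_lt_between in K. lra.
    - intros t Ht. apply Hc; lra. }
  assert (I2 : 0 <= RInt f c b).
  { apply RInt_ge_0; [lra|apply EX; lra|]. intros t Ht; apply Hp; lra. }
  pose proof (RInt_Chasles (V := R_CompleteNormedModule) f a c b (EX a c ltac:(lra) ltac:(lra))
    (EX c b ltac:(lra) ltac:(lra))) as Ch.
  change (RInt f a c + RInt f c b = RInt f a b) in Ch. lra.
Qed.

Lemma unimodular_factor (z : C) : exists u, Cmod u = 1 /\ (u * z)%C = RtoC (Cmod z).
Proof.
  destruct (Ceq_dec z 0%C) as [->|Hz].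
  - exists 1%C. split; [apply Cmod_1|]. rewrite Cmod_0. ring.
  - pose proof (proj1 (Cmod_gt_0 z) Hz) as Hp.
    assert (Hn : RtoC (Cmod z) <> 0%C).
    { intros E. injection E. lra. }
    exists (Cconj z / RtoC (Cmod z))%C. split.
    + rewrite Cmod_div, Cmod_conj, Cmod_R, Rabs_pos_eq by (auto; lra). field. lra.
    + replace (Cconj z / RtoC (Cmod z) * z)%C with (z * Cconj z / RtoC (Cmod z))%C by (field; auto).
      rewrite <- Cmod2_conj. rewrite RtoC_pow. field. auto.
Qed.

(** Among the points of [K] at which [|g|] is maximal, take one, [p], with the largest real part. If
    it were interior, the mean value property would force [|g|] to be maximal on a whole small
    circle around [p], whose rightmost point contradicts the choice of [p]. *)
Lemma maximum_principle (K : C -> Prop) (g : C -> C) (A m : R) :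
  (forall z, K z -> Cmod z <= A) ->
  (forall z, ~ K z -> exists r, 0 < r /\ forall w, Cmod (w - z) < r -> ~ K w) ->
  (forall z, K z -> cdiff g z) ->
  (forall z, K z -> Cmod (g z) <= m \/ exists r, 0 < r /\ forall w, Cmod (w - z) < r -> K w) ->
  forall z, K z -> Cmod (g z) <= m.
Proof.
  intros HA Hcl Hg Hbd z0 Hz0.
  assert (Hgc : forall z, K z -> forall eps, 0 < eps -> exists r, 0 < r /\
     forall w, Cmod (w - z) < r -> Cmod (g w) < Cmod (g z) + eps).
  { intros z Hz eps He. destruct (cdiff_ccont g z (Hg z Hz) eps He) as [r [Hr H]].
    exists r. split; auto. intros w Hw. specialize (H w Hw).
    pose proof (Cmod_ge_sub (g w) (g z)). lra. }
  destruct (closed_bounded_max K (fun z => Cmod (g z)) A) as [p1 [Kp1 M1]]; auto.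
  { now exists z0. }
  { intros z Hz eps He. destruct (Hgc z Hz eps He) as [r [Hr H]]. exists r. auto. }
  eapply Rle_trans; [apply (M1 z0 Hz0)|].
  set (M := Cmod (g p1)) in *.
  (* The level set is closed because [g] is continuous on [K]. *)
  destruct (closed_bounded_max (fun z => K z /\ Cmod (g z) = M) Re A) as [p [[Kp Ep] Mp]].
  { exists p1. auto. }
  { intros z [Hz _]; auto. }
  { intros z Hz. destruct (classic (K z)) as [Kz|Kz].
    - assert (Lt : Cmod (g z) < M).
      { destruct (M1 z Kz); auto. elim Hz; auto. }
      destruct (Hgc z Kz (M - Cmod (g z))) as [r [Hr H]]; [lra|].
      exists r. split; auto. intros w Hw [_ E]. specialize (H w Hw). lra.
    - destruct (Hcl z Kz) as [r [Hr H]]. exists r. split; auto.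
      intros w Hw [Kw _]. now elim (H w Hw). }
  { intros z _ eps He. exists eps. split; auto. intros w _ Hw.
    pose proof (re_le_Cmod (w - z)) as L. apply Rabs_le_between in L.
    unfold Cminus in L. rewrite re_plus, re_opp in L. unfold Cminus in Hw. lra. }
  rewrite <- Ep. destruct (Hbd p Kp) as [|[r [Hr Hin]]]; auto. exfalso.
  destruct (unimodular_factor (g p)) as [u [Hu Eu]].
  assert (PP := PI_RGT_0).
  pose (k := fun z => (u * g (p + z))%C).
  assert (Hcirc : forall z, Cmod z <= r / 2 -> K (p + z)%C).
  { intros z Hz. apply Hin. replace (p + z - p)%C with z by ring. lra. }
  assert (Dk : forall z, Cmod z <= r / 2 -> cdiff k z).
  { intros z Hz. apply cdiff_mult; [apply cdiff_const|].
    apply (cdiff_comp (fun w => p + w)%C g).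
    - apply cdiff_plus; [apply cdiff_const|apply cdiff_id].
    - apply Hg, Hcirc, Hz. }
  assert (MV : circle_integral k (r / 2) = 2 * PI * Re (k 0%C)).
  { apply (mean_value_exceptional k (r / 2) nil); [lra| |].
    - intros z Hz; apply cdiff_ccont; auto.
    - auto. }
  assert (K0 : Re (k 0%C) = M).
  { unfold k. replace (p + 0)%C with p by ring. rewrite Eu, Ep. apply re_RtoC. }
  assert (Ck : forall t, continuous (fun s => Re (k (Cpol (r / 2) s))) t).
  { intros t. apply continuous_circle, cdiff_ccont, Dk. rewrite Cmod_Cpol; lra. }
  assert (Le : forall t, Cmod (k (Cpol (r / 2) t)) <= M).
  { intros t. unfold k. rewrite Cmod_mult, Hu, Rmult_1_l. apply M1, Hcirc.
    rewrite Cmod_Cpol; lra. }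
  assert (Z : M - Re (k (Cpol (r / 2) 0)) = 0).
  { apply (RInt_nonneg_zero (fun t => M - Re (k (Cpol (r / 2) t))) 0 (2 * PI)); [lra| | |].
    - intros t _. apply (continuous_minus (V := R_NormedModule)); auto using continuous_const.
    - intros t _. specialize (Le t). pose proof (re_le_Cmod (k (Cpol (r / 2) t))) as L.
      apply Rabs_le_between in L. lra.
    - rewrite (RInt_minus (V := R_CompleteNormedModule) (fun _ => M) (fun t => Re (k (Cpol (r / 2) t)))).
      + rewrite RInt_const.
        change ((2 * PI - 0) * M - circle_integral k (r / 2) = 0). rewrite MV, K0. ring.
      + apply ex_RInt_const.
      + apply ex_RInt_circle. intros t. apply cdiff_ccont, Dk. rewrite Cmod_Cpol; lra. }
  assert (E0 : Cpol (r / 2) 0 = RtoC (r / 2)).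
  { unfold Cpol, RtoC. rewrite cos_0, sin_0. apply injective_projections; simpl; ring. }
  rewrite E0 in Z.
  assert (Hq : K (p + RtoC (r / 2))%C).
  { apply Hcirc. rewrite Cmod_R, Rabs_pos_eq; lra. }
  specialize (Mp (p + RtoC (r / 2))%C). rewrite re_plus, re_RtoC in Mp.
  assert (G : Cmod (g (p + RtoC (r / 2))%C) = M).
  { apply Rle_antisym; [auto|].
    pose proof (re_le_Cmod (k (RtoC (r / 2)))) as L. apply Rabs_le_between in L.
    unfold k in L, Z. rewrite Cmod_mult, Hu, Rmult_1_l in L. lra. }
  specialize (Mp (conj Hq G)). lra.
Qed.

Definition affine_form (l : R * R * R) (z : C) : R :=
  let '(a, b, c) := l in a * Re z + b * Im z + c.

(** Intersections of half-planes cover the triangles and rectangles on which the maximum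
    principle is applied; their boundary points are those where some form vanishes. *)
Definition polygon (L : list (R * R * R)) (z : C) : Prop :=
  Forall (fun l => 0 <= affine_form l z) L.

Lemma affine_form_lipschitz (l : R * R * R) : exists k, 0 < k /\
  forall z w, Rabs (affine_form l w - affine_form l z) <= k * Cmod (w - z).
Proof.
  destruct l as [[a b] c]. exists (Rabs a + Rabs b + 1). unfold affine_form.
  pose proof (Rabs_pos a). pose proof (Rabs_pos b).
  split; [lra|]. intros z w.
  replace (a * Re w + b * Im w + c - (a * Re z + b * Im z + c))
    with (a * Re (w - z) + b * Im (w - z))
    by (unfold Cminus; rewrite re_plus, re_opp, im_plus, im_opp; ring).
  eapply Rle_trans; [apply Rabs_triang|]. rewrite !Rabs_mult.
  pose proof (re_le_Cmod (w - z)). pose proof (Im_le_Cmod (w - z)).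
  pose proof (Cmod_ge_0 (w - z)). nra.
Qed.

Lemma affine_form_sign_open (l : R * R * R) (z : C) : affine_form l z <> 0 ->
  exists r, 0 < r /\ forall w, Cmod (w - z) < r -> 0 < affine_form l w * affine_form l z.
Proof.
  intros Hn. destruct (affine_form_lipschitz l) as [k [Hk H]].
  assert (Hp : 0 < Rabs (affine_form l z)) by now apply Rabs_pos_lt.
  exists (Rabs (affine_form l z) / k). split; [now apply Rdiv_lt_0_compat|].
  intros w Hw. assert (Hw' : Cmod (w - z) * k < Rabs (affine_form l z)) by now apply Rlt_div_r.
  specialize (H z w). revert Hw' H Hp.
  set (x := affine_form l z). set (y := affine_form l w). intros.
  assert (Q : Rabs (y - x) < Rabs x) by lra.
  unfold Rabs in Q. destruct (Rcase_abs (y - x)); destruct (Rcase_abs x); nra.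
Qed.

Lemma polygon_closed L z : ~ polygon L z ->
  exists r, 0 < r /\ forall w, Cmod (w - z) < r -> ~ polygon L w.
Proof.
  intros Hn.
  assert (E : exists l, In l L /\ affine_form l z < 0).
  { apply NNPP. intros F. apply Hn. apply Forall_forall. intros l Hl.
    apply Rnot_lt_le. intros K. apply F. now exists l. }
  destruct E as [l [Hl Hz]].
  destruct (affine_form_sign_open l z) as [r [Hr H]]; [lra|].
  exists r. split; auto. intros w Hw Pw.
  pose proof (proj1 (Forall_forall _ _) Pw l Hl) as P. simpl in P.
  specialize (H w Hw). nra.
Qed.

Lemma polygon_interior L z : polygon L z ->
  Exists (fun l => affine_form l z = 0) L \/
  exists r, 0 < r /\ forall w, Cmod (w - z) < r -> polygon L w.
Proof.
  intros P. induction P as [|l L Hl P IH].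
  - right. exists 1. split; [lra|]. intros; constructor.
  - destruct (Req_dec (affine_form l z) 0) as [E|N]; [left; now constructor|].
    destruct IH as [IH|[r [Hr H]]]; [left; now constructor 2|].
    destruct (affine_form_sign_open l z N) as [r' [Hr' H']].
    right. exists (Rmin r r'). split; [now apply Rmin_glb_lt|]. intros w Hw.
    constructor.
    + specialize (H' w (Rlt_le_trans _ _ _ Hw (Rmin_r _ _))). nra.
    + apply H. eapply Rlt_le_trans; [apply Hw|apply Rmin_l].
Qed.

Lemma maximum_principle_polygon L (g : C -> C) (A m : R) :
  (forall z, polygon L z -> Cmod z <= A) ->
  (forall z, polygon L z -> cdiff g z) ->
  (forall z, polygon L z -> Exists (fun l => affine_form l z = 0) L -> Cmod (g z) <= m) ->
  forall z, polygon L z -> Cmod (g z) <= m.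
Proof.
  intros HA Hg Hb. apply (maximum_principle (polygon L) g A m); auto.
  - apply polygon_closed.
  - intros z Hz. destruct (polygon_interior L z Hz) as [E|I]; auto.
Qed.

(** * The Phragmen-Lindelof principle *)

Lemma le_limit_exp (X m k : R) : 0 < m -> (forall d, 0 < d -> X <= m * exp (d * k)) -> X <= m.
Proof.
  intros Hm H. apply Rnot_lt_le. intros Hlt.
  assert (Hq : 1 < X / m) by (apply Rlt_div_r; lra).
  assert (HL : 0 < ln (X / m)) by (rewrite <- ln_1; apply ln_increasing; lra).
  pose proof (Rabs_pos k) as Hk.
  set (d := ln (X / m) / (Rabs k + 1)).
  assert (Hd : 0 < d) by (apply Rdiv_lt_0_compat; lra).
  assert (Hdk : d * k < ln (X / m)).
  { apply Rle_lt_trans with (d * Rabs k).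
    - apply Rmult_le_compat_l; [lra|apply Rle_abs].
    - replace (ln (X / m)) with (d * (Rabs k + 1)) by (unfold d; field; lra). nra. }
  specialize (H d Hd).
  assert (E : exp (d * k) < X / m).
  { rewrite <- (exp_ln (X / m)) by lra. now apply exp_increasing. }
  apply (Rmult_lt_compat_l m) in E; auto.
  replace (m * (X / m)) with X in E by (field; lra). lra.
Qed.

Lemma le_limit_linear (X m k : R) : (forall d, 0 < d -> X <= m * (1 + d * k)) -> X <= m.
Proof.
  intros H. apply Rnot_lt_le. intros Hlt.
  set (q := Rabs (m * k)). assert (Hq : 0 <= q) by apply Rabs_pos.
  specialize (H ((X - m) / (2 * (q + 1)))).
  assert (P : 0 < (X - m) / (2 * (q + 1))) by (apply Rdiv_lt_0_compat; lra).
  specialize (H P). set (d := (X - m) / (2 * (q + 1))) in *.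
  assert (E : d * (2 * (q + 1)) = X - m) by (unfold d; field; lra).
  assert (m * k <= q) by apply Rle_abs. nra.
Qed.

(** The substitution [z = w * w] turns the quadrant into the octant [0 <= Im w <= Re w], where
    the order of growth is 2, and there the entire function [exp (- d (1 - 2i) w^3)] is a
    damping factor without any fractional powers: [Re ((1 - 2i) w^3) >= (Re w)^3] on the octant.
    The maximum principle on the triangle cut off at [Re w = A], with [A] large, bounds the
    damped function by [m]; then [d] tends to [0]. *)
Lemma phragmen_lindelof_quadrant (f : C -> C) (B c m : R) :
  (forall z, cdiff f z) -> 0 <= c -> 0 < m ->
  (forall z, Cmod (f z) <= B * exp (c * Cmod z)) ->
  (forall x, 0 <= x -> Cmod (f (RtoC x)) <= m) ->
  (forall y, 0 <= y -> Cmod (f (0, y)) <= m) ->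
  forall x y, 0 <= x -> 0 <= y -> Cmod (f (x, y)) <= m.
Proof.
  intros Hf Hc Hm HB Hx Hy.
  assert (HB0 : 0 <= B).
  { specialize (HB 0%C). rewrite Cmod_0, Rmult_0_r, exp_0, Rmult_1_r in HB.
    eapply Rle_trans; [apply Cmod_ge_0|apply HB]. }
  assert (Oct : forall a b, 0 <= b <= a -> Cmod (f ((a, b) * (a, b))%C) <= m).
  { intros a b Hab.
    apply (le_limit_exp _ m (Re ((1, -2) * ((a, b) * (a, b) * (a, b)))%C)); auto.
    intros d Hd.
    pose (g := fun w : C => (f (w * w) * Cexp (RtoC (- d) * ((1, -2) * (w * w * w))))%C).
    assert (Gm : forall w, Cmod (g w) = Cmod (f (w * w)%C) * exp (- d * Re ((1, -2) * (w * w * w))%C)).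
    { intros w. unfold g. rewrite Cmod_mult, Cmod_Cexp, re_scal_l. reflexivity. }
    assert (Cube : forall s t, 0 <= t <= s -> s ^ 3 <= Re ((1, -2) * ((s, t) * (s, t) * (s, t)))%C).
    { intros s t Hst. unfold Re; simpl.
      assert (0 <= t * (6 * s ^ 2 - 3 * s * t - 2 * t ^ 2)).
      { apply Rmult_le_pos; [lra|]. nra. }
      nra. }
    (* At the far side [Re w = A], the growth and the damping combine to at most [B * exp (- A)],
       because [d * A >= 2 * c + 1], and this is at most [m] because [B <= m * A]. *)
    set (A := a + (2 * c + 1) / d + B / m + 1).
    assert (Q1 : 0 < (2 * c + 1) / d) by (apply Rdiv_lt_0_compat; lra).
    assert (Q2 : 0 <= B / m) by (apply Rdiv_le_0_compat; lra).
    assert (Main : Cmod (g (a, b)) <= m).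
    { apply (maximum_principle_polygon [(0, 1, 0); (1, -1, 0); (-1, 0, A)] g (2 * A) m).
      - intros z P. inversion_clear P as [|? ? P1 P']. inversion_clear P' as [|? ? P2 P''].
        inversion_clear P'' as [|? ? P3 _]. unfold affine_form in *.
        eapply Rle_trans; [apply Cmod_le_abs|]. rewrite !Rabs_pos_eq by lra. lra.
      - intros z _. unfold g. apply cdiff_mult.
        + apply (cdiff_comp (fun w => w * w)%C f); auto.
          apply cdiff_mult; apply cdiff_id.
        + apply (cdiff_comp (fun w => RtoC (- d) * ((1, -2) * (w * w * w)))%C Cexp); [|apply cdiff_Cexp].
          repeat apply cdiff_mult; auto using cdiff_id, cdiff_const.
      - intros z P Ex. inversion_clear P as [|? ? P1 P']. inversion_clear P' as [|? ? P2 P''].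
        inversion_clear P'' as [|? ? P3 _]. unfold affine_form in P1, P2, P3.
        destruct z as [s t]. unfold Re, Im in P1, P2, P3. simpl in P1, P2, P3.
        pose proof (Cube s t ltac:(lra)) as Cu.
        assert (S3 : 0 <= s ^ 3) by (apply pow_le; lra).
        assert (Bnd : forall X, Cmod (f ((s, t) * (s, t))%C) <= X -> X <= m -> Cmod (g (s, t)) <= m).
        { intros X HX Xm. rewrite Gm.
          assert (exp (- d * Re ((1, -2) * ((s, t) * (s, t) * (s, t)))%C) <= 1).
          { apply Rle_trans with (exp 0); [apply exp_monotone|rewrite exp_0; lra].
            rewrite Ropp_mult_distr_l_reverse.
            assert (0 <= d * Re ((1, -2) * ((s, t) * (s, t) * (s, t)))%C) by (apply Rmult_le_pos; lra).
            lra. }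
          pose proof (exp_pos (- d * Re ((1, -2) * ((s, t) * (s, t) * (s, t)))%C)).
          pose proof (Cmod_ge_0 (f ((s, t) * (s, t))%C)). nra. }
        inversion_clear Ex as [? ? E|? ? Ex']; [|inversion_clear Ex' as [? ? E|? ? Ex''];
          [|inversion_clear Ex'' as [? ? E|? ? Ex3]; [|inversion Ex3]]];
          unfold affine_form in E; unfold Re, Im in E; simpl in E.
        + replace (((s, t) : C) * (s, t))%C with (RtoC (s * s)) in Bnd.
          * apply (Bnd m); [apply Hx; nra|lra].
          * assert (t = 0) by lra. subst t. unfold RtoC, Cmult; simpl. f_equal; ring.
        + replace (((s, t) : C) * (s, t))%C with ((0, 2 * s * s) : C) in Bnd.
          * apply (Bnd m); [apply Hy; nra|lra].
          * assert (t = s) by lra. subst t. unfold RtoC, Cmult; simpl. f_equal; ring.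
        + assert (s = A) by lra. subst s.
          rewrite Gm.
          assert (HA1 : 1 <= A) by (unfold A; lra).
          assert (HdA : 2 * c + 1 <= d * A).
          { replace (2 * c + 1) with (d * ((2 * c + 1) / d)) by (field; lra).
            apply Rmult_le_compat_l; unfold A; lra. }
          assert (HmA : B <= m * A).
          { replace B with (m * (B / m)) by (field; lra).
            apply Rmult_le_compat_l; unfold A; lra. }
          eapply Rle_trans.
          { apply Rmult_le_compat_r; [left; apply exp_pos|]. apply HB. }
          rewrite Rmult_assoc, <- exp_plus, Cmod_mult.
          assert (N2 : Cmod (A, t) * Cmod (A, t) <= 2 * A * A).
          { pose proof (Cmod2_alt (A, t)) as N. unfold Re, Im in N; simpl in N. nra. }
          assert (Ex0 : c * (Cmod (A, t) * Cmod (A, t)) +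
             - d * Re ((1, -2) * ((A, t) * (A, t) * (A, t)))%C <= - A).
          { assert (c * (Cmod (A, t) * Cmod (A, t)) <= c * (2 * A * A)) by (apply Rmult_le_compat_l; lra).
            assert (d * A ^ 3 <= d * Re ((1, -2) * ((A, t) * (A, t) * (A, t)))%C)
              by (apply Rmult_le_compat_l; lra).
            assert ((2 * c + 1) * (A * A) <= d * A ^ 3).
            { replace (d * A ^ 3) with (d * A * (A * A)) by ring. apply Rmult_le_compat_r; nra. }
            nra. }
          apply exp_monotone in Ex0.
          assert (EA : exp (- A) * A <= 1).
          { rewrite exp_Ropp. pose proof (exp_ineq1_le A). pose proof (exp_pos A).
            apply Rmult_le_reg_l with (exp A); auto.
            replace (exp A * (/ exp A * A)) with A by (field; lra). lra. }
          apply Rle_trans with (B * exp (- A)); [apply Rmult_le_compat_l; auto|].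
          pose proof (exp_pos (- A)).
          apply Rle_trans with (m * A * exp (- A)); [apply Rmult_le_compat_r; lra|].
          replace (m * A * exp (- A)) with (m * (exp (- A) * A)) by ring. nra.
      - apply Forall_cons; [|apply Forall_cons; [|apply Forall_cons; [|apply Forall_nil]]];
          unfold affine_form, Re, Im; simpl; unfold A; lra. }
    rewrite Gm in Main.
    set (k := Re ((1, -2) * ((a, b) * (a, b) * (a, b)))%C) in *.
    replace (- d * k) with (- (d * k)) in Main by ring. rewrite exp_Ropp in Main.
    pose proof (exp_pos (d * k)).
    apply Rmult_le_compat_r with (r := exp (d * k)) in Main; [|lra].
    rewrite Rmult_assoc, Rinv_l, Rmult_1_r in Main by lra. exact Main. }
  intros x y Hx0 Hy0.
  set (r := Cmod (x, y)).
  assert (Er : r * r = x * x + y * y).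
  { pose proof (Cmod2_alt (x, y)) as N. unfold Re, Im in N; simpl in N. unfold r. lra. }
  assert (Hr : x <= r).
  { pose proof (re_le_Cmod (x, y)) as N. unfold Re in N; simpl in N. apply Rabs_le_between in N. unfold r; lra. }
  (* The square root of [x + i y] in the octant. *)
  replace ((x, y) : C) with ((sqrt ((r + x) / 2), sqrt ((r - x) / 2)) * (sqrt ((r + x) / 2), sqrt ((r - x) / 2)))%C.
  - apply Oct. split; [apply sqrt_pos|]. apply sqrt_le_1; lra.
  - unfold Cmult; simpl. rewrite !sqrt_sqrt by lra. f_equal; [field|].
    rewrite (Rmult_comm (sqrt ((r - x) / 2))).
    rewrite <- sqrt_mult by lra.
    replace ((r + x) / 2 * ((r - x) / 2)) with (Rsqr (y / 2)).
    + rewrite sqrt_Rsqr by lra. field.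
    + unfold Rsqr. replace ((r + x) / 2 * ((r - x) / 2)) with ((r * r - x * x) / 4) by field.
      rewrite Er. field.
Qed.

(** The two quadrants first give some bound [M] in the half-plane. Division by [1 - i d z], of
    modulus at least 1 there and large at infinity, then improves [M] to the bound [m] on the
    real line. The final constant does not depend on [m'], which is what allows the rate
    of the exponential to be lowered to its limit in [exponential_type_bound]. *)
Lemma phragmen_lindelof_half_plane (f : C -> C) (B c m m' : R) :
  (forall z, cdiff f z) -> 0 <= c -> 0 < m ->
  (forall z, Cmod (f z) <= B * exp (c * Cmod z)) ->
  (forall x, Cmod (f (RtoC x)) <= m) ->
  (forall y, 0 <= y -> Cmod (f (0, y)) <= m') ->
  forall z, 0 <= Im z -> Cmod (f z) <= m.
Proof.
  intros Hf Hc Hm HB Hx Hy.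
  set (M := Rmax m m').
  assert (M1 : m <= M) by apply Rmax_l. assert (M2 : m' <= M) by apply Rmax_r.
  assert (HM : forall z, 0 <= Im z -> Cmod (f z) <= M).
  { intros [x y]. unfold Im; simpl. intros Hy0. destruct (Rle_lt_dec 0 x).
    - apply (phragmen_lindelof_quadrant f B c M); auto; try lra.
      + intros t _. specialize (Hx t). lra.
      + intros t Ht. specialize (Hy t Ht). lra.
    - replace ((x, y) : C) with (Ci * (y, (- x)%R))%C
        by (unfold Ci, Cmult; simpl; f_equal; ring).
      apply (phragmen_lindelof_quadrant (fun z => f (Ci * z)%C) B c M); auto; try lra.
      + intros z. apply (cdiff_comp (fun w => Ci * w)%C f); auto.
        apply cdiff_mult; [apply cdiff_const|apply cdiff_id].
      + intros z. eapply Rle_trans; [apply HB|]. rewrite Cmod_mult, Cmod_Ci, Rmult_1_l. lra.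
      + intros t Ht. replace (Ci * RtoC t)%C with ((0, t) : C)
          by (unfold Ci, RtoC, Cmult; simpl; f_equal; ring).
        specialize (Hy t Ht). lra.
      + intros t Ht. replace (Ci * (0%R, t))%C with (RtoC (- t))
          by (unfold Ci, RtoC, Cmult; simpl; f_equal; ring).
        specialize (Hx (- t)). lra. }
  intros z Hz.
  apply (le_limit_linear _ m (Cmod z)). intros d Hd.
  pose (k := fun w : C => (1 - Ci * RtoC d * w)%C).
  assert (Ek : forall w, k w = (1 + d * Im w, - (d * Re w))).
  { intros [x y]. unfold k, Ci, RtoC, Cminus, Cplus, Copp, Cmult, Re, Im; simpl. f_equal; ring. }
  assert (Kre : forall w, 0 <= Im w -> 1 + d * Im w <= Cmod (k w)).
  { intros w Hw. rewrite Ek.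
    pose proof (re_le_Cmod (1 + d * Im w, - (d * Re w))) as L. unfold Re at 1 in L. simpl in L.
    apply Rabs_le_between in L. lra. }
  assert (Kim : forall w, d * Rabs (Re w) <= Cmod (k w)).
  { intros w. rewrite Ek.
    pose proof (Im_le_Cmod (1 + d * Im w, - (d * Re w))) as L. unfold Im at 1 in L. simpl in L.
    rewrite Rabs_Ropp, Rabs_mult, (Rabs_pos_eq d) in L by lra. exact L. }
  assert (K0 : forall w, 0 <= Im w -> k w <> 0%C).
  { intros w Hw. apply Cmod_gt_0. specialize (Kre w Hw). nra. }
  (* On the sides away from the real line [|k| >= d * A], and [M <= m * (d * A)]. *)
  set (A := Cmod z + M / (d * m) + 1).
  assert (0 < d * m) by nra.
  assert (Q1 : 0 <= M / (d * m)) by (apply Rdiv_le_0_compat; lra).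
  assert (HA : M <= m * (d * A)).
  { replace M with (m * (d * (M / (d * m)))) by (field; lra).
    repeat apply Rmult_le_compat_l; try lra. pose proof (Cmod_ge_0 z). unfold A; lra. }
  pose proof (Cmod_ge_0 z) as Zp.
  assert (Main : Cmod (f z / k z)%C <= m).
  { apply (maximum_principle_polygon [(0, 1, 0); (0, -1, A); (1, 0, A); (-1, 0, A)]
      (fun w => f w / k w)%C (2 * A) m).
    - intros w P. inversion_clear P as [|? ? P1 P']. inversion_clear P' as [|? ? P2 P''].
      inversion_clear P'' as [|? ? P3 P4']. inversion_clear P4' as [|? ? P4 _].
      unfold affine_form in *.
      eapply Rle_trans; [apply Cmod_le_abs|].
      assert (Rabs (Re w) <= A) by (apply Rabs_le; lra).
      rewrite (Rabs_pos_eq (Im w)) by lra. lra.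
    - intros w P. inversion_clear P as [|? ? P1 P']. unfold affine_form in P1.
      apply cdiff_div; [auto| |apply K0; lra].
      apply cdiff_minus; [apply cdiff_const|].
      apply cdiff_mult; [apply cdiff_const|apply cdiff_id].
    - intros w P Ex. inversion_clear P as [|? ? P1 P']. inversion_clear P' as [|? ? P2 P''].
      inversion_clear P'' as [|? ? P3 P4']. inversion_clear P4' as [|? ? P4 _].
      unfold affine_form in P1, P2, P3, P4.
      assert (Iw : 0 <= Im w) by lra.
      rewrite Cmod_div by auto. pose proof (Kre w Iw) as Kr. pose proof (Kim w) as Ki.
      assert (Kp : 0 < Cmod (k w)) by nra.
      apply Rle_div_l; auto.
      destruct (Req_dec (Im w) 0) as [E0|N0].
      + assert (Ew : w = RtoC (Re w)).
        { destruct w as [a b]. unfold Im, Re, RtoC in *; simpl in *. now rewrite E0. }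
        rewrite Ew at 1. eapply Rle_trans; [apply Hx|]. nra.
      + assert (D : d * A <= Cmod (k w)).
        { inversion_clear Ex as [? ? E|? ? Ex']; [unfold affine_form in E; lra|].
          inversion_clear Ex' as [? ? E|? ? Ex'']; unfold affine_form in *; [nra|].
          inversion_clear Ex'' as [? ? E|? ? Ex3].
          - eapply Rle_trans; [|apply Ki]. apply Rmult_le_compat_l; [lra|].
            rewrite Rabs_left1; lra.
          - inversion_clear Ex3 as [? ? E|? ? Ex4]; [|inversion Ex4].
            eapply Rle_trans; [|apply Ki]. apply Rmult_le_compat_l; [lra|].
            rewrite Rabs_pos_eq; lra. }
        eapply Rle_trans; [apply HM; auto|]. eapply Rle_trans; [apply HA|].
        apply Rmult_le_compat_l; lra.
    - pose proof (re_le_Cmod z) as L1. pose proof (Im_le_Cmod z) as L2.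
      apply Rabs_le_between in L1. apply Rabs_le_between in L2.
      apply Forall_cons; [|apply Forall_cons; [|apply Forall_cons; [|apply Forall_cons;
        [|apply Forall_nil]]]]; unfold affine_form, A; lra. }
  rewrite Cmod_div in Main by (apply K0; auto).
  assert (Kp : 0 < Cmod (k z)) by (apply Cmod_gt_0, K0; auto).
  apply Rle_div_l in Main; auto.
  eapply Rle_trans; [apply Main|]. apply Rmult_le_compat_l; [lra|].
  unfold k. eapply Rle_trans; [apply Cmod_triangle|].
  rewrite Cmod_opp, !Cmod_mult, Cmod_Ci, Cmod_1, Cmod_R, Rabs_pos_eq by lra. lra.
Qed.

(** Multiplication by [exp (i (1 + eps) z)] leaves the modulus on the real line unchanged and
    cancels the growth along the imaginary axis. The bound of the half-plane is the
    constant [M] of the real line, so [eps] can tend to [0]. *)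
Lemma exponential_type_bound (f : C -> C) (M : R) :
  (forall z, cdiff f z) -> 0 < M ->
  (forall eps, 0 < eps -> exists B, forall z, Cmod (f z) <= B * exp ((1 + eps) * Cmod z)) ->
  (forall x, Cmod (f (RtoC x)) <= M) ->
  forall z, Cmod (f z) <= M * exp (Rabs (Im z)).
Proof.
  assert (Upper : forall f, (forall z, cdiff f z) -> 0 < M ->
    (forall eps, 0 < eps -> exists B, forall z, Cmod (f z) <= B * exp ((1 + eps) * Cmod z)) ->
    (forall x, Cmod (f (RtoC x)) <= M) ->
    forall z, 0 <= Im z -> Cmod (f z) <= M * exp (Im z)).
  { clear f. intros f Hf HM HB Hx z Hz.
    pose proof (exp_pos (Im z)) as Ep.
    apply (le_limit_exp _ (M * exp (Im z)) (Im z)); [nra|].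
    intros eps He. destruct (HB eps He) as [B HB'].
    rewrite Rmult_assoc, <- exp_plus.
    pose (g := fun w : C => (f w * Cexp (RtoC (1 + eps) * (Ci * w)))%C).
    assert (Eg : forall w, Cmod (g w) = Cmod (f w) * exp (- ((1 + eps) * Im w))).
    { intros w. unfold g. rewrite Cmod_mult, Cmod_Cexp, re_scal_l, (Cmult_comm Ci), re_mult_Ci.
      do 2 f_equal. ring. }
    assert (HB0 : 0 <= B).
    { specialize (HB' 0%C). rewrite Cmod_0, Rmult_0_r, exp_0, Rmult_1_r in HB'.
      eapply Rle_trans; [apply Cmod_ge_0|apply HB']. }
    assert (Main : Cmod (g z) <= M).
    { apply (phragmen_lindelof_half_plane g B (2 * (1 + eps)) M B); auto; try lra.
      - intros w. apply cdiff_mult; auto.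
        apply (cdiff_comp (fun w => RtoC (1 + eps) * (Ci * w))%C Cexp); [|apply cdiff_Cexp].
        repeat apply cdiff_mult; auto using cdiff_const, cdiff_id.
      - intros w. rewrite Eg.
        replace (2 * (1 + eps) * Cmod w) with ((1 + eps) * Cmod w + (1 + eps) * Cmod w) by ring.
        rewrite exp_plus, <- Rmult_assoc.
        apply Rmult_le_compat; auto using Cmod_ge_0; [left; apply exp_pos|].
        apply exp_monotone. pose proof (Im_le_Cmod w) as L. apply Rabs_le_between in L. nra.
      - intros x. rewrite Eg, im_RtoC, Rmult_0_r, Ropp_0, exp_0, Rmult_1_r. auto.
      - intros y Hy. rewrite Eg. specialize (HB' (0, y)).
        assert (Cmod (0, y) <= y).
        { eapply Rle_trans; [apply Cmod_le_abs|]. unfold Re, Im; simpl.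
          rewrite Rabs_R0, Rabs_pos_eq; lra. }
        unfold Im; simpl. rewrite exp_Ropp.
        apply Rmult_le_reg_r with (exp ((1 + eps) * y)); [apply exp_pos|].
        rewrite Rmult_assoc, Rinv_l, Rmult_1_r by (apply Rgt_not_eq, exp_pos).
        eapply Rle_trans; [apply HB'|]. apply Rmult_le_compat_l; auto.
        apply exp_monotone. apply Rmult_le_compat_l; lra. }
    rewrite Eg, exp_Ropp in Main.
    apply Rmult_le_compat_r with (r := exp ((1 + eps) * Im z)) in Main; [|left; apply exp_pos].
    rewrite Rmult_assoc, Rinv_l, Rmult_1_r in Main by (apply Rgt_not_eq, exp_pos).
    replace (Im z + eps * Im z) with ((1 + eps) * Im z) by ring. exact Main. }
  intros Hf HM HB Hx z. destruct (Rle_lt_dec 0 (Im z)).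
  - rewrite Rabs_pos_eq by lra. now apply Upper.
  - rewrite Rabs_left by lra.
    replace z with (- (- z))%C by ring. rewrite im_opp, Ropp_involutive.
    apply (Upper (fun w => f (- w)%C)); auto.
    + intros w. apply (cdiff_comp (fun w => - w)%C f); auto. apply cdiff_opp, cdiff_id.
    + intros eps He. destruct (HB eps He) as [B HB']. exists B. intros w.
      rewrite <- (Cmod_opp w). apply HB'.
    + intros x. rewrite <- RtoC_opp. apply Hx.
    + rewrite im_opp. lra.
Qed.

(** * The complex sine, cosine and cardinal sine *)

Lemma Csin_components (z : C) :
  Csin z = (sin (Re z) * cosh (Im z), cos (Re z) * sinh (Im z)).
Proof.
  destruct z as [x y]. unfold Csin, Cexp, cosh, sinh.
  replace (Ci * (x, y))%C with (((- y)%R, x) : C) by (unfold Ci, Cmult; simpl; f_equal; ring).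
  replace (- ((- y)%R, x))%C with ((y, (- x)%R) : C) by (unfold Copp; simpl; f_equal; ring).
  unfold Re, Im; simpl. rewrite cos_neg, sin_neg.
  unfold Cdiv, Cinv, Cminus, Cplus, Copp, Cmult, Ci, RtoC. simpl. f_equal; field.
Qed.

Definition Ccos (z : C) : C := Csin (z + RtoC (PI / 2)).

Lemma Ccos_components (z : C) :
  Ccos z = (cos (Re z) * cosh (Im z), - (sin (Re z) * sinh (Im z))).
Proof.
  unfold Ccos. rewrite Csin_components, re_plus, im_plus, re_RtoC, im_RtoC, Rplus_0_r.
  rewrite sin_plus, cos_plus, sin_PI2, cos_PI2. f_equal; ring.
Qed.

Lemma cdiff_Csin (z : C) : cdiff Csin z.
Proof.
  unfold Csin. apply cdiff_div.
  - apply cdiff_minus.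
    + apply (cdiff_comp (fun z => Ci * z)%C Cexp); [|apply cdiff_Cexp].
      apply cdiff_mult; [apply cdiff_const|apply cdiff_id].
    + apply (cdiff_comp (fun z => - (Ci * z))%C Cexp); [|apply cdiff_Cexp].
      apply cdiff_opp, cdiff_mult; [apply cdiff_const|apply cdiff_id].
  - apply cdiff_const.
  - intros E. injection E. lra.
Qed.

Lemma cdiff_Ccos (z : C) : cdiff Ccos z.
Proof.
  apply (cdiff_comp (fun z => z + RtoC (PI / 2))%C Csin); [|apply cdiff_Csin].
  apply cdiff_plus; [apply cdiff_id|apply cdiff_const].
Qed.

Lemma Csin_sub_node (z : C) (t : R) : cos t = 0 ->
  Csin (z - RtoC t) = (- (RtoC (sin t) * Ccos z))%C.
Proof.
  intros Ht. rewrite Csin_components, Ccos_components. unfold Cminus.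
  rewrite re_plus, im_plus, re_opp, im_opp, re_RtoC, im_RtoC.
  replace (Re z + - t) with (Re z - t) by ring.
  replace (Im z + - 0) with (Im z) by ring.
  rewrite sin_minus, cos_minus, Ht.
  unfold RtoC, Cmult, Copp; simpl. f_equal; ring.
Qed.

Lemma cosh_ge_1 (y : R) : 1 <= cosh y.
Proof.
  unfold cosh. pose proof (exp_ineq1_le y). pose proof (exp_ineq1_le (- y)). lra.
Qed.

Lemma sinh_expands (y : R) : Rabs y <= Rabs (sinh y).
Proof.
  destruct (mvt_from_0 sinh cosh y) as [c [_ E]].
  { intros t. unfold sinh, cosh. auto_derive; auto. field. }
  rewrite E, sinh_0, Rplus_0_l, Rabs_mult.
  pose proof (cosh_ge_1 c). rewrite (Rabs_pos_eq (cosh c)) by lra.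
  pose proof (Rabs_pos y). nra.
Qed.

Lemma cosh2_sinh2 (y : R) : cosh y ^ 2 = 1 + sinh y ^ 2.
Proof.
  unfold cosh, sinh. rewrite exp_Ropp. pose proof (exp_pos y). field. lra.
Qed.

Lemma Ccos_zero (z : C) : Ccos z = 0%C -> z = RtoC (Re z) /\ cos (Re z) = 0.
Proof.
  rewrite Ccos_components. intros E. injection E as E1 E2.
  pose proof (cosh_ge_1 (Im z)) as Hc.
  assert (Hcos : cos (Re z) = 0).
  { apply Rmult_integral in E1. destruct E1; lra. }
  split; auto.
  assert (Hs : sinh (Im z) = 0).
  { assert (E3 : sin (Re z) * sinh (Im z) = 0) by lra.
    apply Rmult_integral in E3. destruct E3 as [E3|]; auto.
    pose proof (sin2_cos2 (Re z)) as S. rewrite E3, Hcos in S. unfold Rsqr in S. lra. }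
  pose proof (sinh_expands (Im z)) as L. rewrite Hs, Rabs_R0 in L.
  assert (Hi : Im z = 0).
  { apply Rabs_eq_0. pose proof (Rabs_pos (Im z)). lra. }
  destruct z as [x y]. unfold Re, Im, RtoC in *; simpl in *. now rewrite Hi.
Qed.

(** The cubic order makes [sinc] differentiable at [0]; an error of quadratic order would only
    give continuity. *)
Lemma Csin_cubic (z : C) : Cmod z <= 1 / 2 -> Cmod (Csin z - z) <= 10 * Cmod z ^ 3.
Proof.
  intros Hz. eapply Rle_trans; [apply Cmod_le_abs|]. rewrite Csin_components.
  pose proof (re_le_Cmod z) as Hx. pose proof (Im_le_Cmod z) as Hy.
  destruct z as [x y]. unfold Re, Im in *. simpl in Hx, Hy. simpl. set (m := Cmod (x, y)) in *.
  pose proof (Rabs_pos x) as Px. pose proof (Rabs_pos y) as Py.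
  assert (X2 : Rabs x ^ 2 <= m ^ 2) by (apply pow_incr; lra).
  assert (Y2 : Rabs y ^ 2 <= m ^ 2) by (apply pow_incr; lra).
  assert (X3 : Rabs x ^ 3 <= m ^ 3) by (apply pow_incr; lra).
  assert (Y3 : Rabs y ^ 3 <= m ^ 3) by (apply pow_incr; lra).
  pose proof (sin_cubic x) as E1.
  pose proof (cosh_quadratic y ltac:(lra)) as E2. rewrite <- (pow2_abs y) in E2.
  pose proof (cos_quadratic x) as E3. rewrite <- (pow2_abs x) in E3.
  pose proof (sinh_cubic y ltac:(lra)) as E4.
  pose proof (Rabs_sin_le x) as E5.
  assert (E6 : Rabs (sinh y) <= 2 * m).
  { replace (sinh y) with ((sinh y - y) + y) by ring.
    eapply Rle_trans; [apply Rabs_triang|].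
    assert (Rabs y ^ 3 <= Rabs y / 4).
    { assert (Rabs y ^ 2 <= (1 / 2) ^ 2) by (apply pow_incr; lra). simpl in *. nra. }
    lra. }
  assert (R1 : Rabs (sin x * cosh y + - x) <= 3 * m ^ 3).
  { replace (sin x * cosh y + - x) with (sin x * (cosh y - 1) + (sin x - x)) by ring.
    eapply Rle_trans; [apply Rabs_triang|]. rewrite Rabs_mult.
    assert (Rabs (sin x) * Rabs (cosh y - 1) <= m * (2 * m ^ 2)).
    { apply Rmult_le_compat; try apply Rabs_pos; lra. }
    simpl in *. lra. }
  assert (R2 : Rabs (cos x * sinh y + - y) <= 4 * m ^ 3).
  { replace (cos x * sinh y + - y) with ((cos x - 1) * sinh y + (sinh y - y)) by ring.
    eapply Rle_trans; [apply Rabs_triang|]. rewrite Rabs_mult.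
    assert (Rabs (cos x - 1) * Rabs (sinh y) <= m ^ 2 * (2 * m)).
    { apply Rmult_le_compat; try apply Rabs_pos; lra. }
    simpl in *. lra. }
  assert (0 <= m ^ 3) by (apply pow_le; apply Cmod_ge_0).
  simpl in *. lra.
Qed.

Definition sinc (z : C) : C := if Ceq_dec z 0%C then RtoC 1 else (Csin z / z)%C.

Lemma sinc_0 : sinc 0 = RtoC 1.
Proof.
  unfold sinc. destruct (Ceq_dec 0 0) as [|N]; auto. now elim N.
Qed.

Lemma sinc_neq_0 (z : C) : z <> 0%C -> sinc z = (Csin z / z)%C.
Proof.
  intros H. unfold sinc. destruct (Ceq_dec z 0); [contradiction|auto].
Qed.

Lemma Csin_0 : Csin 0 = RtoC 0.
Proof. rewrite (Csin_RtoC 0). now rewrite sin_0. Qed.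

Lemma sinc_spec (z : C) : (z * sinc z)%C = Csin z.
Proof.
  destruct (Ceq_dec z 0) as [->|N].
  - rewrite Csin_0. ring.
  - rewrite sinc_neq_0 by auto. field. auto.
Qed.

Lemma cdiff_sinc (z : C) : cdiff sinc z.
Proof.
  destruct (Ceq_dec z 0) as [->|N].
  - exists 0%C. apply cderiv_eps. intros eps He.
    exists (Rmin (1 / 2) (eps / 10)). split; [apply Rmin_glb_lt; lra|].
    intros w Hw. pose proof (Rmin_l (1/2) (eps / 10)). pose proof (Rmin_r (1/2) (eps / 10)).
    replace (w - 0)%C with w in * by ring.
    rewrite sinc_0.
    destruct (Ceq_dec w 0) as [->|Nw].
    + rewrite sinc_0. replace (1 - 1 - 0 * 0)%C with (RtoC 0) by ring. rewrite Cmod_0. lra.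
    + rewrite sinc_neq_0 by auto.
      replace (Csin w / w - 1 - 0 * w)%C with ((Csin w - w) / w)%C by (field; auto).
      rewrite Cmod_div by auto.
      pose proof (proj1 (Cmod_gt_0 w) Nw). apply Rle_div_l; auto.
      eapply Rle_trans; [apply Csin_cubic; lra|]. simpl.
      assert (Cmod w * Cmod w * Cmod w <= (eps / 10) * (Cmod w * Cmod w)) by nra. lra.
  - apply (cdiff_ext_loc (fun w => Csin w / w)%C sinc z (Cmod z)).
    + now apply Cmod_gt_0.
    + intros w Hw. rewrite sinc_neq_0; auto. intros ->.
      replace (0 - z)%C with (- z)%C in Hw by ring. rewrite Cmod_opp in Hw. lra.
    + apply cdiff_div; auto using cdiff_Csin, cdiff_id.
Qed.

(** At a node [t] one has [cos z = - sin t * sin (z - t)], so the slope function is an explicit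
    multiple of [sinc]. *)
Lemma Ccos_cderiv_node (t : R) : cos t = 0 ->
  exists phi, ccont phi (RtoC t) /\ phi (RtoC t) <> 0%C /\
    forall z, Ccos z = (phi z * (z - RtoC t))%C.
Proof.
  intros Ht. exists (fun z => - (RtoC (sin t)) * sinc (z - RtoC t))%C.
  assert (S1 : (RtoC (sin t) * RtoC (sin t))%C = RtoC 1).
  { rewrite <- RtoC_mult. f_equal. pose proof (sin2_cos2 t) as S. rewrite Ht in S. unfold Rsqr in S. lra. }
  split; [|split].
  - apply ccont_mult; [apply ccont_const|]. apply cdiff_ccont.
    apply (cdiff_comp (fun z => z - RtoC t)%C sinc); [|apply cdiff_sinc].
    apply cdiff_minus; [apply cdiff_id|apply cdiff_const].
  - replace (RtoC t - RtoC t)%C with (RtoC 0) by ring. rewrite sinc_0, Cmult_1_r.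
    intros E. assert (E' : (RtoC (sin t) * RtoC (sin t))%C = RtoC 0).
    { replace (RtoC (sin t)) with (- - RtoC (sin t))%C by ring. rewrite E. ring. }
    rewrite S1 in E'. injection E'. lra.
  - intros z. replace (- RtoC (sin t) * sinc (z - RtoC t) * (z - RtoC t))%C
      with (- RtoC (sin t) * ((z - RtoC t) * sinc (z - RtoC t)))%C by ring.
    rewrite sinc_spec, Csin_sub_node by auto.
    replace (- RtoC (sin t) * - (RtoC (sin t) * Ccos z))%C
      with (RtoC (sin t) * RtoC (sin t) * Ccos z)%C by ring.
    rewrite S1. ring.
Qed.

(** Here [|cos z|^2 = cosh^2 y - sin^2 x]. Far from the real line [cosh^2 y] dominates. Near it
    the circle crosses the axis vertically at the zeros [R0] and [- R0] of the sine, so that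
    [|sin x| <= R0 - |x| <= y^2]. *)
Lemma Ccos_lower_bound (z : C) (R0 : R) : 1 <= R0 -> sin R0 = 0 -> Cmod z = R0 ->
  exp (Rabs (Im z)) / 4 <= Cmod (Ccos z).
Proof.
  intros HR Hs Hz.
  pose proof (Cmod2_alt z) as N. rewrite Hz in N.
  pose proof (Cmod2_alt (Ccos z)) as N2. rewrite Ccos_components in N2 at 2 3.
  unfold Re at 1, Im at 2 in N2; simpl in N2.
  set (x := Re z) in *. set (y := Im z) in *.
  pose proof (sin2_cos2 x) as Sx. unfold Rsqr in Sx.
  pose proof (cosh2_sinh2 y) as Hch.
  assert (Q : Cmod (Ccos z) ^ 2 = cosh y ^ 2 - sin x ^ 2).
  { simpl. rewrite N2. replace (cos x * cosh y * (cos x * cosh y * 1))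
      with ((cos x * cos x) * cosh y ^ 2) by ring.
    replace (cos x * cos x) with (1 - sin x * sin x) by lra.
    replace (cosh y * (cosh y * 1)) with (cosh y ^ 2) by ring. rewrite Hch. ring. }
  assert (Hy : y ^ 2 <= sinh y ^ 2).
  { rewrite <- (pow2_abs y), <- (pow2_abs (sinh y)). apply pow_incr.
    split; [apply Rabs_pos|apply sinh_expands]. }
  assert (Half : sin x ^ 2 <= cosh y ^ 2 / 2).
  { destruct (Rle_lt_dec 1 (y ^ 2)) as [L|L].
    - pose proof (Rle_0_sqr (cos x)) as P. unfold Rsqr in P. simpl in *. lra.
    - assert (Sa : sin x ^ 2 = sin (R0 - Rabs x) ^ 2).
      { rewrite sin_minus, Hs.
        pose proof (sin2_cos2 R0) as SR. rewrite Hs in SR. unfold Rsqr in SR.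
        assert (Ex : sin x ^ 2 = sin (Rabs x) ^ 2).
        { unfold Rabs. destruct (Rcase_abs x); auto. rewrite sin_neg. ring. }
        rewrite Ex. replace ((0 * cos (Rabs x) - cos R0 * sin (Rabs x)) ^ 2)
          with ((cos R0 * cos R0) * sin (Rabs x) ^ 2) by ring.
        replace (cos R0 * cos R0) with 1 by lra. ring. }
      assert (Xa : Rabs x ^ 2 = x ^ 2) by apply pow2_abs.
      pose proof (Rabs_pos x) as Px.
      assert (D : 0 <= R0 - Rabs x <= y ^ 2).
      { pose proof (pow2_ge_0 y). split.
        - apply Rnot_lt_le. intros F. simpl in *. nra.
        - assert ((R0 - Rabs x) * (R0 + Rabs x) = y ^ 2) by (simpl in *; lra).
          destruct (Rle_lt_dec (R0 - Rabs x) 0); [lra|]. nra. }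
      assert (B : sin (R0 - Rabs x) ^ 2 <= (y ^ 2) ^ 2).
      { rewrite <- (pow2_abs (sin _)). apply pow_incr. split; [apply Rabs_pos|].
        eapply Rle_trans; [apply Rabs_sin_le|]. rewrite Rabs_pos_eq; lra. }
      rewrite Sa, Hch. pose proof (pow2_ge_0 y).
      assert ((y ^ 2) ^ 2 <= y ^ 2) by nra. lra. }
  assert (Ce : exp (Rabs y) / 2 <= cosh y).
  { unfold cosh, Rabs. pose proof (exp_pos y). pose proof (exp_pos (- y)).
    destruct (Rcase_abs y); lra. }
  pose proof (exp_pos (Rabs y)) as Ep. pose proof (Cmod_ge_0 (Ccos z)).
  apply Rnot_lt_le. intros F. simpl in *. nra.
Qed.

(** * Removable singularities and the cardinal series remainder *)

(** The quotient [Y / D] has only removable singularities, since the zeros of [D] are simple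
    zeros at which [Y] vanishes too. Its continuous extension satisfies the mean value
    property, and the extra factor [z] makes the value at the centre zero. *)
Lemma circle_integral_removable (Y D : C -> C) (R0 : R) (L : list C) : 0 < R0 ->
  (forall z, cdiff Y z) -> (forall z, cdiff D z) ->
  (forall z, Cmod z <= R0 -> D z = 0%C -> Cmod z < R0 /\ In z L /\ Y z = 0%C /\
     exists phi, ccont phi z /\ phi z <> 0%C /\ forall w, D w = (phi w * (w - z))%C) ->
  circle_integral (fun z => z * (Y z / D z))%C R0 = 0.
Proof.
  intros HR HY HD H0.
  destruct (functional_choice_on C C (fun z v =>
    (D z <> 0%C -> v = (Y z / D z)%C) /\
    (D z = 0%C -> Cmod z <= R0 -> exists phi psi, ccont phi z /\ ccont psi z /\ psi z <> 0%C /\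
       (forall w, Y w = (phi w * (w - z))%C) /\ (forall w, D w = (psi w * (w - z))%C) /\
       v = (phi z / psi z)%C))) as [V HV].
  { intros z. destruct (Ceq_dec (D z) 0%C) as [E|N].
    - destruct (classic (Cmod z <= R0)) as [Hz|Hz].
      + destruct (H0 z Hz E) as (_ & _ & Yz & psi & Hp & Hn & Hw).
        destruct (HY z) as [m [phi [Hphi [_ HYw]]]].
        exists (phi z / psi z)%C. split; [contradiction|]. intros _ _.
        exists phi, psi. repeat split; auto.
        intros w. rewrite HYw, Yz. ring.
      + exists 0%C. split; [contradiction|]. intros _ F; contradiction.
    - exists (Y z / D z)%C. split; auto. intros; contradiction. }
  assert (VD : forall z, D z <> 0%C -> cdiff V z).
  { intros z N.
    destruct (ccont_neq_0 D z (cdiff_ccont D z (HD z)) N) as [r [Hr Hn]].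
    apply (cdiff_ext_loc (fun w => Y w / D w)%C V z r); auto.
    - intros w Hw. symmetry. apply (HV w). auto.
    - apply cdiff_div; auto. }
  assert (VC : forall z, Cmod z <= R0 -> ccont V z).
  { intros z Hz. destruct (Ceq_dec (D z) 0%C) as [E|N]; [|now apply cdiff_ccont, VD].
    destruct (proj2 (HV z) E Hz) as (phi & psi & Cphi & Cpsi & Npsi & EY & ED & EV).
    destruct (ccont_neq_0 psi z Cpsi Npsi) as [r [Hr Hn]].
    apply (ccont_ext_loc (fun w => phi w * / psi w)%C V z r); auto.
    - intros w Hw. destruct (Ceq_dec w z) as [->|Nw]; [now rewrite EV|].
      assert (Nz : (w - z)%C <> 0%C) by (apply Cmod_gt_0, Cmod_sub_pos; auto).
      assert (Nd : D w <> 0%C).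
      { rewrite ED. apply Cmult_neq_0; auto. }
      rewrite (proj1 (HV w) Nd), EY, ED. field. auto.
    - apply ccont_mult; auto. apply ccont_inv; auto. }
  assert (MV : circle_integral (fun z => z * V z)%C R0 = 0).
  { rewrite (mean_value_exceptional (fun z => z * V z)%C R0 L); [|lra| |].
    - rewrite Cmult_0_l, re_RtoC. ring.
    - intros z Hz. apply ccont_mult; [apply ccont_id|auto].
    - intros z Hz HL. apply cdiff_mult; [apply cdiff_id|]. apply VD.
      intros E. apply HL. now apply H0. }
  rewrite <- MV. unfold circle_integral. apply (RInt_ext (V := R_CompleteNormedModule)).
  intros t _. do 2 f_equal. symmetry. apply (HV (Cpol R0 t)).
  intros E. pose proof (Cmod_Cpol R0 t ltac:(lra)) as Ec.
  destruct (H0 (Cpol R0 t)) as [Hlt _]; auto; lra.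
Qed.

Definition lsum (h : R -> C) (L : list R) : C := fold_right (fun t s => (h t + s)%C) (RtoC 0) L.

Lemma lsum_ext h k L : (forall t, In t L -> h t = k t) -> lsum h L = lsum k L.
Proof.
  induction L as [|a L IH]; simpl; intros H; auto.
  rewrite (H a), IH; auto.
Qed.

Lemma lsum_mult c h L : (c * lsum h L)%C = lsum (fun t => c * h t)%C L.
Proof.
  induction L as [|a L IH]; simpl; [ring|]. rewrite <- IH. ring.
Qed.

Lemma lsum_conj (h : R -> C) L : Cconj (lsum h L) = lsum (fun t => Cconj (h t)) L.
Proof.
  induction L as [|a L IH]; simpl; [|now rewrite Cplus_conj, IH].
  unfold Cconj, RtoC; simpl. f_equal; ring.
Qed.

Lemma lsum_zero h L : (forall t, In t L -> h t = RtoC 0) -> lsum h L = RtoC 0.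
Proof.
  induction L as [|a L IH]; simpl; intros H; auto.
  rewrite H, IH by auto. ring.
Qed.

Lemma cdiff_lsum (h : R -> C -> C) L (z : C) : (forall t, In t L -> cdiff (h t) z) ->
  cdiff (fun w => lsum (fun t => h t w) L) z.
Proof.
  induction L as [|a L IH]; simpl; intros H; [apply cdiff_const|].
  apply cdiff_plus; auto.
Qed.

(** For two zeros [s] and [t] of the cosine, [sinc (s - t)] is 1 or 0 according to whether they
    coincide; over a list of such zeros this sum is the interpolant of [f] at them. *)
Definition cardinal_sum (f : C -> C) (L : list R) (z : C) : C :=
  lsum (fun t => f (RtoC t) * sinc (z - RtoC t))%C L.

Lemma cdiff_cardinal_sum f L z : cdiff (cardinal_sum f L) z.
Proof.
  unfold cardinal_sum. apply (cdiff_lsum (fun t w => f (RtoC t) * sinc (w - RtoC t))%C).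
  intros t _. apply cdiff_mult; [apply cdiff_const|].
  apply (cdiff_comp (fun w => w - RtoC t)%C sinc); [|apply cdiff_sinc].
  apply cdiff_minus; [apply cdiff_id|apply cdiff_const].
Qed.

Lemma sinc_node_diff (s t : R) : cos s = 0 -> cos t = 0 -> s <> t ->
  sinc (RtoC s - RtoC t) = RtoC 0.
Proof.
  intros Hs Ht N. rewrite <- RtoC_minus.
  rewrite sinc_neq_0.
  - rewrite Csin_RtoC, sin_minus, Hs, Ht.
    replace (sin s * 0 - 0 * sin t) with 0 by ring. unfold Cdiv. ring.
  - intros E. injection E. lra.
Qed.

Lemma cardinal_sum_node f L s : NoDup L -> (forall t, In t L -> cos t = 0) -> In s L ->
  cardinal_sum f L (RtoC s) = f (RtoC s).
Proof.
  unfold cardinal_sum. induction L as [|a L IH]; simpl; intros ND Hc Hin; [contradiction|].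
  inversion ND as [|? ? Na NL]; subst.
  destruct Hin as [->|Hin].
  - replace (RtoC s - RtoC s)%C with (RtoC 0) by ring. rewrite sinc_0.
    rewrite lsum_zero; [ring|]. intros t Ht. rewrite sinc_node_diff; auto; [ring|].
    intros ->. contradiction.
  - rewrite IH by auto. rewrite sinc_node_diff; auto; [ring|].
    intros ->. contradiction.
Qed.

(** On the circle [|z| = R0] the pole at [a] is reflected to the point
    [R0 * R0 / conj a] outside it, at the cost of a conjugation. Since conjugation does not
    affect real parts, mean values of rational functions with poles inside the circle become
    mean values of holomorphic ones. *)
Lemma reflect_circle (z a : C) (R0 : R) : Cmod z = R0 -> Cmod a < R0 ->
  (/ (z - a))%C = Cconj (z / (RtoC (R0 * R0) - Cconj a * z))%C /\
  (RtoC (R0 * R0) - Cconj a * z)%C <> 0%C.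
Proof.
  intros Hz Ha. pose proof (Cmod_ge_0 a) as Pa.
  assert (Nza : (z - a)%C <> 0%C).
  { intros E. assert (z = a) by (replace z with (z - a + a)%C by ring; rewrite E; ring).
    subst z. lra. }
  assert (Nz : z <> 0%C) by (intros ->; rewrite Cmod_0 in Hz; lra).
  assert (Nzc : Cconj z <> 0%C).
  { intros E. apply Nz. rewrite <- (Cconj_conj z), E. unfold Cconj, RtoC; simpl. f_equal; ring. }
  assert (E : RtoC (R0 * R0) = (z * Cconj z)%C).
  { rewrite <- Cmod2_conj, Hz. f_equal. ring. }
  assert (E2 : (RtoC (R0 * R0) - Cconj a * z)%C = (z * Cconj (z - a))%C).
  { rewrite E, Cminus_conj. ring. }
  assert (Nc : Cconj (z - a) <> 0%C).
  { intros F. apply Nza. rewrite <- (Cconj_conj (z - a)), F. unfold Cconj, RtoC; simpl. f_equal; ring. }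
  rewrite E2. split; [|apply Cmult_neq_0; auto].
  rewrite Cdiv_conj by (apply Cmult_neq_0; auto).
  rewrite Cmult_conj, Cconj_conj. field. auto.
Qed.

Lemma reflect_denominator (z a : C) (R0 : R) : Cmod z <= R0 -> Cmod a < R0 ->
  (RtoC (R0 * R0) - Cconj a * z)%C <> 0%C.
Proof.
  intros Hz Ha E. pose proof (Cmod_ge_0 a). pose proof (Cmod_ge_0 z).
  assert (E' : (Cconj a * z)%C = RtoC (R0 * R0)).
  { replace (RtoC (R0 * R0)) with ((RtoC (R0 * R0) - Cconj a * z) + Cconj a * z)%C by ring.
    rewrite E. ring. }
  apply (f_equal Cmod) in E'. rewrite Cmod_mult, Cmod_conj, Cmod_R, Rabs_pos_eq in E' by nra.
  nra.
Qed.

Lemma circle_integral_minus (g h : C -> C) (R0 : R) : 0 <= R0 ->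
  (forall z, Cmod z = R0 -> ccont g z) -> (forall z, Cmod z = R0 -> ccont h z) ->
  circle_integral (fun z => g z - h z)%C R0 = circle_integral g R0 - circle_integral h R0.
Proof.
  intros HR Hg Hh. unfold circle_integral.
  rewrite (RInt_ext (V := R_CompleteNormedModule) _ (fun t => minus (Re (g (Cpol R0 t))) (Re (h (Cpol R0 t))))).
  - rewrite (RInt_minus (V := R_CompleteNormedModule)); [reflexivity| |];
      apply ex_RInt_circle; intros t; [apply Hg|apply Hh]; now apply Cmod_Cpol.
  - intros t _. unfold Cminus. rewrite re_plus, re_opp. reflexivity.
Qed.

Lemma circle_integral_ext (g h : C -> C) (R0 : R) : 0 <= R0 ->
  (forall z, Cmod z = R0 -> Re (g z) = Re (h z)) -> circle_integral g R0 = circle_integral h R0.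
Proof.
  intros HR H. apply (RInt_ext (V := R_CompleteNormedModule)).
  intros t _. apply H. now apply Cmod_Cpol.
Qed.

(** Write [S] for the cardinal sum over the zeros of the cosine inside the circle, and [v] for
    [(f w - S w) / cos w]. The function [f - S - v cos] vanishes at those zeros and at [w], so
    that its quotient by [cos z (z - w)] has a vanishing circle integral. What [S] and [v cos]
    contribute to that quotient are the partial fractions [z / ((z - t) (z - w))] and
    [z / (z - w)], of mean 0 and 1 by reflection. *)
Lemma cardinal_remainder (f : C -> C) (L : list R) (R0 : R) (u w : C) :
  (forall z, cdiff f z) -> 0 < R0 -> sin R0 = 0 -> NoDup L ->
  (forall t, In t L <-> cos t = 0 /\ Rabs t < R0) ->
  Cmod w < R0 -> Ccos w <> 0%C ->
  circle_integral (fun z => u * (z * f z / (Ccos z * (z - w))))%C R0 =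
    2 * PI * Re (u * ((f w - cardinal_sum f L w) / Ccos w))%C.
Proof.
  intros Hf HR Hs ND HL Hw Nw.
  set (v := ((f w - cardinal_sum f L w) / Ccos w)%C).
  (* The choice of [v] makes [Y] vanish at [w]; at the nodes the cardinal sum interpolates [f]. *)
  pose (Y := fun z => (u * (f z - cardinal_sum f L z - v * Ccos z))%C).
  pose (D := fun z => (Ccos z * (z - w))%C).
  assert (Zeros : forall z, Cmod z <= R0 -> Ccos z = 0%C ->
      exists t, z = RtoC t /\ In t L /\ cos t = 0 /\ Cmod z < R0).
  { intros z Hz E. destruct (Ccos_zero z E) as [Ez Ec].
    exists (Re z). assert (Hlt : Rabs (Re z) < R0).
    { rewrite Ez, Cmod_R in Hz. destruct Hz as [|E']; auto. exfalso.
      assert (S0 : sin (Re z) = 0).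
      { revert E'. unfold Rabs. destruct (Rcase_abs (Re z)); intros E'.
        - replace (Re z) with (- R0) by lra. rewrite sin_neg. lra.
        - now rewrite E'. }
      pose proof (sin2_cos2 (Re z)) as S. rewrite S0, Ec in S. unfold Rsqr in S. lra. }
    repeat split; auto.
    - apply HL; auto.
    - rewrite Ez, Cmod_R. auto. }
  assert (I0 : circle_integral (fun z => z * (Y z / D z))%C R0 = 0).
  { apply (circle_integral_removable Y D R0 (w :: map RtoC L)); auto.
    - intros z. apply cdiff_mult; [apply cdiff_const|].
      apply cdiff_minus; [apply cdiff_minus; auto using cdiff_cardinal_sum|].
      apply cdiff_mult; [apply cdiff_const|apply cdiff_Ccos].
    - intros z. apply cdiff_mult; [apply cdiff_Ccos|].
      apply cdiff_minus; [apply cdiff_id|apply cdiff_const].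
    - intros z Hz E. unfold D in E.
      destruct (Ceq_dec z w) as [->|N].
      + repeat split; auto.
        * now left.
        * unfold Y, v. field. auto.
        * exists Ccos. split; [apply cdiff_ccont, cdiff_Ccos|]. split; auto.
      + assert (Ec : Ccos z = 0%C).
        { destruct (Ceq_dec (Ccos z) 0%C) as [|Nc]; auto. exfalso.
          revert E. apply Cmult_neq_0; auto. apply Cmod_gt_0, Cmod_sub_pos; auto. }
        destruct (Zeros z Hz Ec) as (t & -> & Ht & Hct & Hlt).
        repeat split; auto.
        * right. now apply in_map.
        * unfold Y. rewrite Ec, cardinal_sum_node; auto; [ring|].
          intros s Hs'. now apply HL.
        * destruct (Ccos_cderiv_node t Hct) as (phi & C1 & N1 & E1).
          exists (fun z => phi z * (z - w))%C. split; [|split].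
          -- apply ccont_mult; auto. apply cdiff_ccont, cdiff_minus; [apply cdiff_id|apply cdiff_const].
          -- apply Cmult_neq_0; auto. apply Cmod_gt_0, Cmod_sub_pos; auto.
          -- intros z. unfold D. rewrite E1. ring. }
  (* On the circle, [Cconj (G z)] is the sum of the partial fractions contributed by the
     cardinal sum and by [v * Ccos]; all terms of [G 0] except the first vanish. *)
  pose (G := fun z : C =>
    (Cconj (u * v) * (RtoC (R0 * R0) / (RtoC (R0 * R0) - Cconj w * z)) +
     lsum (fun t => Cconj (- (u * (f (RtoC t) * RtoC (sin t)))) *
       (RtoC (R0 * R0) * z / ((RtoC (R0 * R0) - Cconj (RtoC t) * z) * (RtoC (R0 * R0) - Cconj w * z)))) L)%C).
  assert (Lt : forall t, In t L -> Cmod (RtoC t) < R0).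
  { intros t Ht. rewrite Cmod_R. now apply HL. }
  assert (DG : forall z, Cmod z <= R0 -> cdiff G z).
  { intros z Hz.
    assert (Den : forall a, cdiff (fun z => RtoC (R0 * R0) - Cconj a * z)%C z).
    { intros a. apply cdiff_minus; [apply cdiff_const|].
      apply cdiff_mult; [apply cdiff_const|apply cdiff_id]. }
    apply cdiff_plus.
    - apply cdiff_mult; [apply cdiff_const|]. apply cdiff_div; auto using cdiff_const.
      now apply reflect_denominator.
    - apply (cdiff_lsum (fun t z => Cconj (- (u * (f (RtoC t) * RtoC (sin t)))) *
       (RtoC (R0 * R0) * z / ((RtoC (R0 * R0) - Cconj (RtoC t) * z) * (RtoC (R0 * R0) - Cconj w * z))))%C).
      intros t Ht. apply cdiff_mult; [apply cdiff_const|]. apply cdiff_div.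
      + apply cdiff_mult; [apply cdiff_const|apply cdiff_id].
      + apply cdiff_mult; auto.
      + apply Cmult_neq_0; apply reflect_denominator; auto. }
  assert (IG : circle_integral G R0 = 2 * PI * Re (u * v)%C).
  { rewrite (mean_value_exceptional G R0 nil); [|lra| |].
    - f_equal. transitivity (Re (Cconj (u * v)%C)); [|apply re_conj].
      f_equal. unfold G. rewrite lsum_zero.
      + assert (N : RtoC (R0 * R0) <> 0%C) by (intros E; injection E; nra).
        replace (RtoC (R0 * R0) - Cconj w * 0)%C with (RtoC (R0 * R0)) by ring. field. auto.
      + intros t _. unfold Cdiv. ring.
    - intros z Hz. now apply cdiff_ccont, DG.
    - auto. }
  assert (Nc : forall z, Cmod z = R0 -> Ccos z <> 0%C).
  { intros z Hz E. destruct (Zeros z (Req_le _ _ Hz) E) as (t & _ & _ & _ & F). lra. }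
  assert (Nzw : forall z a, Cmod z = R0 -> Cmod a < R0 -> (z - a)%C <> 0%C).
  { intros z a Hz Ha. apply Cmod_gt_0, Cmod_sub_pos. intros ->. lra. }
  rewrite <- IG. apply Rminus_diag_uniq. rewrite <- I0.
  rewrite <- circle_integral_minus; [|lra| |].
  - apply circle_integral_ext; [lra|]. intros z Hz.
    assert (EG : Re (G z) = Re (Cconj (G z))) by (symmetry; apply re_conj).
    unfold Cminus. rewrite re_plus, re_opp, EG, <- re_opp, <- re_plus. f_equal.
    assert (Ez : (z * Cconj z)%C = RtoC (R0 * R0)).
    { rewrite <- Cmod2_conj, Hz. f_equal. ring. }
    assert (Ecard : cardinal_sum f L z =
      (lsum (fun t => - (f (RtoC t) * RtoC (sin t) * / (z - RtoC t))) L * Ccos z)%C).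
    { rewrite Cmult_comm, lsum_mult. apply lsum_ext. intros t Ht.
      rewrite sinc_neq_0 by (apply Nzw; auto).
      rewrite Csin_sub_node by now apply HL. field. apply Nzw; auto. }
    assert (EGc : Cconj (G z) = (u * v * (z / (z - w)) +
      u * (z / (z - w)) * lsum (fun t => - (f (RtoC t) * RtoC (sin t) * / (z - RtoC t))) L)%C).
    { unfold G. rewrite Cplus_conj, lsum_conj, lsum_mult. f_equal.
      - rewrite Cmult_conj, Cconj_conj. f_equal.
        destruct (reflect_circle z w R0 Hz Hw) as [E1 N1].
        unfold Cdiv at 2. rewrite E1.
        replace (RtoC (R0 * R0) / (RtoC (R0 * R0) - Cconj w * z))%C
          with (Cconj z * (z / (RtoC (R0 * R0) - Cconj w * z)))%C.
        + rewrite Cmult_conj, Cconj_conj. reflexivity.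
        + rewrite <- Ez at 2. rewrite <- Ez in N1. rewrite <- Ez. field. auto.
      - apply lsum_ext. intros t Ht. rewrite Cmult_conj, Cconj_conj.
        destruct (reflect_circle z w R0 Hz Hw) as [E1 N1].
        destruct (reflect_circle z (RtoC t) R0 Hz (Lt t Ht)) as [E2 N2].
        replace (RtoC (R0 * R0) * z / ((RtoC (R0 * R0) - Cconj (RtoC t) * z) * (RtoC (R0 * R0) - Cconj w * z)))%C
          with (Cconj z * (z / (RtoC (R0 * R0) - Cconj (RtoC t) * z)) * (z / (RtoC (R0 * R0) - Cconj w * z)))%C.
        + rewrite !Cmult_conj, Cconj_conj, <- E1, <- E2. unfold Cdiv. ring.
        + rewrite <- Ez in N1, N2 |- *. field. auto. }
    rewrite EGc. unfold Y, D. rewrite Ecard. field. split; [apply Nzw; auto|apply Nc; auto].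
  - intros z Hz. apply cdiff_ccont. apply cdiff_mult; [apply cdiff_const|].
    apply cdiff_div.
    + apply cdiff_mult; auto using cdiff_id.
    + apply cdiff_mult; [apply cdiff_Ccos|].
      apply cdiff_minus; [apply cdiff_id|apply cdiff_const].
    + apply Cmult_neq_0; auto.
  - intros z Hz. apply cdiff_ccont, DG. lra.
Qed.

(** * Convergence of the cardinal series *)

(** The zeros of the cosine between [- N * PI] and [N * PI]. *)
Definition nodes (N : nat) : list R :=
  map (fun j => IZR (Z.of_nat j - Z.of_nat N) * PI + PI / 2) (seq 0 (2 * N)).

Lemma nodes_spec (N : nat) (t : R) :
  In t (nodes N) <-> cos t = 0 /\ Rabs t < INR N * PI.
Proof.
  assert (PP := PI_RGT_0). unfold nodes. rewrite in_map_iff, INR_IZR_INZ. split.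
  - intros [j [<- Hj]]. apply in_seq in Hj. split; [apply cos_eq_0_1; eauto|].
    assert (H1 : IZR (- Z.of_nat N) <= IZR (Z.of_nat j - Z.of_nat N)) by (apply IZR_le; lia).
    assert (H2 : IZR (Z.of_nat j - Z.of_nat N) <= IZR (Z.of_nat N - 1)) by (apply IZR_le; lia).
    rewrite opp_IZR in H1. rewrite (minus_IZR (Z.of_nat N) 1) in H2.
    set (a := IZR (Z.of_nat j - Z.of_nat N)) in *. apply Rabs_lt_between. nra.
  - intros [Hc Ht]. destruct (cos_eq_0_0 t Hc) as [k Hk]. subst t.
    apply Rabs_lt_between in Ht.
    assert (H1 : (- Z.of_nat N <= k)%Z).
    { apply Z.lt_succ_r. apply lt_IZR. rewrite opp_IZR, succ_IZR. nra. }
    assert (H2 : (k < Z.of_nat N)%Z) by (apply lt_IZR; nra).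
    exists (Z.to_nat (k + Z.of_nat N)). split.
    + do 3 f_equal. lia.
    + apply in_seq. lia.
Qed.

Lemma nodes_NoDup (N : nat) : NoDup (nodes N).
Proof.
  assert (PP := PI_RGT_0). unfold nodes.
  apply FinFun.Injective_map_NoDup; [|apply seq_NoDup].
  intros i j E. assert (E' : IZR (Z.of_nat i - Z.of_nat N) = IZR (Z.of_nat j - Z.of_nat N)).
  { apply Rmult_eq_reg_r with PI; lra. }
  apply eq_IZR in E'. lia.
Qed.

Lemma exists_node_radius (r : R) : exists N0, forall N, (N0 <= N)%nat -> r < INR N * PI /\ (1 <= N)%nat.
Proof.
  assert (PP := PI_RGT_0). pose proof PI2_1 as P1.
  destruct (INR_unbounded r) as [N0 H0]. exists (S N0). intros N HN. split; [|lia].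
  assert (INR N0 <= INR N) by (apply le_INR; lia).
  pose proof (pos_INR N). nra.
Qed.

(** On [|z| = N * PI] the growth [exp |Im z|] of [z f z] is absorbed by the cosine, which leaves
    the decay of [1 / (z - w)]. *)
Lemma cardinal_series_error (f : C -> C) (K : R) (w : C) (N : nat) :
  (forall z, cdiff f z) -> 
  (forall z, Cmod (z * f z)%C <= K * exp (Rabs (Im z))) ->
  Ccos w <> 0%C -> (1 <= N)%nat -> Cmod w < INR N * PI ->
  Cmod (f w - cardinal_sum f (nodes N) w) <= Cmod (Ccos w) * (4 * K / (INR N * PI - Cmod w)).
Proof.
  intros Hf HK Nw HN Hw. assert (PP := PI_RGT_0). pose proof PI2_1 as P1.
  set (R0 := INR N * PI) in *.
  assert (H1 : 1 <= R0).
  { assert (INR 1 <= INR N) by (apply le_INR; lia). simpl in *. unfold R0. nra. }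
  assert (HS : sin R0 = 0).
  { apply sin_eq_0_1. exists (Z.of_nat N). unfold R0. now rewrite INR_IZR_INZ. }
  set (v := ((f w - cardinal_sum f (nodes N) w) / Ccos w)%C).
  destruct (unimodular_factor v) as [u [Hu Ev]].
  assert (Rem := cardinal_remainder f (nodes N) R0 u w Hf ltac:(lra) HS (nodes_NoDup N)
    (nodes_spec N) Hw Nw). fold v in Rem. rewrite Ev, re_RtoC in Rem.
  assert (HK0 : 0 <= K).
  { specialize (HK 0%C). rewrite Cmult_0_l, Cmod_0, im_RtoC, Rabs_R0, exp_0 in HK. lra. }
  set (B := 4 * K / (R0 - Cmod w)).
  assert (Hsmall : forall z, Cmod z = R0 ->
    Ccos z <> 0%C /\ (z - w)%C <> 0%C /\ Cmod (u * (z * f z / (Ccos z * (z - w))))%C <= B).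
  { intros z Hz.
    pose proof (Ccos_lower_bound z R0 H1 HS Hz) as Lc.
    pose proof (exp_pos (Rabs (Im z))) as Ep.
    assert (Nc : Ccos z <> 0%C) by (apply Cmod_gt_0; lra).
    pose proof (Cmod_ge_sub z w) as Lz.
    assert (Nz : (z - w)%C <> 0%C) by (apply Cmod_gt_0; lra).
    repeat split; auto.
    rewrite Cmod_mult, Hu, Rmult_1_l, Cmod_div, (Cmod_mult (Ccos z)) by (apply Cmult_neq_0; auto).
    apply Rle_div_l; [apply Rmult_lt_0_compat; lra|].
    eapply Rle_trans; [apply HK|].
    assert (B0 : 0 <= B) by (apply Rdiv_le_0_compat; lra).
    apply Rle_trans with (B * (exp (Rabs (Im z)) / 4 * (R0 - Cmod w))).
    - right. unfold B. field. lra.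
    - apply Rmult_le_compat_l; auto. apply Rmult_le_compat; lra. }
  assert (Hint : Rabs (2 * PI * Cmod v) <= 2 * PI * B).
  { rewrite <- Rem. unfold circle_integral.
    replace (2 * PI * B) with ((2 * PI - 0) * B) by ring.
    apply abs_RInt_le_const; [lra| |].
    - apply (ex_RInt_circle (fun z => u * (z * f z / (Ccos z * (z - w))))%C). intros t.
      destruct (Hsmall (Cpol R0 t)) as (Nc & Nz & _); [apply Cmod_Cpol; lra|].
      apply cdiff_ccont, cdiff_mult; [apply cdiff_const|]. apply cdiff_div.
      + apply cdiff_mult; auto using cdiff_id.
      + apply cdiff_mult; [apply cdiff_Ccos|apply cdiff_minus; [apply cdiff_id|apply cdiff_const]].
      + apply Cmult_neq_0; auto.
    - intros t _. eapply Rle_trans; [apply re_le_Cmod|].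
      apply Hsmall. apply Cmod_Cpol; lra. }
  pose proof (Cmod_ge_0 v) as Pv.
  rewrite Rabs_pos_eq in Hint by (apply Rmult_le_pos; lra).
  apply Rmult_le_reg_l in Hint; [|lra].
  replace (f w - cardinal_sum f (nodes N) w)%C with (Ccos w * v)%C by (unfold v; field; auto).
  rewrite Cmod_mult. apply Rmult_le_compat_l; [apply Cmod_ge_0|auto].
Qed.

Lemma cardinal_series_converges (f : C -> C) (K : R) (w : C) :
  (forall z, cdiff f z) ->
  (forall z, Cmod (z * f z)%C <= K * exp (Rabs (Im z))) ->
  Ccos w <> 0%C ->
  forall eps, 0 < eps -> exists N0, forall N, (N0 <= N)%nat ->
    Cmod (f w - cardinal_sum f (nodes N) w) <= eps.
Proof.
  intros Hf HK Nw eps He.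
  assert (HK0 : 0 <= K).
  { specialize (HK 0%C). rewrite Cmult_0_l, Cmod_0, im_RtoC, Rabs_R0, exp_0 in HK. lra. }
  pose proof (Cmod_ge_0 (Ccos w)) as Pc.
  set (q := Cmod (Ccos w) * (4 * K) / eps).
  assert (Hq : 0 <= q) by (apply Rdiv_le_0_compat; nra).
  destruct (exists_node_radius (Cmod w + q + 1)) as [N0 H0].
  exists N0. intros N HN. destruct (H0 N HN) as [Hr H1].
  eapply Rle_trans; [apply (cardinal_series_error f K w N); auto; lra|].
  unfold Rdiv at 1. rewrite <- Rmult_assoc. apply Rle_div_l; [lra|].
  replace (Cmod (Ccos w) * (4 * K)) with (eps * q) by (unfold q; field; lra).
  apply Rmult_le_compat_l; lra.
Qed.

(** * The extremal problem for type one *)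

Definition rsinc (x : R) : R := Re (sinc (RtoC x)).

Lemma rsinc_0 : rsinc 0 = 1.
Proof. unfold rsinc. rewrite sinc_0. apply re_RtoC. Qed.

Lemma rsinc_neq_0 (x : R) : x <> 0 -> rsinc x = sin x / x.
Proof.
  intros Hx. unfold rsinc. rewrite sinc_neq_0.
  - rewrite Csin_RtoC, <- RtoC_div by auto. apply re_RtoC.
  - intros E. injection E. auto.
Qed.

Lemma sinc_RtoC (x : R) : sinc (RtoC x) = RtoC (rsinc x).
Proof.
  destruct (Req_dec x 0) as [->|Hx].
  - now rewrite rsinc_0, sinc_0.
  - rewrite rsinc_neq_0, sinc_neq_0, Csin_RtoC, RtoC_div; auto.
    intros E. injection E. auto.
Qed.

(** The strictness is what confines the points of equality to the origin. *)
Lemma rsinc_lt_1 (x : R) : x <> 0 -> Rabs x < PI / 2 -> rsinc x < 1.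
Proof.
  intros Hx Hlt. rewrite rsinc_neq_0 by auto. apply Rabs_lt_between in Hlt.
  assert (PP := PI_RGT_0).
  destruct (Rlt_le_dec 0 x).
  - apply Rlt_div_l; auto. pose proof (sin_lt_x x). lra.
  - replace (sin x / x) with (sin (- x) / (- x)) by (rewrite sin_neg; field; auto).
    apply Rlt_div_l; [lra|]. pose proof (sin_lt_x (- x)). lra.
Qed.

Lemma node_ge (t : R) : cos t = 0 -> PI / 2 <= Rabs t.
Proof.
  intros Ht. apply Rnot_lt_le. intros F. apply Rabs_lt_between in F.
  pose proof (cos_gt_0 t). lra.
Qed.

Lemma node_sin_sqr (t : R) : cos t = 0 -> sin t * sin t = 1.
Proof.
  intros Ht. pose proof (sin2_cos2 t) as S. rewrite Ht in S. unfold Rsqr in S. lra.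
Qed.

Lemma Cmod_Csin_le (z : C) : Cmod (Csin z) <= 2 * exp (Rabs (Im z)).
Proof.
  eapply Rle_trans; [apply Cmod_le_abs|]. rewrite Csin_components. unfold Re at 1, Im at 2; simpl.
  rewrite !Rabs_mult.
  assert (S1 : Rabs (sin (Re z)) <= 1) by (apply Rabs_le, SIN_bound).
  assert (S2 : Rabs (cos (Re z)) <= 1) by (apply Rabs_le, COS_bound).
  set (y := Im z). pose proof (exp_pos y). pose proof (exp_pos (- y)).
  assert (E1 : exp y <= exp (Rabs y)) by (apply exp_monotone, Rle_abs).
  assert (E2 : exp (- y) <= exp (Rabs y)).
  { apply exp_monotone. rewrite <- Rabs_Ropp. apply Rle_abs. }
  assert (Ch : Rabs (cosh y) <= exp (Rabs y)).
  { unfold cosh. rewrite Rabs_pos_eq; lra. }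
  assert (Sh : Rabs (sinh y) <= exp (Rabs y)).
  { unfold sinh. apply Rabs_le. lra. }
  pose proof (Rabs_pos (sin (Re z))). pose proof (Rabs_pos (cos (Re z))).
  pose proof (Rabs_pos (cosh y)). pose proof (Rabs_pos (sinh y)). nra.
Qed.

Lemma sinc_bound (z : C) : Cmod (z * sinc z)%C <= 2 * exp (Rabs (Im z)).
Proof. rewrite sinc_spec. apply Cmod_Csin_le. Qed.

Lemma lsum_dominated (h k : R -> C) (M : R) L :
  (forall t, In t L -> Cmod (h t) <= M * Re (k t)) ->
  Cmod (lsum h L) <= M * Re (lsum k L).
Proof.
  induction L as [|a L IH]; intros H.
  - change (Cmod (RtoC 0) <= M * Re (RtoC 0)). rewrite Cmod_0, re_RtoC. lra.
  - change (Cmod (h a + lsum h L)%C <= M * Re (k a + lsum k L)%C).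
    rewrite re_plus, Rmult_plus_distr_l.
    eapply Rle_trans; [apply Cmod_triangle|]. apply Rplus_le_compat.
    + apply H. now left.
    + apply IH. intros t Ht. apply H. now right.
Qed.

(** All the deficits [M * Re (k t) - Re (h t)] are nonnegative, so a single one is at most their
    sum. *)
Lemma lsum_deficit (h k : R -> C) (M : R) L s :
  (forall t, In t L -> Cmod (h t) <= M * Re (k t)) -> In s L ->
  M * Re (k s) - Re (h s) <= M * Re (lsum k L) - Re (lsum h L).
Proof.
  intros H Hin. induction L as [|a L IH]; [contradiction|].
  change (lsum h (a :: L)) with (h a + lsum h L)%C.
  change (lsum k (a :: L)) with (k a + lsum k L)%C.
  rewrite !re_plus.
  assert (Hre : forall z, Re z <= Cmod z).
  { intros z. eapply Rle_trans; [apply Rle_abs|apply re_le_Cmod]. }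
  destruct Hin as [->|Hin].
  - pose proof (lsum_dominated h k M L (fun t Ht => H t (or_intror Ht))).
    pose proof (Hre (lsum h L)). lra.
  - specialize (IH (fun t Ht => H t (or_intror Ht)) Hin).
    pose proof (H a (or_introl eq_refl)). pose proof (Hre (h a)). lra.
Qed.

Lemma real_of_Re_ge_Cmod (z : C) : Cmod z <= Re z -> z = RtoC (Re z).
Proof.
  intros H. pose proof (Cmod2_alt z) as N. pose proof (Cmod_ge_0 z).
  assert (Im z = 0).
  { apply Rsqr_0_uniq. pose proof (Rle_0_sqr (Im z)). unfold Rsqr in *. simpl in N. nra. }
  destruct z as [x y]. unfold Im, Re, RtoC in *; simpl in *. now subst y.
Qed.

Section Extremal.
Variable f : C -> C.
Variable M : R.
Hypothesis Hf : forall z, cdiff f z.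
Hypothesis Hgrowth : forall eps, 0 < eps ->
  exists B, forall z, Cmod (f z) <= B * exp ((1 + eps) * Cmod z).
Hypothesis HM : forall x, Cmod (RtoC x * f (RtoC x))%C <= M.

Lemma sup_nonneg : 0 <= M.
Proof. eapply Rle_trans; [apply Cmod_ge_0|apply (HM 0)]. Qed.

(** The factor [z] is absorbed by the room [eps] in the exponential type, and [M + 1] rather
    than [M] keeps the constant positive. *)
Lemma growth_along_strips (z : C) : Cmod (z * f z)%C <= (M + 1) * exp (Rabs (Im z)).
Proof.
  pose proof sup_nonneg as HM0.
  apply (exponential_type_bound (fun z => z * f z)%C (M + 1)); [|lra| |].
  - intros w. apply cdiff_mult; auto using cdiff_id.
  - intros eps He. destruct (Hgrowth (eps / 2)) as [B HB]; [lra|].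
    exists (2 / eps * B). intros w. rewrite Cmod_mult.
    replace ((1 + eps) * Cmod w) with (eps / 2 * Cmod w + (1 + eps / 2) * Cmod w) by field.
    rewrite exp_plus.
    replace (2 / eps * B * (exp (eps / 2 * Cmod w) * exp ((1 + eps / 2) * Cmod w)))
      with ((2 / eps * exp (eps / 2 * Cmod w)) * (B * exp ((1 + eps / 2) * Cmod w))) by ring.
    apply Rmult_le_compat; auto using Cmod_ge_0.
    pose proof (exp_ineq1_le (eps / 2 * Cmod w)).
    apply Rle_trans with (2 / eps * (eps / 2 * Cmod w)).
    + right. field. lra.
    + apply Rmult_le_compat_l; [|lra]. apply Rlt_le, Rdiv_lt_0_compat; lra.
  - intros x. specialize (HM x). lra.
Qed.

Lemma Ccos_real_neq_0 (x : R) : Rabs x < PI / 2 -> Ccos (RtoC x) <> 0%C.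
Proof.
  intros Hx E. destruct (Ccos_zero _ E) as [_ E']. rewrite re_RtoC in E'.
  pose proof (node_ge x E'). lra.
Qed.

(** Since [|t| >= PI / 2 > |x|], the numbers [t] and [t - x] have the same sign, so that
    [sinc t * sinc (x - t) = cos x / (t (t - x))] is positive; and [|sin t| = 1] turns the
    hypothesis [|t f t| <= M] into [|f t| <= M * |sinc t|]. *)
Lemma cardinal_terms_dominated (x t : R) : Rabs x < PI / 2 -> cos t = 0 ->
  Cmod (f (RtoC t) * sinc (RtoC x - RtoC t))%C
    <= M * Re (sinc (RtoC t) * sinc (RtoC x - RtoC t))%C.
Proof.
  intros Hx Ht. pose proof (node_ge t Ht) as Hge. assert (PP := PI_RGT_0).
  pose proof (node_sin_sqr t Ht) as S1.
  apply Rabs_lt_between in Hx.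
  assert (Sgn : 0 < t * (t - x)).
  { unfold Rabs in Hge. destruct (Rcase_abs t); nra. }
  assert (T0 : t <> 0) by (intros ->; lra).
  assert (T1 : x - t <> 0) by (intros E; replace (t - x) with 0 in Sgn by lra; lra).
  rewrite <- RtoC_minus, !sinc_RtoC, <- RtoC_mult, re_RtoC.
  rewrite Cmod_mult, Cmod_R.
  assert (Ft : Cmod (f (RtoC t)) <= M * Rabs (rsinc t)).
  { rewrite rsinc_neq_0 by auto. unfold Rdiv. rewrite Rabs_mult, Rabs_inv.
    assert (Sa : Rabs (sin t) = 1).
    { assert (Q : Rabs (sin t) * Rabs (sin t) = 1) by (rewrite <- Rabs_mult, S1; apply Rabs_R1).
      pose proof (Rabs_pos (sin t)). nra. }
    rewrite Sa, Rmult_1_l. apply Rle_div_r; [now apply Rabs_pos_lt|].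
    specialize (HM t). rewrite Cmod_mult, Cmod_R in HM. lra. }
  assert (Pr : 0 <= rsinc t * rsinc (x - t)).
  { rewrite !rsinc_neq_0, sin_minus, Ht by auto.
    replace (sin t / t * ((sin x * 0 - cos x * sin t) / (x - t)))
      with (sin t * sin t * cos x / (t * (t - x))) by (field; lra).
    rewrite S1, Rmult_1_l. apply Rdiv_le_0_compat; auto. apply cos_ge_0; lra. }
  eapply Rle_trans; [apply Rmult_le_compat_r; [apply Rabs_pos|apply Ft]|].
  rewrite Rmult_assoc, <- Rabs_mult, Rabs_pos_eq by auto. apply Rle_refl.
Qed.

(** The dominated terms sum to the cardinal series of [sinc] itself. *)
Lemma le_rsinc (x : R) : Rabs x < PI / 2 -> Cmod (f (RtoC x)) <= M * rsinc x.
Proof.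
  intros Hx. pose proof sup_nonneg as HM0.
  apply Rnot_lt_le. intros Hlt.
  set (e := (Cmod (f (RtoC x)) - M * rsinc x) / (2 * (M + 1))).
  assert (He : 0 < e) by (apply Rdiv_lt_0_compat; lra).
  assert (Ee : e * (2 * (M + 1)) = Cmod (f (RtoC x)) - M * rsinc x) by (unfold e; field; lra).
  pose proof (Ccos_real_neq_0 x Hx) as Nx.
  destruct (cardinal_series_converges f (M + 1) (RtoC x) Hf growth_along_strips Nx e He) as [N1 H1].
  destruct (cardinal_series_converges sinc 2 (RtoC x) cdiff_sinc sinc_bound Nx e He) as [N2 H2].
  specialize (H1 (N1 + N2)%nat ltac:(lia)). specialize (H2 (N1 + N2)%nat ltac:(lia)).
  set (L := nodes (N1 + N2)) in *.
  assert (D : Cmod (cardinal_sum f L (RtoC x)) <= M * Re (cardinal_sum sinc L (RtoC x))).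
  { apply lsum_dominated. intros t Ht. apply cardinal_terms_dominated; auto.
    apply nodes_spec in Ht. tauto. }
  pose proof (Cmod_ge_sub (f (RtoC x)) (cardinal_sum f L (RtoC x))) as T1.
  pose proof (re_le_Cmod (sinc (RtoC x) - cardinal_sum sinc L (RtoC x))) as T2.
  rewrite re_minus in T2. apply Rabs_le_between in T2.
  fold (rsinc x) in T2.
  assert (M * Re (cardinal_sum sinc L (RtoC x)) <= M * (rsinc x + e)).
  { apply Rmult_le_compat_l; lra. }
  lra.
Qed.

Lemma bound_on_reals (x : R) : Cmod (f (RtoC x)) <= M.
Proof.
  pose proof sup_nonneg as HM0. pose proof PI2_1 as P1.
  destruct (Rlt_le_dec (Rabs x) (PI / 2)) as [H|H].
  - eapply Rle_trans; [now apply le_rsinc|].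
    destruct (Req_dec x 0) as [->|Hx].
    + rewrite rsinc_0. lra.
    + pose proof (rsinc_lt_1 x Hx H). nra.
  - specialize (HM x). rewrite Cmod_mult, Cmod_R in HM.
    pose proof (Cmod_ge_0 (f (RtoC x))). nra.
Qed.

(** Away from [0] equality forces [M = 0], and then [f 0 = 0] as well. *)
Lemma extremal_at_0 (x : R) : Cmod (f (RtoC x)) = M -> Cmod (f 0%C) = M.
Proof.
  intros E. pose proof sup_nonneg as HM0. pose proof PI2_1 as P1.
  destruct (Req_dec x 0) as [->|Hx]; auto.
  assert (Z : M = 0).
  { destruct (Rlt_le_dec (Rabs x) (PI / 2)) as [H|H].
    - pose proof (le_rsinc x H). pose proof (rsinc_lt_1 x Hx H). nra.
    - specialize (HM x). rewrite Cmod_mult, Cmod_R, E in HM. nra. }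
  pose proof (bound_on_reals 0). pose proof (Cmod_ge_0 (f 0%C)). lra.
Qed.

(** With [u * f 0 = M], the series of [u * f 0] has sum [M], and its terms [h t] are dominated by
    [M * k t], whose sum is also [M]. So no term has a deficit, and [h s = M * k s]. *)
Lemma extremal_at_nodes (s : R) : Cmod (f 0%C) = M -> cos s = 0 ->
  f (RtoC s) = (f 0%C * sinc (RtoC s))%C.
Proof.
  intros E Hs. pose proof sup_nonneg as HM0. assert (PP := PI_RGT_0).
  destruct (unimodular_factor (f 0%C)) as [u [Hu Eu]]. rewrite E in Eu.
  pose (h := fun t => (u * (f (RtoC t) * sinc (RtoC 0 - RtoC t)))%C).
  pose (k := fun t => (sinc (RtoC t) * sinc (RtoC 0 - RtoC t))%C).
  assert (Z0 : Rabs 0 < PI / 2) by (rewrite Rabs_R0; lra).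
  assert (Dom : forall t, cos t = 0 -> Cmod (h t) <= M * Re (k t)).
  { intros t Ht. unfold h. rewrite Cmod_mult, Hu, Rmult_1_l.
    now apply cardinal_terms_dominated. }
  assert (Key : M * Re (k s) <= Re (h s)).
  { apply Rnot_lt_le. intros Hlt.
    (* Both partial sums within [e] of [M] and 1 leave a total deficit of at most [(M + 1) * e],
       half of the supposed deficit at [s]. *)
    set (e := (M * Re (k s) - Re (h s)) / (2 * (M + 1))).
    assert (He : 0 < e) by (apply Rdiv_lt_0_compat; lra).
    assert (Ee : e * (2 * (M + 1)) = M * Re (k s) - Re (h s)) by (unfold e; field; lra).
    pose proof (Ccos_real_neq_0 0 Z0) as Nx.
    destruct (cardinal_series_converges f (M + 1) (RtoC 0) Hf growth_along_strips Nx e He) as [N1 H1].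
    destruct (cardinal_series_converges sinc 2 (RtoC 0) cdiff_sinc sinc_bound Nx e He) as [N2 H2].
    destruct (exists_node_radius (Rabs s)) as [N3 H3].
    specialize (H1 (N1 + N2 + N3)%nat ltac:(lia)). specialize (H2 (N1 + N2 + N3)%nat ltac:(lia)).
    specialize (H3 (N1 + N2 + N3)%nat ltac:(lia)).
    set (N := (N1 + N2 + N3)%nat) in *.
    assert (Hin : In s (nodes N)) by (apply nodes_spec; tauto).
    pose proof (lsum_deficit h k M (nodes N) s
      (fun t Ht => Dom t (proj1 (proj1 (nodes_spec N t) Ht))) Hin) as Def.
    assert (Eh : lsum h (nodes N) = (u * cardinal_sum f (nodes N) (RtoC 0))%C).
    { unfold cardinal_sum. rewrite lsum_mult. reflexivity. }
    change (lsum k (nodes N)) with (cardinal_sum sinc (nodes N) (RtoC 0)) in Def.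
    rewrite Eh in Def.
    pose proof (re_le_Cmod (sinc (RtoC 0) - cardinal_sum sinc (nodes N) (RtoC 0))) as T2.
    rewrite re_minus in T2. apply Rabs_le_between in T2.
    fold (rsinc 0) in T2. rewrite rsinc_0 in T2.
    pose proof (re_le_Cmod (u * (f (RtoC 0) - cardinal_sum f (nodes N) (RtoC 0)))) as T1.
    rewrite Cmod_mult, Hu, Rmult_1_l in T1.
    replace (u * (f (RtoC 0) - cardinal_sum f (nodes N) (RtoC 0)))%C
      with (RtoC M + - (u * cardinal_sum f (nodes N) (RtoC 0)))%C in T1 by (rewrite <- Eu; ring).
    rewrite re_plus, re_opp, re_RtoC in T1. apply Rabs_le_between in T1.
    assert (M * Re (cardinal_sum sinc (nodes N) (RtoC 0)) <= M * (1 + e)).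
    { apply Rmult_le_compat_l; lra. }
    lra. }
  pose proof (node_ge s Hs) as Hge.
  assert (S0 : s <> 0) by (intros ->; rewrite Rabs_R0 in Hge; lra).
  assert (Ns : rsinc (0 - s) <> 0).
  { rewrite rsinc_neq_0, Rminus_0_l, sin_neg by lra.
    replace (- sin s / - s) with (sin s / s) by (field; auto).
    intros F. pose proof (node_sin_sqr s Hs) as S1.
    assert (sin s = 0) by (replace (sin s) with (sin s / s * s) by (field; auto); rewrite F; ring).
    nra. }
  assert (Val : h s = (RtoC M * k s)%C).
  { pose proof (Dom s Hs) as Ds.
    rewrite (real_of_Re_ge_Cmod (h s)) by lra.
    assert (Er : Re (h s) = M * Re (k s)).
    { apply Rle_antisym; [|exact Key].
      eapply Rle_trans; [|exact Ds]. eapply Rle_trans; [apply Rle_abs|apply re_le_Cmod]. }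
    rewrite Er, RtoC_mult. f_equal. unfold k.
    rewrite <- RtoC_minus, !sinc_RtoC, <- RtoC_mult, re_RtoC. reflexivity. }
  unfold h, k in Val. rewrite <- Eu, <- RtoC_minus, (sinc_RtoC (0 - s)) in Val.
  assert (Nu : u <> 0%C) by (intros ->; rewrite Cmod_0 in Hu; lra).
  assert (Nr : RtoC (rsinc (0 - s)) <> 0%C) by (intros F; injection F; auto).
  set (r := RtoC (rsinc (0 - s))) in *.
  replace (f (RtoC s)) with (/ (u * r) * (u * (f (RtoC s) * r)))%C by (field; auto).
  rewrite Val. field. auto.
Qed.

(** The difference [d] of the two sides vanishes at all nodes, so its cardinal series is zero.
    The series represents [d] off the zeros of the cosine, and the zeros are the nodes. *)
Lemma extremal_is_sinc : Cmod (f 0%C) = M -> forall z, f z = (f 0%C * sinc z)%C.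
Proof.
  intros E z.
  assert (D0 : (f z - f 0%C * sinc z)%C = 0%C).
  2:{ replace (f z) with (f z - f 0%C * sinc z + f 0%C * sinc z)%C by ring. rewrite D0. ring. }
  destruct (Ceq_dec (Ccos z) 0%C) as [Ez|Nz].
  { destruct (Ccos_zero z Ez) as [E1 Hc]. pose proof (extremal_at_nodes _ E Hc) as E2.
    rewrite <- E1 in E2. rewrite E2. ring. }
  pose (d := fun w => (f w - f 0%C * sinc w)%C).
  assert (Dd : forall w, cdiff d w).
  { intros w. apply cdiff_minus; auto. apply cdiff_mult; [apply cdiff_const|apply cdiff_sinc]. }
  assert (Bd : forall w, Cmod (w * d w)%C <= ((M + 1) + M * 2) * exp (Rabs (Im w))).
  { intros w. unfold d.
    replace (w * (f w - f 0%C * sinc w))%C with (w * f w - f 0%C * (w * sinc w))%C by ring.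
    eapply Rle_trans; [apply Cmod_triangle|].
    rewrite Cmod_opp, (Cmod_mult (f 0%C)), E.
    pose proof (growth_along_strips w). pose proof (sinc_bound w). pose proof sup_nonneg.
    assert (M * Cmod (w * sinc w)%C <= M * (2 * exp (Rabs (Im w)))) by (apply Rmult_le_compat_l; auto).
    lra. }
  apply Cmod_eq_0. apply Rle_antisym; [|apply Cmod_ge_0].
  apply Rnot_lt_le. intros Hp.
  destruct (cardinal_series_converges d _ z Dd Bd Nz (Cmod (d z) / 2)) as [N H]; [unfold d; lra|].
  specialize (H N (Nat.le_refl N)).
  unfold cardinal_sum in H. rewrite lsum_zero in H.
  - replace (d z - 0)%C with (d z) in H by ring. unfold d in H. lra.
  - intros t Ht. apply nodes_spec in Ht. unfold d. rewrite (extremal_at_nodes t E) by tauto. ring.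
Qed.
End Extremal.

(** * Exponential type, suprema and rescaling *)

Lemma exp_type_eventual_bound (gamma : R) (f : C -> C) : exp_type gamma f ->
  forall eps, 0 < eps -> exists r B, 0 <= B /\
    forall z, r < Cmod z -> Cmod (f z) <= B * exp ((gamma + eps) * Cmod z).
Proof.
  intros [_ Hl] eps He. specialize (Hl eps He). unfold limsup_infty in Hl.
  set (E := fun s : Rbar => exists r : R, s = Lub_Rbar (fun y => exists z : C, r < Cmod z /\
     y = Cmod (f z) * exp (- ((gamma + eps) * Cmod z)))) in *.
  assert (X : exists s, E s /\ s <> p_infty).
  { apply NNPP. intros F.
    assert (G : Rbar_le p_infty (Rbar_glb E)).
    { apply (proj2 (proj2_sig (Rbar_ex_glb E))). intros s Hs.
      destruct (classic (s = p_infty)) as [->|N]; [apply Rbar_le_refl|].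
      elim F. exists s. auto. }
    exact (Rbar_lt_not_le _ _ Hl G). }
  destruct X as [s [[r Hs] Ns]].
  exists r, (Rabs (real s)). split; [apply Rabs_pos|]. intros z Hz.
  pose proof (proj1 (Lub_Rbar_correct (fun y => exists z : C, r < Cmod z /\
     y = Cmod (f z) * exp (- ((gamma + eps) * Cmod z))))) as Ub.
  specialize (Ub (Cmod (f z) * exp (- ((gamma + eps) * Cmod z)))).
  rewrite <- Hs in Ub. specialize (Ub ltac:(eauto)).
  destruct s as [s| |]; [|now elim Ns|contradiction]. simpl in *.
  pose proof (exp_pos ((gamma + eps) * Cmod z)) as Ep.
  rewrite exp_Ropp in Ub.
  apply Rmult_le_compat_r with (r := exp ((gamma + eps) * Cmod z)) in Ub; [|lra].
  rewrite Rmult_assoc, Rinv_l, Rmult_1_r in Ub by lra.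
  eapply Rle_trans; [apply Ub|]. apply Rmult_le_compat_r; [lra|apply Rle_abs].
Qed.

(** The bound holds outside some disc by definition; inside, the maximum principle carries over the
    bound from a slightly larger circle. *)
Lemma exp_type_growth (gamma : R) (f : C -> C) : 0 <= gamma -> exp_type gamma f ->
  forall eps, 0 < eps -> exists B, forall z, Cmod (f z) <= B * exp ((gamma + eps) * Cmod z).
Proof.
  intros Hg Hf eps He.
  destruct (exp_type_eventual_bound gamma f Hf eps He) as (r & B & HB & Hb).
  set (rho := Rabs r + 1). assert (Hr : r < rho) by (pose proof (Rle_abs r); unfold rho; lra).
  set (B' := B * exp ((gamma + eps) * rho)).
  assert (HB' : 0 <= B') by (apply Rmult_le_pos; [auto|left; apply exp_pos]).
  assert (Disc : forall z, Cmod z <= rho -> Cmod (f z) <= B').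
  { apply (maximum_principle (fun z => Cmod z <= rho) f rho B'); auto.
    - intros z Hz. exists (Cmod z - rho). split; [lra|]. intros w Hw F.
      rewrite Cmod_sub_sym in Hw. pose proof (Cmod_ge_sub z w). lra.
    - intros z _. apply ex_derive_cdiff. apply Hf.
    - intros z Hz. destruct (Req_dec (Cmod z) rho) as [E|N].
      + left. unfold B'. rewrite <- E. apply Hb. lra.
      + right. exists (rho - Cmod z). split; [lra|]. intros w Hw.
        pose proof (Cmod_ge_sub w z). lra. }
  exists (B + B'). intros z.
  assert (E1 : 1 <= exp ((gamma + eps) * Cmod z)).
  { rewrite <- exp_0 at 1. apply exp_monotone. apply Rmult_le_pos; [lra|apply Cmod_ge_0]. }
  destruct (Rle_lt_dec (Cmod z) rho) as [L|L].
  - specialize (Disc z L). nra.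
  - specialize (Hb z ltac:(lra)). nra.
Qed.

Lemma sup_norm_cases (g : R -> C) :
  sup_norm g = p_infty \/ exists m, sup_norm g = Finite m /\ forall t, Cmod (g t) <= m.
Proof.
  unfold sup_norm. pose proof (proj1 (Lub_Rbar_correct (fun y => exists t, y = Cmod (g t)))) as U.
  assert (U' : forall t, Rbar_le (Cmod (g t)) (Lub_Rbar (fun y => exists t, y = Cmod (g t)))).
  { intros t. apply U. now exists t. }
  destruct (Lub_Rbar _) as [m| |]; auto.
  - right. exists m. auto.
  - elim (U' 0).
Qed.

Lemma Rbar_mult_pos_p_infty (s : R) : 0 < s -> Rbar_mult (Finite s) p_infty = p_infty.
Proof.
  intros Hs. apply is_Rbar_mult_unique. unfold is_Rbar_mult. simpl.
  destruct (Rle_dec 0 s) as [H|H]; [|lra].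
  destruct (Rle_lt_or_eq_dec 0 s H); [auto|lra].
Qed.

Lemma sin_quot_sinc (sigma : R) (z : C) : sigma <> 0 ->
  sin_quot sigma z = (RtoC sigma * sinc (RtoC sigma * z))%C.
Proof.
  intros Hs. assert (Ns : RtoC sigma <> 0%C) by (intros E; injection E; auto).
  unfold sin_quot. destruct (Ceq_dec z 0%C) as [->|N].
  - rewrite Cmult_0_r, sinc_0. ring.
  - rewrite sinc_neq_0 by (apply Cmult_neq_0; auto). field. auto.
Qed.

Lemma rescaled_hypotheses (sigma m : R) (f : C -> C) : 0 < sigma -> exp_type sigma f ->
  (forall t, Cmod (RtoC t * f (RtoC t))%C <= m) ->
  let g := fun z => f (RtoC (/ sigma) * z)%C in
  (forall z, cdiff g z) /\
  (forall eps, 0 < eps -> exists B, forall z, Cmod (g z) <= B * exp ((1 + eps) * Cmod z)) /\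
  (forall x, Cmod (RtoC x * g (RtoC x))%C <= sigma * m).
Proof.
  intros Hs Hf Hm g. split; [|split].
  - intros z. apply (cdiff_comp (fun z => RtoC (/ sigma) * z)%C f).
    + apply cdiff_mult; [apply cdiff_const|apply cdiff_id].
    + apply ex_derive_cdiff, Hf.
  - intros eps He.
    destruct (exp_type_growth sigma f (Rlt_le _ _ Hs) Hf (eps * sigma)) as [B HB]; [nra|].
    exists B. intros z. unfold g. eapply Rle_trans; [apply HB|].
    rewrite Cmod_mult, Cmod_R, Rabs_pos_eq by (left; now apply Rinv_0_lt_compat).
    right. do 2 f_equal. field. lra.
  - intros x. unfold g. rewrite <- RtoC_mult.
    replace (RtoC x) with (RtoC sigma * RtoC (/ sigma * x))%C.
    + rewrite <- Cmult_assoc, Cmod_mult, Cmod_R, (Rabs_pos_eq sigma) by lra.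
      apply Rmult_le_compat_l; [lra|apply Hm].
    + rewrite <- RtoC_mult. f_equal. field. lra.
Qed.

(** The supremum is attained where [sin (sigma t) = 1]. *)
Lemma sup_norm_sin (sigma S : R) (f : C -> C) : 0 < sigma ->
  (forall z, f z = (RtoC S * sin_quot sigma z)%C) ->
  sup_norm (fun t => RtoC t * f (RtoC t))%C = Finite (Rabs S).
Proof.
  intros Hs Hf.
  assert (V : forall t, Cmod (RtoC t * f (RtoC t))%C = Rabs S * Rabs (sin (sigma * t))).
  { intros t. rewrite Hf, sin_quot_sinc by lra.
    replace (RtoC t * (RtoC S * (RtoC sigma * sinc (RtoC sigma * RtoC t))))%C
      with (RtoC S * ((RtoC sigma * RtoC t) * sinc (RtoC sigma * RtoC t)))%C by ring.
    rewrite sinc_spec, <- RtoC_mult, Csin_RtoC, <- RtoC_mult, Cmod_R. apply Rabs_mult. }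
  apply is_lub_Rbar_unique. split.
  - intros y [t ->]. rewrite V. simpl.
    assert (Rabs (sin (sigma * t)) <= 1) by (apply Rabs_le, SIN_bound).
    pose proof (Rabs_pos S). nra.
  - intros b Hb. apply Hb. exists (PI / 2 / sigma). rewrite V.
    replace (sigma * (PI / 2 / sigma)) with (PI / 2) by (field; lra).
    rewrite sin_PI2, Rabs_R1. ring.
Qed.

Theorem corollary1p6 (sigma : R) (hsigma : 0 < sigma) :
  (forall f : C -> C, exp_type sigma f ->
     forall x : R,
       Rbar_le (Finite (Cmod (f (RtoC x))))
         (Rbar_mult (Finite sigma)
            (sup_norm (fun t : R => (RtoC t * f (RtoC t))%C)))) /\
  (forall f : C -> C, exp_type sigma f ->
     (forall x : R, Im (f (RtoC x)) = 0) ->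
     ~ (forall z : C, f z = RtoC 0) ->
     ((exists x0 : R,
         Finite (Cmod (f (RtoC x0))) =
           Rbar_mult (Finite sigma)
             (sup_norm (fun t : R => (RtoC t * f (RtoC t))%C)))
      <->
      (exists S : R, S <> 0 /\
         forall z : C, f z = (RtoC S * sin_quot sigma z)%C))).
Proof.
  assert (Unscale : forall z, (RtoC (/ sigma) * (RtoC sigma * z))%C = z).
  { intros z. rewrite Cmult_assoc, <- RtoC_mult, Rinv_l by lra. ring. }
  split.
  - intros f Hf x.
    destruct (sup_norm_cases (fun t => RtoC t * f (RtoC t))%C) as [->|[m [-> Hm]]].
    + rewrite Rbar_mult_pos_p_infty by auto. exact I.
    + destruct (rescaled_hypotheses sigma m f hsigma Hf Hm) as (Dg & Gg & Bg).
      pose proof (bound_on_reals _ _ Dg Gg Bg (sigma * x)) as Bd. simpl in Bd.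
      rewrite RtoC_mult, Unscale in Bd. exact Bd.
  - intros f Hf Hreal Hnz. split.
    + intros [x0 Heq].
      destruct (sup_norm_cases (fun t => RtoC t * f (RtoC t))%C) as [Ei|[m [Em Hm]]].
      { rewrite Ei, Rbar_mult_pos_p_infty in Heq by auto. discriminate. }
      rewrite Em in Heq. simpl in Heq. injection Heq as Heq.
      destruct (rescaled_hypotheses sigma m f hsigma Hf Hm) as (Dg & Gg & Bg).
      assert (E0 : Cmod (f (RtoC (/ sigma) * RtoC 0)%C) = sigma * m).
      { apply (extremal_at_0 _ _ Dg Gg Bg (sigma * x0)).
        now rewrite RtoC_mult, Unscale. }
      pose proof (extremal_is_sinc _ _ Dg Gg Bg E0) as Hsinc.
      assert (Ef : forall z, f z = (f 0%C * sinc (RtoC sigma * z))%C).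
      { intros z. specialize (Hsinc (RtoC sigma * z)%C). cbv beta in Hsinc.
        now rewrite Unscale, Cmult_0_r in Hsinc. }
      assert (R0 : f 0%C = RtoC (Re (f 0%C))).
      { specialize (Hreal 0). destruct (f (RtoC 0)) as [a b].
        unfold Im, Re, RtoC in *; simpl in *. now subst b. }
      assert (Es : forall z, f z = (RtoC (Re (f 0%C) / sigma) * sin_quot sigma z)%C).
      { intros z. rewrite sin_quot_sinc by lra.
        rewrite (Ef z), R0 at 1. unfold Rdiv. rewrite Cmult_assoc, <- RtoC_mult.
        do 2 f_equal. field. lra. }
      exists (Re (f 0%C) / sigma). split; auto.
      intros F. apply Hnz. intros z. rewrite Es, F. ring.
    + intros [S [HS Hz]]. exists 0.
      rewrite (sup_norm_sin sigma S f hsigma Hz), Hz.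
      unfold sin_quot. destruct (Ceq_dec (RtoC 0) 0%C) as [_|N]; [|now elim N].
      rewrite Cmod_mult, !Cmod_R, (Rabs_pos_eq sigma) by lra.
      simpl. f_equal. ring.
Qed.
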